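(* Let $p$ be an odd prime, let $k$ be the field with $p$ elements, and let $G$ be a finite $p$-group such that $\gamma_2(G)^p\gamma_4(G)=1$ and $|G:\Phi(G)|=|G:\mathrm{Z}_2(G)|=p^3$. If $G$ has nilpotency class $3$, assume furthermore that $[[K_G,G],G]\subseteq[K_G,\gamma_2(G)]$, where $K_G$ is the subgroup of $G$ defined in the context. Then the isomorphism type of $G$ is determined by the unit group of the small group algebra of $kG$, that is: for every finite $p$-group $H$ with $\gamma_2(H)^p\gamma_4(H)=1$, if the unit groups of the small group algebras of $kG$ and $kH$ are isomorphic, then $G\cong H$. Moreover, the Modular Isomorphism Problem has a positive answer for $G$: for every group $H$, if $kG\cong kH$ as rings, then $G\cong H$.
   Context: $\gamma_i(G)$ is the $i$-th term of the lower central series, $\mathrm{Z}_2(G)$ the second term of the upper central series, $\mathrm{Z}(G)$ the centre, $\Phi(G)$ the Frattini subgroup, $X^p=\langle x^p\mid x\in X\rangle$, and $\Gamma(G)=\mathrm{Z}(G)\cap\gamma_2(G)$. $kG$ is the group algebra, $I(kG)$ its augmentation ideal, $I(k\gamma_2(G))$ the augmentation ideal of $k\gamma_2(G)\subseteq kG$. For a finite $p$-group $G$ with $\gamma_2(G)^p\gamma_4(G)=1$, the small group algebra of $kG$ is $kG/I(kG)I(k\gamma_2(G))$. Definition of $K_G$. Let $G$ satisfy the hypotheses above and have class $3$. Then $\Phi(G)=\mathrm{Z}_2(G)$, and $G/\mathrm{Z}_2(G)$ is a $3$-dimensional $k$-vector space; the commutator map induces a surjective $k$-linear map $\wedge^2(G/\mathrm{Z}_2(G))\to\gamma_2(G)/\Gamma(G)$,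 and $|\gamma_2(G):\Gamma(G)|\in\{p^2,p^3\}$. The subgroup $K_G$ contains $\mathrm{Z}_2(G)$ and is such that the sequence $$1\to\wedge^2(K_G/\mathrm{Z}_2(G))\to\wedge^2(G/\mathrm{Z}_2(G))\to\gamma_2(G)/\Gamma(G)\to1$$ induced by the commutator map is exact. Explicitly: if $|\gamma_2(G):\Gamma(G)|=p^3$, then $K_G=\mathrm{Z}_2(G)$; if $|\gamma_2(G):\Gamma(G)|=p^2$, then $K_G$ is the unique subgroup containing $\mathrm{Z}_2(G)$ with this property, and it is a maximal subgroup of $G$. *)

(* Defs.v *)
From HB Require Import structures.
From mathcomp Require Import all_boot all_order all_algebra.
From mathcomp Require Import all_fingroup all_solvable.
From mathcomp Require Import finmap generic_quotient ring_quotient.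
From mathcomp.classical Require Import boolp.
From mathcomp.multinomials Require Import monalg.

Set Implicit Arguments.
Unset Strict Implicit.
Unset Printing Implicit Defensive.

Import GRing.Theory.
Local Open Scope fset_scope.
Local Open Scope quotient_scope.
Local Open Scope ring_scope.

Definition group_isom (G H : groupType) : Prop :=
  exists f : {multiplicative G -> H}, bijective f.

Definition ring_isom (R S : pzRingType) : Prop :=
  exists f : {rmorphism R -> S}, bijective f.

(* A unit is a pair of mutually inverse elements, so that inversion needs no
   choice and the ring need not be a unitRingType. *)
Section UnitGroup.
Variable R : pzRingType.

Definition unit_group : Type :=
  {u : R * R | (u.1 * u.2 == 1) && (u.2 * u.1 == 1)}.
HB.instance Definition _ := Choice.on unit_group.

Implicit Types u v w : unit_group.

Fact unit_group_mul_subproof u v :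
  ((val u).1 * (val v).1 * ((val v).2 * (val u).2) == 1)
  && ((val v).2 * (val u).2 * ((val u).1 * (val v).1) == 1).
Proof.
case: u v => [[a b] /= /andP[/eqP ab /eqP ba]] [[c d] /= /andP[/eqP cd /eqP dc]].
rewrite -mulrA (mulrA c) cd mul1r ab eqxx /=.
by rewrite -mulrA (mulrA b) ba mul1r dc.
Qed.

Fact unit_group_inv_subproof u :
  ((val u).2 * (val u).1 == 1) && ((val u).1 * (val u).2 == 1).
Proof. by rewrite andbC (valP u). Qed.

Fact unit_group_one_subproof :
  (((1, 1) : R * R).1 * ((1, 1) : R * R).2 == 1)
  && (((1, 1) : R * R).2 * ((1, 1) : R * R).1 == 1).
Proof. by rewrite /= mulr1 eqxx. Qed.

Definition unit_group_mul u v : unit_group :=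
  exist _ ((val u).1 * (val v).1, (val v).2 * (val u).2)
    (unit_group_mul_subproof u v).
Definition unit_group_inv u : unit_group :=
  exist _ ((val u).2, (val u).1) (unit_group_inv_subproof u).
Definition unit_group_one : unit_group := exist _ (1, 1) unit_group_one_subproof.

Fact unit_group_mulA : associative unit_group_mul.
Proof. by move=> u v w; apply: val_inj; rewrite /= !mulrA. Qed.
Fact unit_group_mul1g : left_id unit_group_one unit_group_mul.
Proof. by move=> [[a b] ab]; apply: val_inj; rewrite /= mul1r mulr1. Qed.
Fact unit_group_mulg1 : right_id unit_group_one unit_group_mul.
Proof. by move=> [[a b] ab]; apply: val_inj; rewrite /= mul1r mulr1. Qed.
Fact unit_group_mulVg :
  left_inverse unit_group_one unit_group_inv unit_group_mul.
Proof.
by move=> [[a b] ab]; apply: val_inj => /=; case/andP: ab => _ /eqP/= ->.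
Qed.
Fact unit_group_mulgV :
  right_inverse unit_group_one unit_group_inv unit_group_mul.
Proof.
by move=> [[a b] ab]; apply: val_inj => /=; case/andP: ab => /eqP/= ->.
Qed.

HB.instance Definition _ := isGroup.Build unit_group
  unit_group_mulA unit_group_mul1g unit_group_mulg1
  unit_group_mulVg unit_group_mulgV.

End UnitGroup.

HB.mixin Record isTwoSided (R : pzRingType) (S : R -> bool) := {
  twosidedMl : forall a, {in S, forall u, a * u \in S};
  twosidedMr : forall a, {in S, forall u, u * a \in S}
}.

#[short(type="twoSidedIdeal")]
HB.structure Definition TwoSidedIdeal (R : pzRingType) :=
  {S of GRing.ZmodClosed R S & isTwoSided R S}.

(* The library only makes the quotient of a commutative ring a ring. *)
Section IdealQuotient.
Variables (R : pzRingType) (I : twoSidedIdeal R).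

Definition ring_quot : Type := Quotient.quot I.
HB.instance Definition _ := GRing.Zmodule.on ring_quot.
HB.instance Definition _ := EqQuotient.on ring_quot.

Definition ring_quot_one : ring_quot := \pi_ring_quot 1.
Definition ring_quot_mul := lift_op2 ring_quot *%R.

Lemma pi_ring_quot_eq (a b : R) :
  (\pi_ring_quot a == \pi_ring_quot b) = (a - b \in I).
Proof. by rewrite [RHS](@Quotient.idealrBE R I). Qed.

Lemma pi_ring_quotM (a b : R) :
  ring_quot_mul (\pi_ring_quot a) (\pi_ring_quot b) = \pi_ring_quot (a * b).
Proof.
apply/eqP; rewrite /ring_quot_mul -lock pi_ring_quot_eq.
set a' := repr _; set b' := repr _.
have ha : a' - a \in I by rewrite -pi_ring_quot_eq reprK.
have hb : b' - b \in I by rewrite -pi_ring_quot_eq reprK.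
have -> : a' * b' - a * b = (a' - a) * b' + a * (b' - b).
  by rewrite mulrBl mulrBr addrA subrK.
by apply: rpredD; [apply: twosidedMr | apply: twosidedMl].
Qed.

Lemma pi_ring_quotD (a b : R) :
  \pi_ring_quot (a + b) = \pi_ring_quot a + \pi_ring_quot b.
Proof. exact: (@Quotient.pi_add R I). Qed.

Fact ring_quot_mulA : associative ring_quot_mul.
Proof.
by move=> x y z; rewrite -[x]reprK -[y]reprK -[z]reprK !pi_ring_quotM mulrA.
Qed.
Fact ring_quot_mul1r : left_id ring_quot_one ring_quot_mul.
Proof. by move=> x; rewrite -[x]reprK pi_ring_quotM mul1r. Qed.
Fact ring_quot_mulr1 : right_id ring_quot_one ring_quot_mul.
Proof. by move=> x; rewrite -[x]reprK pi_ring_quotM mulr1. Qed.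
Fact ring_quot_mulDl : left_distributive ring_quot_mul +%R.
Proof.
move=> x y z; rewrite -[x]reprK -[y]reprK -[z]reprK.
by rewrite -pi_ring_quotD !pi_ring_quotM mulrDl pi_ring_quotD.
Qed.
Fact ring_quot_mulDr : right_distributive ring_quot_mul +%R.
Proof.
move=> x y z; rewrite -[x]reprK -[y]reprK -[z]reprK.
by rewrite -pi_ring_quotD !pi_ring_quotM mulrDr pi_ring_quotD.
Qed.

HB.instance Definition _ := GRing.Zmodule_isPzRing.Build ring_quot
  ring_quot_mulA ring_quot_mul1r ring_quot_mulr1
  ring_quot_mulDl ring_quot_mulDr.

End IdealQuotient.

Section IdealProduct.
Variable R : pzRingType.

Definition idealM (I J : {pred R}) : R -> bool := fun a =>
  `[< exists2 s : seq (R * R), all (fun u => (u.1 \in I) && (u.2 \in J)) s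
        & a = \sum_(u <- s) u.1 * u.2 >].

Lemma idealMD (I J : {pred R}) a b :
  a \in idealM I J -> b \in idealM I J -> a + b \in idealM I J.
Proof.
move=> /asboolP[s hs ->] /asboolP[t ht ->]; apply/asboolP.
by exists (s ++ t); rewrite ?all_cat ?hs ?ht ?big_cat.
Qed.

Lemma idealM0 (I J : {pred R}) : 0 \in idealM I J.
Proof. by apply/asboolP; exists [::]; rewrite ?big_nil. Qed.

Lemma idealM1 (I J : {pred R}) x y :
  x \in I -> y \in J -> x * y \in idealM I J.
Proof.
by move=> xI yJ; apply/asboolP; exists [:: (x, y)]; rewrite ?big_seq1 //= xI yJ.
Qed.

Lemma idealM_ind (I J : {pred R}) (P : R -> Prop) :
  P 0 -> (forall a b, P a -> P b -> P (a + b)) ->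
  (forall x y, x \in I -> y \in J -> P (x * y)) ->
  {in idealM I J, forall a, P a}.
Proof.
move=> P0 PD P1 a /asboolP[s hs ->]; rewrite big_seq.
by apply: big_ind => // u /(allP hs)/andP[uI uJ]; apply: P1.
Qed.

End IdealProduct.

(* The group algebra RG.  The library's {malg R[K]} is only a ring for monoids
   K without non-trivial units, so the ring structure is put on an alias. *)
Section GroupAlgebra.
Variables (R : nzRingType) (G : groupType).

Definition galg : Type := {malg R[G]}.
HB.instance Definition _ := GRing.Lmodule.on galg.

Implicit Types x y z : galg.

Definition galg_one : galg := << 1%g >>.
Definition galg_mul x y : galg :=
  \sum_(g <- msupp x) \sum_(h <- msupp y) << x@_g * y@_h *g (g * h)%g >>.

Lemma galg_mulw (d1 d2 : {fset G}) x y : msupp x `<=` d1 -> msupp y `<=` d2 ->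
  galg_mul x y = \sum_(g <- d1) \sum_(h <- d2) << x@_g * y@_h *g (g * h)%g >>.
Proof.
move=> le_d1 le_d2; rewrite /galg_mul (big_fset_incl _ le_d1) /=.
  apply/eq_bigr=> g _; apply/big_fset_incl => // h _ /mcoeff_outdom ->.
  by rewrite mulr0 monalgU0.
move=> g _ /mcoeff_outdom xg.
by rewrite big1 // => h _; rewrite xg mul0r monalgU0.
Qed.

Lemma galg_mul0r : left_zero 0 galg_mul.
Proof. by move=> x; rewrite /galg_mul msupp0 big_seq_fset0. Qed.

Lemma galg_mulr0 : right_zero 0 galg_mul.
Proof.
by move=> x; rewrite /galg_mul big1 // => g _; rewrite msupp0 big_seq_fset0.
Qed.

Lemma galg_mulUl c g x :
  galg_mul << c *g g >> x = \sum_(h <- msupp x) << c * x@_h *g (g * h)%g >>.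
Proof.
rewrite (galg_mulw msuppU_le (fsubset_refl _)) big_seq_fset1.
by apply/eq_bigr => h _; rewrite mcoeffUU.
Qed.

Lemma galg_mulUr c h x :
  galg_mul x << c *g h >> = \sum_(g <- msupp x) << x@_g * c *g (g * h)%g >>.
Proof.
rewrite (galg_mulw (fsubset_refl _) msuppU_le).
by apply/eq_bigr => g _; rewrite big_seq_fset1 mcoeffUU.
Qed.

Lemma galg_mulUU c d g h :
  galg_mul << c *g g >> << d *g h >> = << c * d *g (g * h)%g >>.
Proof. by rewrite (galg_mulw msuppU_le msuppU_le) !big_seq_fset1 !mcoeffUU. Qed.

Fact galg_mul1r : left_id galg_one galg_mul.
Proof.
move=> x; rewrite galg_mulUl [RHS]monalgE.
by apply/eq_bigr=> g _; rewrite mul1r mul1g.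
Qed.

Fact galg_mulr1 : right_id galg_one galg_mul.
Proof.
move=> x; rewrite galg_mulUr [RHS]monalgE.
by apply/eq_bigr=> g _; rewrite mulr1 mulg1.
Qed.

Fact galg_mulDl : left_distributive galg_mul +%R.
Proof.
move=> x y z.
rewrite [in RHS](galg_mulw (fsubsetUl _ (msupp y)) (fsubset_refl _)).
rewrite [in RHS](galg_mulw (fsubsetUr (msupp x) _) (fsubset_refl _)).
rewrite (galg_mulw (msuppD_le _ _) (fsubset_refl _)).
rewrite -big_split /=; apply/eq_bigr=> g _.
rewrite -big_split /=; apply/eq_bigr=> h _.
by rewrite mcoeffD mulrDl monalgUD.
Qed.

Fact galg_mulDr : right_distributive galg_mul +%R.
Proof.
move=> z x y.
rewrite [in RHS](galg_mulw (fsubset_refl _) (fsubsetUl _ (msupp y))).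
rewrite [in RHS](galg_mulw (fsubset_refl _) (fsubsetUr (msupp x) _)).
rewrite (galg_mulw (fsubset_refl _) (msuppD_le _ _)).
rewrite -big_split /=; apply/eq_bigr=> g _.
rewrite -big_split /=; apply/eq_bigr=> h _.
by rewrite mcoeffD mulrDr monalgUD.
Qed.

Fact galg_mulA : associative galg_mul.
Proof.
have suml (I : Type) (r : seq I) (F : I -> galg) z :
    galg_mul (\sum_(i <- r) F i) z = \sum_(i <- r) galg_mul (F i) z.
  by apply: (big_morph (galg_mul^~ z) (fun _ _ => galg_mulDl _ _ _) (galg_mul0r _)).
have sumr (I : Type) (r : seq I) (F : I -> galg) z :
    galg_mul z (\sum_(i <- r) F i) = \sum_(i <- r) galg_mul z (F i).
  by apply: (big_morph (galg_mul z) (fun _ _ => galg_mulDr _ _ _) (galg_mulr0 _)).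
have := galg_mulUU; move: galg_mul suml sumr => m suml sumr mUU.
move=> x y z; rewrite [x]monalgE [y]monalgE.
rewrite !suml; apply: eq_bigr => g _.
rewrite !sumr suml; apply: eq_bigr => h _.
rewrite [z]monalgE !sumr; apply: eq_bigr => i _.
by rewrite !mUU mulrA mulgA.
Qed.

Fact galg_oner_neq0 : galg_one != 0.
Proof.
by apply/eqP/malgP=> /(_ 1%g) /eqP; rewrite mcoeffUU mcoeff0 oner_eq0.
Qed.

HB.instance Definition _ := GRing.Zmodule_isNzRing.Build galg
  galg_mulA galg_mul1r galg_mulr1 galg_mulDl galg_mulDr galg_oner_neq0.

Lemma galgME x y : x * y =
  \sum_(g <- msupp x) \sum_(h <- msupp y) << x@_g * y@_h *g (g * h)%g >>.
Proof. by []. Qed.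

Lemma mcoeff_galgUM c g x h : ((<< c *g g >> : galg) * x)@_h = c * x@_(g^-1 * h)%g.
Proof.
rewrite [_ * _]galg_mulUl raddf_sum /=.
rewrite [X in _ = c * X@__]monalgE raddf_sum mulr_sumr /=.
apply/eq_bigr => i _; rewrite !mcoeffU mulrnAr; congr (_ *+ nat_of_bool _).
by apply/eqP/eqP => [<-|->]; rewrite ?mulKg ?mulKVg.
Qed.

Lemma mcoeff_galgMU c g x h : (x * (<< c *g g >> : galg))@_h = x@_(h * g^-1)%g * c.
Proof.
rewrite [_ * _]galg_mulUr raddf_sum /=.
rewrite [X in _ = X@__ * c]monalgE raddf_sum mulr_suml /=.
apply/eq_bigr => i _; rewrite !mcoeffU mulrnAl; congr (_ *+ nat_of_bool _).
by apply/eqP/eqP => [<-|->]; rewrite ?mulgK ?mulgKV.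
Qed.

Definition aug x : R := \sum_(g <- msupp x) x@_g.

Lemma augEw (d : {fset G}) x : msupp x `<=` d -> aug x = \sum_(g <- d) x@_g.
Proof. by move=> le; apply: big_fset_incl => // g _ /mcoeff_outdom. Qed.

Fact aug_is_zmod_morphism : zmod_morphism aug.
Proof.
move=> x y; rewrite (augEw (msuppB_le x y)).
rewrite (augEw (fsubsetUl (msupp x) (msupp y))).
rewrite (augEw (fsubsetUr (msupp x) (msupp y))) -sumrB.
by apply/eq_bigr => g _; rewrite mcoeffB.
Qed.
HB.instance Definition _ :=
  GRing.isZmodMorphism.Build galg R aug aug_is_zmod_morphism.

Lemma augU c g : aug << c *g g >> = c.
Proof. by rewrite (augEw msuppU_le) big_seq_fset1 mcoeffUU. Qed.

Fact aug_is_monoid_morphism : monoid_morphism aug.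
Proof.
split=> [|x y]; first exact: augU.
rewrite galgME raddf_sum /= mulr_suml; apply/eq_bigr => g _.
rewrite raddf_sum /= mulr_sumr; apply/eq_bigr => h _.
exact: augU.
Qed.
HB.instance Definition _ :=
  GRing.isMonoidMorphism.Build galg R aug aug_is_monoid_morphism.

End GroupAlgebra.

(* For a subgroup N of G, aug_ideal R N is the augmentation ideal of RN, viewed
   inside RG; in particular aug_ideal R [set: gT] is the augmentation ideal of
   the whole group algebra. *)
Section SmallGroupAlgebra.
Variables (R : nzRingType) (gT : finGroupType).
Local Notation A := (galg R gT).

Definition aug_ideal (N : {set gT}) : A -> bool := fun x =>
  all (fun g => g \in N) (msupp x) && (aug x == 0).

Lemma aug_idealP (N : {set gT}) (x : A) :
  reflect ((forall g, g \notin N -> x@_g = 0) /\ aug x = 0)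
          (x \in aug_ideal N).
Proof.
apply: (iffP andP) => -[xN /eqP ax]; split=> //.
  move=> g gN; apply: mcoeff_outdom; apply: contra gN.
  exact: (allP xN).
by apply/allP => g; rewrite -mcoeff_neq0; apply: contraR => /xN ->.
Qed.

Definition small_ideal : A -> bool :=
  idealM (aug_ideal [set: gT]) (aug_ideal 'L_2([set: gT])%g).

Fact aug_idealT (x : A) : (x \in aug_ideal [set: gT]) = (aug x == 0).
Proof.
by apply/aug_idealP/eqP => [[]//|ax]; split=> // g; rewrite in_setT.
Qed.

Fact small_ideal_zmod_closed : zmod_closed small_ideal.
Proof.
split=> [|x y xI yI]; first exact: idealM0.
apply: idealMD => //.
move: y yI; apply: idealM_ind => [|a b ha hb|a b ha hb].
- by rewrite oppr0; apply: idealM0.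
- by rewrite opprD; apply: idealMD.
by rewrite -mulNr; apply: idealM1; rewrite // aug_idealT rmorphN oppr_eq0 -aug_idealT.
Qed.
HB.instance Definition _ :=
  GRing.isZmodClosed.Build A small_ideal small_ideal_zmod_closed.

Fact small_ideal_mull (a : A) : {in small_ideal, forall u, a * u \in small_ideal}.
Proof.
apply: idealM_ind => [|x y hx hy|x y hx hy].
- by rewrite mulr0; apply: idealM0.
- by rewrite mulrDr; apply: idealMD.
rewrite mulrA; apply: idealM1 => //; move: hx; rewrite !aug_idealT rmorphM /=.
by move/eqP->; rewrite mulr0.
Qed.

Fact small_ideal_mulr (a : A) : {in small_ideal, forall u, u * a \in small_ideal}.
Proof.
apply: idealM_ind => [|x y hx hy|x y hx hy].
- by rewrite mul0r; apply: idealM0.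
- by rewrite mulrDl; apply: idealMD.
rewrite [a]monalgE mulr_sumr; apply: (big_ind (fun z => z \in small_ideal)).
- exact: idealM0.
- by move=> *; apply: idealMD.
move=> g _; set c := a@_g.
pose d : A := << 1 *g g >>; pose d' : A := << 1 *g g^-1%g >>.
have dd' : d * d' = 1 by rewrite [LHS]galg_mulUU mulr1 mulgV.
pose w : A := << c *g g >>.
have -> : x * y * w = (x * d) * (d' * (y * w)).
  by rewrite mulrA -(mulrA x d) dd' mulr1 mulrA.
apply: idealM1.
  by move: hx; rewrite !aug_idealT rmorphM /= => /eqP->; rewrite mul0r.
case/aug_idealP: hy => yN ay; apply/aug_idealP; split; last first.
  by rewrite 2!rmorphM /= ay mul0r mulr0.
move=> h hN; rewrite mcoeff_galgUM mcoeff_galgMU yN ?mul0r ?mulr0 //.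
apply: contra hN => hN.
have nN : g \in ('N('L_2([set: gT])))%g.
  by apply: (subsetP (normal_norm (lcn_normal 2 [set: gT]))); rewrite in_setT.
by rewrite -(memJ_norm _ (groupVr nN)) conjgE invgK mulgA -{1}(invgK g).
Qed.
HB.instance Definition _ :=
  isTwoSided.Build A small_ideal small_ideal_mull small_ideal_mulr.

Definition small_galg : Type := ring_quot (TwoSidedIdeal.clone A small_ideal _).
HB.instance Definition _ := GRing.PzRing.on small_galg.

End SmallGroupAlgebra.

(* The exterior square over k of a vector space V over the prime field k,
   where V is written multiplicatively: the k-space on the symbols (x, y),
   modulo bilinearity and alternation.  Homogeneity in each argument follows
   from additivity because k is a prime field. *)
Section ExteriorSquare.
Variables (k : fieldType) (V : finGroupType).
Local Notation F := {malg k[(V * V)%type]}.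

Inductive ext2_null : F -> Prop :=
| Ext2_0 : ext2_null 0
| Ext2_B u v : ext2_null u -> ext2_null v -> ext2_null (u - v)
| Ext2_Z a u : ext2_null u -> ext2_null (a *: u)
| Ext2_addl x y z :
    ext2_null (<< ((x * y)%g, z) >> - << (x, z) >> - << (y, z) >>)
| Ext2_addr x y z :
    ext2_null (<< (x, (y * z)%g) >> - << (x, y) >> - << (x, z) >>)
| Ext2_alt x : ext2_null << (x, x) >>.

Definition ext2_nullb : F -> bool := fun u => `[< ext2_null u >].

Fact ext2_nullb_zmod_closed : zmod_closed ext2_nullb.
Proof.
split=> [|u v /asboolP hu /asboolP hv]; apply/asboolP; first exact: Ext2_0.
exact: Ext2_B.
Qed.
HB.instance Definition _ := GRing.isZmodClosed.Build F ext2_nullb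
  ext2_nullb_zmod_closed.

Definition ext2 : Type :=
  Quotient.quot (GRing.ZmodClosed.clone F ext2_nullb _).
HB.instance Definition _ := GRing.Zmodule.on ext2.
HB.instance Definition _ := EqQuotient.on ext2.

Definition wedge (x y : V) : ext2 := \pi_ext2 << (x, y) >>.

End ExteriorSquare.

Local Open Scope group_scope.

(* X^p, generated by all p-th powers of elements of X. *)
Definition pow_gen (gT : finGroupType) (p : nat) (X : {set gT}) : {set gT} :=
  <<[set x ^+ p | x in X]>>.

Section KG.
Variables (p : nat) (gT : finGroupType).
Implicit Types G K : {group gT}.

Definition Gam G : {group gT} := ('Z(G) :&: 'L_2(G))%G.

(* Exactness of
     1 -> /\^2 (K / Z_2(G)) -> /\^2 (G / Z_2(G)) -> gamma_2(G) / Gamma(G) -> 1,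
   the two maps being the homomorphisms i and c which are given on pure wedges
   by the inclusion of K in G and by the commutator map. *)
Definition comm_exact G K : Prop :=
  exists (i : {additive ext2 'F_p [subg K / 'Z_2(G)]%type ->
                        ext2 'F_p [subg G / 'Z_2(G)]%type})
         (c : ext2 'F_p [subg G / 'Z_2(G)]%type -> coset_of (Gam G)),
    [/\ forall x y, i (wedge 'F_p x y) =
           wedge 'F_p (subg (G / 'Z_2(G)) (sgval x))
                      (subg (G / 'Z_2(G)) (sgval y)),
        {morph c : u v / (u + v)%R >-> u * v}
        /\ {in G &, forall x y,
             c (wedge 'F_p (subg (G / 'Z_2(G)) (coset 'Z_2(G) x))
                           (subg (G / 'Z_2(G)) (coset 'Z_2(G) y)))
             = coset (Gam G) [~ x, y]},
        injective i,
        forall u, c u = 1 <-> exists v, u = i v &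
        forall z, z \in 'L_2(G) / Gam G <-> exists u, c u = z].

(* The last clause is needed when |gamma_2(G) : Gamma(G)| = p^3, since the
   sequence is then also exact whenever |K : Z_2(G)| = p. *)
Definition is_KG G K : Prop :=
  [/\ 'Z_2(G) \subset K, K \subset G, comm_exact G K &
      #|'L_2(G) : Gam G| = (p ^ 3)%N -> K :=: 'Z_2(G)].

End KG.

(* Main.v *)
Require Import Defs.
From HB Require Import structures.
From mathcomp Require Import all_boot all_order all_algebra.
From mathcomp Require Import all_fingroup all_solvable all_field all_character.
From mathcomp Require Import finmap generic_quotient ring_quotient.
From mathcomp.classical Require Import boolp.
From mathcomp.multinomials Require Import monalg.

(* Let V be the unit group of the small group algebra S of G, and I the
   augmentation ideal of S. Since I I(k gamma_2(G)) vanishes in S, the commutators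
   of V lie in gamma_2(G), the elements 1 + I^2 lie in the second centre of V, and
   V = k^* G (1 + I^2). An isomorphism of unit groups therefore identifies
   gamma_2(H) with gamma_2(G), and relates g in G with h in H when their images
   agree modulo 1 + I^2; as Phi(G) = Z_2(G), this relation R is a subgroup of G x H
   mapping onto G with kernel Phi(G).

   Lift a basis of H / gamma_2(H) through R to elements of G, in such a way that
   the powers to the orders of the basis elements agree. These pairs, together with
   the pairs (n, n) for n in Gamma(G), generate a subgroup D of G x H, which is the graph of an isomorphism
   unless it contains some (1, h) with h <> 1. Such an (1, h) is a product of
   commutators of D up to Gamma(G), hence, G having three generators, a single
   commutator [(v, v'), (w, w')] up to Gamma(G), with [v, w] central. If v and w are
   dependent modulo Phi(G) this forces h = 1. Otherwise K_G = <v, w> Z_2(G), and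
   gamma_3(G) = [K_G, gamma_2(G)] allows one to multiply the chosen elements of
   G by elements of gamma_2(G) so that [v, w] and [v', w'] match.

   If kG and kH are isomorphic, then H embeds in the small group algebra of G, and
   the argument applies with the identity map of its unit group. *)

Set Implicit Arguments.
Unset Strict Implicit.
Unset Printing Implicit Defensive.

Import GRing.Theory.
Local Open Scope group_scope.

(** The relation R records elements only modulo 1 + I^2, whereas an isomorphism needs exact
    equalities. Two steps above hide the work. Powers: g (1 + q) with q in I^2 has p^e-th power
    g^(p^e) (1 + q^(p^e)). If this is an element n of gamma_2(G), functionals on S show that g^(p^e)
    and n differ by an element of Mho^1(Mho^e(G)); this is the p^e-th power of a central element of
    Phi(G), which g absorbs. Commutators: that (1, h) is a product of commutators of D up to
    Gamma(G) follows by comparing indices, which requires |H : gamma_2(H)| <= |G : gamma_2(G)|; this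
    comes from counting units. Oddness of p enters through (x - 1)^p in I^3 and through p dividing
    C(p^e, 2). In both halves of the theorem S is treated as a ring with a map from a group
    satisfying [small_alg]. In the second half one ring S carries two such maps, from G and from H,
    and gamma_2(H)^p gamma_4(H) = 1 has to be derived. *)

(** * Elementary abelian quotients and commutators in class two *)

Lemma abelem_separate p (gT : finGroupType) (A B : {group gT}) x :
  prime p -> B <| A -> p.-abelem (A / B) -> x \in A -> x \notin B ->
  exists l : gT -> 'F_p,
    [/\ {in A &, forall y z, l (y * z) = (l y + l z)%R},
        forall y, y \in B -> l y = 0%R & l x = 1%R].
Proof.
move=> pr_p nBA abAB Ax Bx; have [sBA /subsetP nBA'] := andP nBA.
have Axq : coset B x \in A / B by apply: mem_quotient.
have ntx : coset B x != 1.
  by apply: contra Bx => /eqP/coset_idr; apply; apply: nBA'.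
have ntAB : A / B != 1 by apply/trivgPn; exists (coset B x).
set r := abelem_rV abAB ntAB.
have r1 : r 1 = 0%R.
  by apply: (addrI (r 1)); rewrite -abelem_rV_M ?group1 // mulg1 addr0.
have : r (coset B x) != 0%R.
  by rewrite -r1; apply: contra ntx => /eqP/abelem_rV_inj->; rewrite ?group1.
case/rV0Pn => j nz.
exists (fun y => r (coset B y) 0%R j / r (coset B x) 0%R j)%R; split.
- move=> y z Ay Az.
  rewrite morphM ?nBA' // [in LHS]/r abelem_rV_M ?mem_quotient // mxE.
  by rewrite mulrDl.
- by move=> y By; rewrite coset_id // r1 mxE mul0r.
by rewrite divff.
Qed.

(** Adjoining [x] multiplies the order by at most [#[x]]. Applied to a lifted basis, this bounds the
    index of [lift_ker]. *)
Lemma card_gen_seq_abelian (gT : finGroupType) (A : {group gT}) (s : seq gT) :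
  abelian A -> all (mem A) s -> #|<<[set x in s]>>| <= \prod_(x <- s) #[x].
Proof.
move=> abA; elim: s => [|x s IHs] /=; first by rewrite big_nil set_nil gen0 cards1.
case/andP=> Ax /[dup] As /IHs {}IHs; rewrite big_cons.
have sA : <<[set y in s]>> \subset A.
  by rewrite gen_subG; apply/subsetP=> y; rewrite inE => /(allP As).
have -> : <<[set y in x :: s]>> = <[x]> <*> <<[set y in s]>>.
  rewrite joing_idl joing_idr; congr <<_>>.
  by apply/setP=> y; rewrite !inE.
rewrite norm_joinEl; last first.
  apply: cents_norm; rewrite (sub_abelian_cent2 abA) // cycle_subG //.
apply: leq_trans (leq_mul (leqnn _) IHs).
rewrite -[#[x]]/(#|<[x]>|) mul_cardG; apply: leq_pmulr; exact: cardG_gt0.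
Qed.

Lemma comm_cent2M (gT : finGroupType) (E : {group gT}) u v w :
  E^`(1) \subset 'Z(E) -> u \in E -> v \in E -> w \in E ->
  [~ u * v, w] = [~ u, w] * [~ v, w] /\ [~ w, u * v] = [~ w, u] * [~ w, v].
Proof.
move=> sEZ Eu Ev Ew.
have cen a b c : a \in E -> b \in E -> c \in E -> [~ a, b] ^ c = [~ a, b].
  move=> Ea Eb Ec; have: [~ a, b] \in 'Z(E) by rewrite (subsetP sEZ) ?mem_commg.
  case/centerP=> _ /(_ c Ec) cc; exact/conjg_fixP/commgP.
rewrite commMgJ commgMJ !cen //; split=> //.
have: [~ w, u] \in 'Z(E) by rewrite (subsetP sEZ) ?mem_commg.
by case/centerP=> _ ->//; rewrite groupR.
Qed.

Lemma comm_cent2X (gT : finGroupType) (E : {group gT}) u v n :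
  E^`(1) \subset 'Z(E) -> u \in E -> v \in E ->
  [~ u ^+ n, v] = [~ u, v] ^+ n /\ [~ u, v ^+ n] = [~ u, v] ^+ n.
Proof.
move=> sEZ Eu Ev.
have: [~ u, v] \in 'Z(E) by rewrite (subsetP sEZ) ?mem_commg.
case/centerP=> _ cE; split; [apply: commXg | apply: commgX];
by apply/commute_sym/cE.
Qed.

Lemma comm_centl_group (gT : finGroupType) (E W : {group gT}) t :
  E^`(1) \subset 'Z(E) -> t \in E -> group_set [set u in E | [~ t, u] \in W].
Proof.
move=> sEZ Et; apply/group_setP; split=> [|u v].
  by rewrite inE group1 commg1 group1.
rewrite !inE => /andP[Eu Wu] /andP[Ev Wv]; rewrite groupM //=.
by rewrite (proj2 (comm_cent2M sEZ Eu Ev Et)) groupM.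
Qed.

(* Every bivector of a 3-dimensional space is decomposable. *)
Lemma der1_commutator (gT : finGroupType) (E : {group gT}) p x y z e :
  prime p -> E^`(1) \subset 'Z(E) -> (forall u, u \in E^`(1) -> u ^+ p = 1) ->
  x \in E -> y \in E -> z \in E -> E \subset <<[set x; y; z]>> * 'Z(E) ->
  e \in E^`(1) -> exists u v, [/\ u \in E, v \in E & e = [~ u, v]].
Proof.
move=> pr_p sEZ expE Ex Ey Ez sE.
have cZ u v : u \in E -> v \in E -> [~ u, v] \in 'Z(E).
  by move=> *; rewrite (subsetP sEZ) ?mem_commg.
pose W := (<<[set [~ x, y]; [~ x, z]; [~ y, z]]>>)%G.
have in3 (K : {group gT}) : x \in K -> y \in K -> z \in K ->
    'Z(E) \subset K -> E \subset K.
  move=> Kx Ky Kz sZ; apply: (subset_trans sE).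
  rewrite mul_subG // gen_subG; apply/subsetP=> u.
  by rewrite !inE -!orbA => /or3P[] /eqP->.
have [Wxy Wxz Wyz] : [/\ [~ x, y] \in W, [~ x, z] \in W & [~ y, z] \in W].
  by split; apply: mem_gen; rewrite !inE eqxx ?orbT.
have CZ t u : t \in E -> u \in 'Z(E) -> [~ t, u] = 1.
  by move=> Et /centerP[_ /(_ t Et) c]; apply/eqP/commgP/commute_sym.
have sZ t : t \in E -> 'Z(E) \subset [set u in E | [~ t, u] \in W].
  move=> Et; apply/subsetP=> u Zu; rewrite inE CZ // group1 andbT.
  by case/centerP: Zu.
have cW t : t \in E -> [~ t, x] \in W -> [~ t, y] \in W -> [~ t, z] \in W ->
    forall u, u \in E -> [~ t, u] \in W.
  move=> Et h1 h2 h3 u Eu.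
  have /subsetP/(_ u Eu): E \subset Group (comm_centl_group W sEZ Et).
    by apply: in3; rewrite ?inE ?Ex ?Ey ?Ez //; apply: sZ.
  by rewrite inE => /andP[].
have sym t u : [~ t, u] \in W -> [~ u, t] \in W by rewrite -groupV invg_comm.
have cWx := cW x Ex; have cWy := cW y Ey; have cWz := cW z Ez.
rewrite !commgg !group1 in cWx cWy cWz.
have sEW : E^`(1) \subset W.
  rewrite gen_subG; apply/subsetP=> _ /imset2P[t u Et Eu ->].
  by apply: (cW) => //; apply/sym; [apply: (cWx) | apply: (cWy) | apply: (cWz)];
     rewrite ?Wxy ?Wxz ?Wyz //; apply/sym.
have [Dxy Dxz Dyz] : [/\ [~ x, y] \in E^`(1), [~ x, z] \in E^`(1) & [~ y, z] \in E^`(1)].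
  by split; apply: mem_commg.
move/(subsetP sEW) => eW.
have [a [b [c ->]]] : exists a b c,
    e = [~ x, y] ^+ a * [~ x, z] ^+ b * [~ y, z] ^+ c.
  have Zc u v : u \in 'Z(E) -> v \in 'Z(E) -> commute u v.
    by case/centerP=> Eu _ /centerP[_ /(_ u Eu)]; apply: commute_sym.
  have [Zxy Zxz Zyz] : [/\ [~ x, y] \in 'Z(E), [~ x, z] \in 'Z(E) & [~ y, z] \in 'Z(E)].
    by split; apply: cZ.
  have gW : group_set (<[[~ x, y]]> * <[[~ x, z]]> * <[[~ y, z]]>).
    have cc u v : u \in 'Z(E) -> v \in 'Z(E) -> <[u]> \subset 'C(<[v]>).
      by move=> Zu Zv; rewrite (sub_abelian_cent2 (center_abelian E)) ?cycle_subG.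
    rewrite -(cent_joinEr (cc _ _ Zxz Zxy)) -cent_joinEr ?groupP //.
    by rewrite centY subsetI !cc.
  have : e \in Group gW.
    apply: (subsetP _ _ eW); rewrite gen_subG; apply/subsetP=> u.
    have mW t1 t2 t3 : t1 \in <[[~ x, y]]> -> t2 \in <[[~ x, z]]> ->
      t3 \in <[[~ y, z]]> -> t1 * t2 * t3 \in Group gW by move=> *; rewrite !mem_mulg.
    rewrite !inE -!orbA => /or3P[] /eqP->.
    - by have := mW _ 1 1 (cycle_id _) (group1 _) (group1 _); rewrite !mulg1.
    - by have := mW 1 _ 1 (group1 _) (cycle_id _) (group1 _); rewrite mul1g mulg1.
    by have := mW 1 1 _ (group1 _) (group1 _) (cycle_id _); rewrite !mul1g.
  case/mulsgP=> _ _ /mulsgP[_ _ /cycleP[a ->] /cycleP[b ->] ->] /cycleP[c ->] ->.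
  by exists a, b, c.
(* If [a] vanishes modulo [p], the bivector is b x^z + c y^z = (b x + c y)^z, writing ^ for the
   wedge. *)
have [/dvdnP[k ->]|ap] := boolP (p %| a)%N.
  exists (x ^+ b * y ^+ c), z; rewrite groupM ?groupX //; split=> //.
  rewrite (proj1 (comm_cent2M sEZ _ _ _)) ?groupX //.
  rewrite !(proj1 (comm_cent2X _ sEZ _ _)) //.
  by rewrite mulnC expgM expE // expg1n mul1g.
have cpa : coprime a p by rewrite coprime_sym prime_coprime.
have a_gt0 : (0 < a)%N by case: (a) ap => //; rewrite dvdn0.
(* [k] inverts [a] modulo [p]: in (x - c k z)^(a y + b z) the wedges x^y, x^z and y^z have the
   coefficients a, b and c k a = c. *)
case: (egcdnP p a_gt0) => k l; rewrite (eqP cpa) => ha _.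
have Ez' : z^-1 \in E by rewrite groupV.
have cV u : u \in E -> [~ z^-1, u] = [~ u, z].
  move=> Eu; rewrite -[LHS]mulg1 -(mulgV [~ z, u]) mulgA.
  rewrite -(proj1 (comm_cent2M sEZ _ _ _)) // mulVg comm1g mul1g.
  by rewrite invg_comm.
exists (x * z^-1 ^+ (c * k)), (y ^+ a * z ^+ b).
rewrite !groupM ?groupX //; split=> //.
rewrite (proj1 (comm_cent2M sEZ _ _ _)) ?groupM ?groupX //.
rewrite !(proj2 (comm_cent2M sEZ _ _ _)) ?groupX //.
rewrite !(proj1 (comm_cent2X _ sEZ _ _)) ?groupX //.
rewrite !(proj2 (comm_cent2X _ sEZ _ _)) // !cV // commgg !expg1n mulg1.
by rewrite -expgM mulnC -mulnA ha mulnDr muln1 expgD mulnA (expgM _ _ p) expE ?mul1g ?groupX.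
Qed.

(** * Correspondences between two groups *)

Lemma pairM (gT hT : finGroupType) (g g' : gT) (h h' : hT) :
  (g, h) * (g', h') = (g * g', h * h').
Proof. by []. Qed.

Lemma pairV (gT hT : finGroupType) (g : gT) (h : hT) : (g, h)^-1 = (g^-1, h^-1).
Proof. by []. Qed.

Lemma pairR (gT hT : finGroupType) (g g' : gT) (h h' : hT) :
  [~ (g, h), (g', h')] = ([~ g, g'], [~ h, h']).
Proof. by []. Qed.

Lemma pairX (gT hT : finGroupType) (g : gT) (h : hT) n :
  (g, h) ^+ n = (g ^+ n, h ^+ n).
Proof. by elim: n => // n IHn; rewrite !expgS IHn. Qed.

Section Correspondence.

Variables (p : nat) (gT hT : finGroupType).
Local Notation G := [set: gT]%G.
Local Notation H := [set: hT]%G.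
Variables (nu : hT -> gT) (R : {group gT * hT}).

(* [nu] is the isomorphism between the derived subgroups induced by that of the
   unit groups, and [R] relates g and h when their images in the unit group of
   the small group algebra agree modulo 1 + I^2. *)
Record correspondence : Prop := Correspondence {
  corr_p : prime p;
  corr_pG : p.-group G;
  corr_pH : p.-group H;
  corr_exp : forall n, n \in 'L_2(G) -> n ^+ p = 1;
  corr_L3 : 'L_3(G) \subset 'Z(G);
  corr_Mho : 'Mho^1(G) \subset 'Z(G);
  corr_nuM : {in 'L_2(H) &, {morph nu : x y / x * y}};
  corr_nuI : {in 'L_2(H) &, injective nu};
  corr_nuN : forall n, n \in 'L_2(H) -> nu n \in 'L_2(G);
  corr_nuR : forall n, n \in 'L_2(H) -> (nu n, n) \in R;
  corr_fst : forall g, exists h, (g, h) \in R;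
  corr_ker : forall g, ((g, 1) \in R) = (g \in 'Phi(G));
  corr_comm : forall g g' h h', (g, h) \in R -> (g', h') \in R ->
    [~ g, g']^-1 * nu [~ h, h'] \in 'L_3(G);
  corr_comm3 : forall n g h, n \in 'L_2(H) -> (g, h) \in R ->
    nu [~ n, h] = [~ nu n, g];
  corr_cardL2 : (#|'L_2(G)| <= #|'L_2(H)|)%N;
  corr_card : (#|H : 'L_2(H)| <= #|G : 'L_2(G)|)%N
}.

(* Pairs whose second components lift a basis of the abelian group H / L_2(H) and
   whose powers of the corresponding orders match under [nu]. *)
Definition lift_basis (ds : seq (gT * hT)) :=
  [/\ forall d, d \in ds -> [/\ d \in R, (p %| #[coset 'L_2(H) d.2])%N &
         d.1 ^+ #[coset 'L_2(H) d.2] = nu (d.2 ^+ #[coset 'L_2(H) d.2])],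
      forall K : {group hT}, 'L_2(H) \subset K ->
         (forall d, d \in ds -> d.2 \in K) -> H \subset K &
      (\prod_(d <- ds) #[coset 'L_2(H) d.2])%N = #|H : 'L_2(H)|].

Hypothesis C : correspondence.

Let pr_p := corr_p C.

Lemma nu1 : nu 1 = 1.
Proof.
by apply: (mulgI (nu 1)); rewrite -(corr_nuM C) ?group1 // !mulg1.
Qed.

Lemma nuV n : n \in 'L_2(H) -> nu n^-1 = (nu n)^-1.
Proof.
move=> Hn; apply: (mulgI (nu n)).
by rewrite -(corr_nuM C) ?groupV // !mulgV nu1.
Qed.

Lemma nuX n k : n \in 'L_2(H) -> nu (n ^+ k) = nu n ^+ k.
Proof.
move=> Hn; elim: k => [|k IHk]; first exact: nu1.
by rewrite !expgS (corr_nuM C) ?groupX // IHk.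
Qed.

Lemma comL2 (T : finGroupType) (x y : T) : [~ x, y] \in 'L_2([set: T]).
Proof. by rewrite mem_commg ?inE. Qed.

Lemma comL3 (T : finGroupType) (x y : T) :
  x \in 'L_2([set: T]) -> [~ x, y] \in 'L_3([set: T]).
Proof. by move=> Lx; rewrite mem_commg ?inE. Qed.

Lemma L3G_comm n g : n \in 'L_3(G) -> [~ n, g] = 1.
Proof. by move/(subsetP (corr_L3 C))/centerP=> [_ /(_ g (in_setT _))]; move/commgP/eqP. Qed.

Lemma L3_sub2 n : n \in 'L_3(G) -> n \in 'L_2(G).
Proof. exact/subsetP/lcn_subS. Qed.

(** The pairs (n, n) with n in Gamma(G), once gamma_2(H) is identified with gamma_2(G) by [nu]. They
    are central in R, and D has class at most 2 modulo them. *)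
Definition diag_cent : {set gT * hT} :=
  [set d | (d.2 \in 'L_2(H)) && (d.1 == nu d.2) && (d.1 \in 'Z(G))].

Fact diag_cent_group : group_set diag_cent.
Proof.
apply/group_setP; split=> [|[g h] [g' h']]; first by rewrite inE /= nu1 !group1 eqxx.
rewrite !inE /= => /andP[/andP[Lh /eqP->] Zg] /andP[/andP[Lh' /eqP->] Zg'].
by rewrite (corr_nuM C) // eqxx !groupM.
Qed.
Canonical diag_cent_gp := Group diag_cent_group.

Lemma diag_centP g h :
  reflect [/\ h \in 'L_2(H), g = nu h & g \in 'Z(G)] ((g, h) \in diag_cent).
Proof.
rewrite [_ \in diag_cent]inE; apply: (iffP andP) => [[/andP[? /eqP ?]] | [? -> ?]] //.
by rewrite eqxx andbT.
Qed.

(** The first coordinate is trivial by centrality, the second because the injective [nu] maps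
    [h, h'] to [nu h, g']. *)
Lemma diag_cent_comm d d' : d \in diag_cent -> d' \in R -> [~ d, d'] = 1.
Proof.
case: d d' => g h [g' h'] /diag_centP[Lh -> Zg] Rd'.
have e : [~ nu h, g'] = 1.
  by case/centerP: Zg => _ /(_ g' (in_setT _))/commgP/eqP.
apply/eqP; rewrite -pair_eqE /=; apply/andP; split; first exact/eqP.
apply/eqP/(corr_nuI C); rewrite ?group1 ?comL2 //.
by rewrite (corr_comm3 C Lh Rd') nu1.
Qed.

Lemma diag_cent_R : diag_cent \subset R.
Proof. by apply/subsetP=> -[g h] /diag_centP[Lh -> _]; apply: (corr_nuR C). Qed.

Section Diagonal.
Variable ds : seq (gT * hT).
Hypothesis dsP : lift_basis ds.

Definition lift_group := <<[set d in ds] :|: diag_cent>>.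
Local Notation D := lift_group.

Lemma lift_sub_R : D \subset R.
Proof.
rewrite gen_subG subUset diag_cent_R andbT; apply/subsetP=> d.
by rewrite inE; case: dsP => h _ _ /h[].
Qed.

Lemma diag_sub_lift : diag_cent \subset D.
Proof. exact: subset_trans (subsetUr _ _) (subset_gen _). Qed.

Lemma lift_snd h : exists g, (g, h) \in D.
Proof.
pose K := ([morphism of @snd gT hT] @* D)%G.
have : H \subset K <*> 'L_2(H).
  case: dsP => _ + _; apply=> [|d hd]; first exact: joing_subr.
  apply/(subsetP (joing_subl _ _))/morphimP; exists d; rewrite ?inE //.
  by apply: mem_gen; rewrite !inE hd.
move=> sH; have KH : K :=: H.
  rewrite /= -[LHS]genGid; apply: Phi_nongen; apply/eqP.
  rewrite eqEsubset subsetT /= (subset_trans sH) // join_subG joing_subr /=.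
  rewrite (Phi_joing (corr_pH C)); apply: subset_trans (joing_subl _ _).
  exact: joing_subl.
have : h \in K by rewrite KH inE.
by case/morphimP=> -[g h'] _ Dd /= ->; exists g.
Qed.

(** If (g, h) is in R and (g', h) in D, then g and g' differ by an element of Phi(G), and such
    elements are non-generators of G. *)
Lemma lift_fst g : exists h, (g, h) \in D.
Proof.
pose K := ([morphism of @fst gT hT] @* D)%G.
have KG : K :=: G.
  rewrite /= -[LHS]genGid; apply: Phi_nongen; apply/eqP.
  rewrite eqEsubset subsetT /=; apply/subsetP=> {}g _.
  have [h Rgh] := corr_fst C g; have [g' Dg'] := lift_snd h.
  have : (g * g'^-1, 1) \in R.
    have -> : (g * g'^-1, 1) = (g, h) * (g', h)^-1.
      by rewrite pairV pairM mulgV.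
    by rewrite groupM // groupV (subsetP lift_sub_R).
  rewrite (corr_ker C) => Phi; rewrite -(mulgKV g' g).
  apply: groupM; first exact/(subsetP (joing_subl _ _)).
  by apply/(subsetP (joing_subr _ _))/morphimP; exists (g', h); rewrite ?inE.
have : g \in K by rewrite KG inE.
by case/morphimP=> -[g' h] _ Dd /= ->; exists h.
Qed.

(** Modulo [diag_cent] this is the derived subgroup of D; by [lift_L2] it is the full preimage of
    gamma_2(G) in D. *)
Definition lift_ker := D^`(1) <*> diag_cent.
Local Notation L := lift_ker.

Lemma diag_sub_ker : diag_cent \subset L. Proof. exact: joing_subr. Qed.

Lemma ker_sub_lift : L \subset D.
Proof. by rewrite join_subG diag_sub_lift der_sub. Qed.

Lemma diag_cent_lift : D \subset 'C(diag_cent).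
Proof.
rewrite centsC; apply/centsP=> d Cd d' /(subsetP lift_sub_R) Rd'.
by apply/commgP; rewrite (diag_cent_comm Cd Rd').
Qed.

Lemma lift_norm_ker : D \subset 'N(L).
Proof. by apply: normsY; [apply: der_norm | apply/cents_norm/diag_cent_lift]. Qed.

Lemma lift_kerP g h : (g, h) \in L ->
  [/\ g \in 'L_2(G), h \in 'L_2(H) & g^-1 * nu h \in 'L_3(G)].
Proof.
have gY : group_set [set l : gT * hT | [&& l.1 \in 'L_2(G), l.2 \in 'L_2(H)
                                     & l.1^-1 * nu l.2 \in 'L_3(G)]].
  apply/group_setP; split=> [|[n n'] [m m']].
    by rewrite inE -[1]/(1, 1) /= nu1 mulVg !group1.
  rewrite !inE pairM /= => /and3P[Ln Ln' nn'] /and3P[Lm Lm' mm'].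
  rewrite (groupM Ln Lm) (groupM Ln' Lm') /= (corr_nuM C) // invMg -mulgA (mulgA n^-1).
  have /centerP[_ c] := subsetP (corr_L3 C) _ nn'.
  by rewrite mulgA -(c m^-1) ?inE // -mulgA groupM.
have : L \subset Group gY.
  rewrite join_subG; apply/andP; split; last first.
    apply/subsetP=> -[g' h'] /diag_centP[Lh -> _].
    by rewrite inE /= Lh (corr_nuN C) // mulVg group1.
  rewrite gen_subG; apply/subsetP=> _ /imset2P[[g1 h1] [g2 h2] D1 D2 ->].
  rewrite inE pairR /= !comL2 /=.
  by apply: (corr_comm C); apply: (subsetP lift_sub_R).
by move=> /subsetP sL /sL; rewrite inE => /and3P[].
Qed.

Lemma Mho1X (g : gT) n : (p %| n)%N -> g ^+ n \in 'Z(G).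
Proof.
case/dvdnP=> k ->; rewrite mulnC expgM groupX // (subsetP (corr_Mho C)) //.
have pg : p.-elt g by apply: mem_p_elt (corr_pG C) _; rewrite inE.
by have := Mho_p_elt 1 (in_setT g) pg; rewrite expn1.
Qed.

(** As p divides the order o of h modulo gamma_2(H), the power g^o is central, and the matching of
    powers puts (g, h)^o into [diag_cent]. So the generators of the abelian group D / L have orders
    at most those of the basis of H / gamma_2(H). *)
Lemma lift_index : (#|D : L| <= #|H : 'L_2(H)|)%N.
Proof.
case: (dsP) => dsR _ <-.
rewrite -card_quotient ?lift_norm_ker //.
have sD d : d \in ds -> d \in D by move=> hd; rewrite mem_gen // !inE hd.
pose s := map (coset L) ds.
have abDL : abelian (D / L) by apply: sub_der1_abelian; apply: joing_subl.
have allS : all (mem (D / L)) s.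
  apply/allP=> _ /mapP[d hd ->] /=; apply: mem_quotient; exact: sD.
have sDL : D / L \subset <<[set x in s]>>.
  rewrite sub_quotient_pre ?lift_norm_ker //.
  rewrite gen_subG subUset; apply/andP; split; apply/subsetP=> d.
    rewrite inE => hd; rewrite mem_morphpre ?(subsetP lift_norm_ker) ?sD //.
    by rewrite mem_gen // inE map_f.
  move=> Cd; have Ld := subsetP diag_sub_ker _ Cd.
  by rewrite mem_morphpre ?(subsetP (normG _)) //= coset_id // group1.
apply: leq_trans (subset_leq_card sDL) _.
apply: leq_trans (card_gen_seq_abelian abDL allS) _.
rewrite big_map big_seq [leqRHS]big_seq; apply: leq_prod => -[g h] hd.
have [Rd pd /= eqd] := dsR _ hd.
have nd : (g, h) \in 'N(L) by rewrite (subsetP lift_norm_ker) ?sD.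
apply: dvdn_leq; rewrite ?order_gt0 // order_dvdn -morphX //; apply/eqP/coset_id.
apply: (subsetP diag_sub_ker); rewrite pairX; apply/diag_centP; split.
- apply: coset_idr; first by rewrite (subsetP (lcn_norm _ _)) ?inE.
  by rewrite morphX ?expg_order // (subsetP (lcn_norm _ _)) ?inE.
- exact: eqd.
exact: Mho1X.
Qed.

Let LT := (D :&: ([morphism of @fst gT hT] @*^-1 'L_2(G)))%G.

Lemma lift_index_ge : (#|G : 'L_2(G)| <= #|D : LT|)%N.
Proof.
have fD : [morphism of @fst gT hT] @* D = G.
  apply/eqP; rewrite eqEsubset subsetT; apply/subsetP=> g' _.
  by have [h' Dh'] := lift_fst g'; apply/morphimP; exists (g', h'); rewrite ?inE.
have := index_morphim [morphism of @fst gT hT] (G := D) (H := LT).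
rewrite fD subsetT => /(_ isT) h1.
have h2 : [morphism of @fst gT hT] @* LT \subset 'L_2(G).
  by apply/subsetP=> _ /morphimP[[g' h'] _ /setIP[_ /morphpreP[_ /= ?]] ->].
apply: dvdn_leq; first exact: indexg_gt0.
exact: dvdn_trans (indexgS G h2) h1.
Qed.

(** L is contained in LT, and |D : L| <= |H : gamma_2(H)| <= |G : gamma_2(G)| <= |D : LT| forces
    equality. This makes an element (1, h) of D a product of commutators up to [diag_cent]. *)
Lemma lift_L2 g h : (g, h) \in D -> g \in 'L_2(G) -> (g, h) \in L.
Proof.
have sL : L \subset LT.
  rewrite subsetI ker_sub_lift; apply/subsetP=> -[g' h'] /lift_kerP[Lg' _ _].
  by rewrite !inE.
have eqL : L :=: LT.
  apply/eqP; rewrite eqEcard sL /= -(leq_pmul2r (indexg_gt0 D LT)).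
  rewrite [leqLHS]Lagrange ?subsetIl //.
  rewrite -(Lagrange ker_sub_lift) leq_mul2l (leq_trans lift_index) ?orbT //.
  exact: leq_trans (corr_card C) lift_index_ge.
by move=> Dg Lg; have : (g, h) \in LT; [rewrite !inE Dg | rewrite -eqL].
Qed.

Lemma lift_card : (#|G| <= #|H|)%N.
Proof.
rewrite -(Lagrange (lcn_sub 2 G)) -(Lagrange (lcn_sub 2 H)).
apply: leq_mul; first exact: (corr_cardL2 C).
apply: leq_trans lift_index_ge _; apply: leq_trans lift_index.
have sL : L \subset LT.
  rewrite subsetI ker_sub_lift; apply/subsetP=> -[g' h'] /lift_kerP[Lg' _ _].
  by rewrite !inE.
by apply: dvdn_leq; rewrite ?indexg_gt0 ?indexgS.
Qed.

(** An element (n, n') of L equals (nu n', n') up to a factor in the central gamma_3(G), so the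
    components of its commutators correspond under [nu]. *)
Lemma comm_lift_ker l d : l \in L -> d \in D -> [~ l, d] \in diag_cent.
Proof.
case: l d => n n' [g h] /lift_kerP[Ln Ln' nn'] Dd.
have Rd := subsetP lift_sub_R _ Dd.
rewrite pairR; apply/diag_centP; split; first exact: comL2.
  rewrite (corr_comm3 C Ln' Rd) -[in RHS](mulKVg n (nu n')) commMgJ.
  by rewrite (L3G_comm _ nn') mulg1; apply/esym/conjg_fixP/eqP/L3G_comm/comL3.
by apply: (subsetP (corr_L3 C)); apply: comL3.
Qed.

Local Notation E := (D / diag_cent).

Lemma diag_lift_norm : D \subset 'N(diag_cent).
Proof. exact/cents_norm/diag_cent_lift. Qed.

Lemma lift_quo_class2 : E^`(1) \subset 'Z(E).
Proof.
rewrite -quotient_der ?diag_lift_norm // subsetI quotientS ?der_sub //=.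
have nD := diag_lift_norm.
rewrite quotient_cents2 ?(subset_trans (der_sub 1 _)) //.
rewrite gen_subG; apply/subsetP=> _ /imset2P[l d Dl Dd ->].
by apply: comm_lift_ker => //; apply: (subsetP (joing_subl _ _)).
Qed.

Lemma lift_quo_exp u : u \in E^`(1) -> u ^+ p = 1.
Proof.
rewrite -quotient_der ?diag_lift_norm //.
case/morphimP=> -[n n'] nn /(subsetP (joing_subl _ diag_cent)) Ll ->.
have /lift_kerP[Ln Ln' _] := Ll.
rewrite -morphX //= pairX (corr_exp C) //.
suff -> : n' ^+ p = 1 by rewrite coset_id ?group1.
apply: (corr_nuI C); rewrite ?group1 ?groupX //.
by rewrite nu1 nuX // (corr_exp C) ?(corr_nuN C).
Qed.

Lemma lift_quo_center d :
  d \in D -> (forall d', d' \in D -> [~ d, d'] \in diag_cent) ->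
  coset diag_cent d \in 'Z(E).
Proof.
move=> Dd cd; have nD := subsetP diag_lift_norm.
apply/centerP; split=> [|_ /morphimP[d' nd' Dd' ->]]; first exact: mem_quotient.
apply/commgP; rewrite -morphR ?nD //= coset_id //; exact: cd.
Qed.

Lemma lift_ker_center l : l \in L -> coset diag_cent l \in 'Z(E).
Proof.
move=> Ll; apply: lift_quo_center => [|d]; first exact: (subsetP ker_sub_lift).
exact: comm_lift_ker.
Qed.

(** Elements over gamma_2(G) lie in L, and p-th powers are central in E because commutators of E
    have exponent p. Two elements of D over the same g differ by some (1, h), which lies in L and so
    is central in E. *)
Lemma lift_Phi_center g h :
  (g, h) \in D -> g \in 'Phi(G) -> coset diag_cent (g, h) \in 'Z(E).
Proof.
have nD := subsetP diag_lift_norm.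
pose M := ([morphism of @fst gT hT] @* (D :&: coset diag_cent @*^-1 'Z(E)))%G.
have sM : 'Phi(G) \subset M.
  rewrite (Phi_joing (corr_pG C)) join_subG; apply/andP; split.
    apply/subsetP=> n Ln; have [n' Dn] := lift_fst n.
    apply/morphimP; exists (n, n') => //; rewrite inE Dn.
    by rewrite mem_morphpre ?nD // lift_ker_center // lift_L2.
  rewrite (MhoE 1 (corr_pG C)) gen_subG; apply/subsetP=> _ /imsetP[x _ ->].
  have [y Dxy] := lift_fst x.
  apply/morphimP; exists ((x, y) ^+ (p ^ 1)); [by rewrite inE | | by rewrite pairX].
  rewrite inE (groupX _ Dxy) mem_morphpre ?groupX ?nD // morphX ?nD //=.
  have Exy : coset diag_cent (x, y) \in E by apply: mem_quotient.
  apply/centerP; split; rewrite ?groupX // => e Ee.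
  apply/commgP; rewrite (proj1 (comm_cent2X _ lift_quo_class2 _ _)) //.
  by rewrite expn1 lift_quo_exp // mem_commg.
move=> Dg /(subsetP sM)/morphimP[[g' h'] _ /setIP[Dg' Zg'] /= eg].
have -> : (g, h) = (g', h') * (1, h'^-1 * h).
  by rewrite pairM mulg1 mulKVg eg.
have D1 : (1, h'^-1 * h) \in D.
  have -> : (1, h'^-1 * h) = (g', h')^-1 * (g, h).
    by rewrite pairV pairM eg mulVg.
  by rewrite groupM ?groupV.
have Z1 : coset diag_cent (g', h') \in 'Z(E) by case/morphpreP: Zg'.
by rewrite morphM ?nD // (groupM Z1) // lift_ker_center // lift_L2 ?group1.
Qed.

(** Transfers generation from G to E: membership in [Q] may be tested on first coordinates, because
    all choices of the second one agree modulo the centre of E. *)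
Lemma lift_gen_quo (Q : {group coset_of diag_cent}) (X : {set gT}) g h :
  'Z(E) \subset Q ->
  (forall x, x \in X -> exists2 y, (x, y) \in D & coset diag_cent (x, y) \in Q) ->
  (g, h) \in D -> g \in X <*> 'Phi(G) -> coset diag_cent (g, h) \in Q.
Proof.
move=> sZQ XQ; have nD := subsetP diag_lift_norm.
pose M := ([morphism of @fst gT hT] @* (D :&: coset diag_cent @*^-1 Q))%G.
have sM : X <*> 'Phi(G) \subset M.
  rewrite join_subG; apply/andP; split; apply/subsetP=> x Xx.
    have [y Dxy Qxy] := XQ x Xx.
    by apply/morphimP; exists (x, y) => //; rewrite inE Dxy mem_morphpre ?nD.
  have [y Dxy] := lift_fst x.
  apply/morphimP; exists (x, y) => //; rewrite inE Dxy mem_morphpre ?nD //.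
  by rewrite (subsetP sZQ) // lift_Phi_center.
move=> Dg /(subsetP sM)/morphimP[[g' h'] _ /setIP[Dg' Zg'] /= eg].
have -> : (g, h) = (g', h') * (1, h'^-1 * h).
  by rewrite pairM mulg1 mulKVg eg.
have D1 : (1, h'^-1 * h) \in D.
  have -> : (1, h'^-1 * h) = (g', h')^-1 * (g, h).
    by rewrite pairV pairM eg mulVg.
  by rewrite groupM ?groupV.
have Q1 : coset diag_cent (g', h') \in Q by case/morphpreP: Zg'.
rewrite morphM ?nD // (groupM Q1) //.
by apply/(subsetP sZQ)/lift_ker_center/lift_L2; rewrite ?group1.
Qed.

Lemma lift_commuteP d d' : d \in D -> d' \in D ->
  reflect (commute (coset diag_cent d) (coset diag_cent d')) ([~ d, d'] \in diag_cent).
Proof.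
move=> Dd Dd'; have nD := subsetP diag_lift_norm.
apply: (iffP idP) => [dd' | /commgP/eqP].
  by apply/commgP; rewrite -morphR ?nD //= coset_id.
by rewrite -morphR ?nD //= => /coset_idr; apply; rewrite groupR ?nD.
Qed.

(** The cosets of all such elements lie in the subgroup generated by two commuting cosets and the
    centre of E, which is abelian. *)
Lemma lift_comm_span v w v' w' d d' :
  (v, v') \in D -> (w, w') \in D -> [~ (v, v'), (w, w')] \in diag_cent ->
  d \in D -> d' \in D -> d.1 \in [set v; w] <*> 'Phi(G) ->
  d'.1 \in [set v; w] <*> 'Phi(G) -> [~ d, d'] \in diag_cent.
Proof.
move=> Dv Dw /(lift_commuteP Dv Dw) cvw Dd Dd' sd sd'.
apply/lift_commuteP => //.
pose qv := coset diag_cent (v, v'); pose qw := coset diag_cent (w, w').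
pose Q := ([set qv; qw] <*> 'Z(E))%G.
have Evw : [set qv; qw] \subset E.
  by rewrite subUset !sub1set !mem_quotient.
have abQ : abelian Q.
  rewrite /Q /= -joing_idl abelianY center_abelian abelian_gen /=.
  have sEZ : E \subset 'C('Z(E)) by rewrite centsC subsetIr.
  rewrite cent_gen (subset_trans (subsetIr E _)) ?centS // ?andbT //.
  apply/centsP=> a; rewrite !inE => /orP[] /eqP-> b; rewrite !inE => /orP[] /eqP->//.
have mQ g h : (g, h) \in D -> g \in [set v; w] <*> 'Phi(G) ->
    coset diag_cent (g, h) \in Q.
  apply: lift_gen_quo => [|x]; first exact: joing_subr.
  rewrite !inE => /orP[] /eqP->; [exists v' | exists w'] => //;
    by apply: (subsetP (joing_subl _ _)); rewrite !inE eqxx ?orbT.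
case: d d' Dd Dd' sd sd' => g h [g' h'] Dd Dd' sd sd'.
by apply: (centsP abQ); apply: mQ.
Qed.

(** Three generators of G give three generators of E modulo its centre, as [der1_commutator]
    requires. *)
Lemma lift_der x y z l : G \subset <<[set x; y; z]>> -> l \in D^`(1) ->
  exists d d', [/\ d \in D, d' \in D & l * [~ d, d']^-1 \in diag_cent].
Proof.
move=> sG Dl; have nD := subsetP diag_lift_norm.
have [x' Dx] := lift_fst x; have [y' Dy] := lift_fst y; have [z' Dz] := lift_fst z.
pose q (g : gT) (h : hT) := coset diag_cent (g, h).
have sDD := der_sub 1 D.
have [||u [v []]] := @der1_commutator _ (E)%G p (q x x') (q y y') (q z z') (coset diag_cent l)
  pr_p lift_quo_class2 lift_quo_exp (mem_quotient _ Dx) (mem_quotient _ Dy) (mem_quotient _ Dz).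
- have ex : <<[set q x x'; q y y'; q z z']>> \subset 'C('Z(E)).
    rewrite gen_subG (subset_trans (_ : _ \subset E)) ?(centsC E) ?subsetIr //.
    by rewrite !subUset !sub1set !mem_quotient.
  rewrite -cent_joinEl // joing_idl; apply/subsetP=> _ /morphimP[[g h] _ Dg ->].
  apply: (@lift_gen_quo ([set q x x'; q y y'; q z z'] <*> 'Z(E))%G [set x; y; z]) => //.
  + exact: joing_subr.
  + move=> t; rewrite !inE -!orbA => /or3P[] /eqP->; [exists x' | exists y' | exists z'] => //;
      by apply: (subsetP (joing_subl _ _)); rewrite !inE eqxx ?orbT.
  have /(subsetP sG) : g \in G by rewrite inE.
  apply/subsetP; rewrite gen_subG; exact: joing_subl.
- by rewrite -quotient_der ?diag_lift_norm // mem_quotient.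
case/morphimP=> d nd Dd -> /morphimP[d' nd' Dd' ->] e.
exists d, d'; split=> //.
have Dl' := subsetP sDD _ Dl.
apply: coset_idr; first by rewrite nD // groupM // groupV groupR.
by rewrite morphM ?nD ?groupV ?groupR // morphV ?nD ?groupR // morphR ?nD //= e mulgV.
Qed.

Lemma lift_isom x y z : G \subset <<[set x; y; z]>> ->
  (forall d d', d \in D -> d' \in D -> [~ d.1, d'.1] \in 'Z(G) ->
     [~ d, d'] \in diag_cent) ->
  exists2 f : gT -> hT, {morph f : a b / a * b} & bijective f.
Proof.
move=> sG B.
have D1 h : (1, h) \in D -> h = 1.
  move=> Dh; have /mulsgP : (1, h) \in D^`(1) * diag_cent.
    rewrite -norm_joinEl; first exact: lift_L2.
    by rewrite (subset_trans (der_sub 1 D)) ?diag_lift_norm.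
  case=> l c Dl Cc eh; have [d [d' [Dd Dd' lc]]] := lift_der sG Dl.
  (* The first coordinates of [l] and [c] multiply to 1 and that of [c] is central, hence so is that
     of [d, d']. *)
  have Cdd : [~ d, d'] \in diag_cent.
    apply: B => //.
    case: d d' l c eh lc Cc {Dl Dd Dd'} => d1 d2 [d1' d2'] [l1 l2] [c1 c2] [e1 _].
    rewrite pairR pairV pairM => /diag_centP[_ _ Zl] /diag_centP[_ _ Zc] /=.
    have Zl1 : l1 \in 'Z(G) by rewrite -(groupMr _ Zc) -e1 group1.
    by rewrite groupMl // groupV in Zl.
  have : (1, h) \in diag_cent.
    by rewrite eh groupM // -(mulgKV [~ d, d'] l) groupM.
  by case/diag_centP=> Lh e _; apply: (corr_nuI C); rewrite ?group1 // nu1.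
have /fin_all_exists[f fD] : forall g, exists h, (g, h) \in D by apply: lift_fst.
have fE g h : (g, h) \in D -> f g = h.
  move=> Dg; apply/eqP; rewrite eq_mulgV1; apply/eqP/D1.
  have -> : (1, f g * h^-1) = (g, f g) * (g, h)^-1 by rewrite pairV pairM mulgV.
  by rewrite groupM ?groupV.
exists f => [a b|].
  by apply: fE; rewrite -pairM groupM.
have fS : codom f =i predT.
  by move=> h; have [g /fE <-] := lift_snd h; rewrite codom_f.
have cGH : (#|gT| <= #|hT|)%N by have := lift_card; rewrite !cardsT.
have injf : injective f.
  apply/injectiveP/card_uniqP; rewrite size_codom; apply/eqP.
  by rewrite eqn_leq {2}(eq_card fS) cGH andbT -(size_codom f) card_size.
by apply: inj_card_bij => //; rewrite -(eq_card fS) -(size_codom f) card_size.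
Qed.

End Diagonal.
End Correspondence.

(** * Powers, coordinates modulo the Frattini subgroup and twisting *)

Lemma expg_FpD (gT : finGroupType) p (x : gT) (a b : 'F_p) :
  prime p -> x ^+ p = 1 -> x ^+ (a + b)%R = x ^+ a * x ^+ b.
Proof.
move=> pr_p xp; rewrite -expgD -[in RHS](expg_mod (a + b) xp); congr (_ ^+ _).
by congr (_ %% _)%N; apply: Fp_cast.
Qed.

Lemma dvdn_bin2_odd p n : odd p -> (p %| n)%N -> (p %| 'C(n, 2))%N.
Proof.
move=> op pn; rewrite -(@Gauss_dvdr p 2) ?coprimen2 // -mul_bin_diag.
by rewrite dvdn_mulr.
Qed.

(** Since [m, g] is central, (g m)^n = g^n m^n [m, g]^C(n, 2); the odd prime p divides C(n, 2) along
    with n. *)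
Lemma expMg_L2 (gT : finGroupType) p (g m : gT) n :
  odd p -> (p %| n)%N -> 'L_3([set: gT]) \subset 'Z([set: gT]) ->
  (forall m, m \in 'L_2([set: gT]) -> m ^+ p = 1) ->
  m \in 'L_2([set: gT]) -> (g * m) ^+ n = g ^+ n.
Proof.
move=> op pn L3Z expL2 Lm.
have Lmg : [~ m, g] \in 'L_3([set: gT]) by apply: comL3.
have c x : commute x [~ m, g].
  by case/centerP: (subsetP L3Z _ Lmg) => _ /(_ x (in_setT _)) /commute_sym.
have X k y : (p %| k)%N -> y \in 'L_2([set: gT]) -> y ^+ k = 1.
  by case/dvdnP=> q -> Ly; rewrite mulnC expgM expL2 // expg1n.
by rewrite expMg_Rmul // (X n m) // (X _ [~ m, g]) ?dvdn_bin2_odd ?comL2 // !mulg1.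
Qed.

Lemma Phi_sub_abelem p (gT : finGroupType) (G B : {group gT}) :
  prime p -> p.-group G -> 'Phi(G) \subset B -> B \subset G ->
  B <| G /\ p.-abelem (G / B).
Proof.
move=> pr_p pG sB sBG.
have [sDP sMP] : G^`(1) \subset 'Phi(G) /\ 'Mho^1(G) \subset 'Phi(G).
  by rewrite (Phi_joing pG) joing_subl joing_subr.
have nBG : B <| G := sub_der1_normal (subset_trans sDP sB) sBG.
split=> //; apply/(abelemP pr_p); split.
  exact/sub_der1_abelian/(subset_trans sDP sB).
move=> _ /morphimP[g Ng Gg ->]; rewrite -morphX //=; apply: coset_id.
apply: (subsetP sB); apply: (subsetP sMP).
by have := Mho_p_elt 1 Gg (mem_p_elt pG Gg); rewrite expn1.
Qed.

(** With these coordinates the elements chosen over [v] and over [w] can be changed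
    independently. *)
Lemma Phi_coord p (gT : finGroupType) (v w : gT) :
  prime p -> p.-group [set: gT] -> v \notin [set w] <*> 'Phi([set: gT]) ->
  exists l : gT -> 'F_p, [/\ forall y z, l (y * z) = (l y + l z)%R,
        forall y, y \in 'Phi([set: gT]) -> l y = 0%R, l w = 0%R & l v = 1%R].
Proof.
move=> pr_p pG nv; have sB : 'Phi([set: gT]) \subset [set w] <*> 'Phi([set: gT]).
  exact: joing_subr.
have [nB abB] := Phi_sub_abelem (B := ([set w] <*> 'Phi([set: gT]))%G) pr_p pG sB (subsetT _).
have [l [lM lB lv]] := abelem_separate pr_p nB abB (in_setT v) nv.
exists l; split=> // [y z|y Py|]; first by apply: lM; rewrite inE.
  exact/lB/(subsetP sB).
by apply/lB/(subsetP (joing_subl _ _)); rewrite inE.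
Qed.

Section LiftBasis.
Variables (p : nat) (gT hT : finGroupType).
Local Notation G := [set: gT]%G.
Local Notation H := [set: hT]%G.
Variables (nu : hT -> gT) (R : {group gT * hT}).
Hypothesis C : correspondence p nu R.
Hypothesis p_odd : odd p.
Hypothesis powlift : forall h e, (0 < e)%N -> h ^+ (p ^ e) \in 'L_2(H) ->
  exists2 g, (g, h) \in R & g ^+ (p ^ e) = nu (h ^+ (p ^ e)).

(** A basis of H / gamma_2(H) is lifted to H arbitrarily; its orders are powers p^e with e > 0, so
    [powlift] supplies partners in G with the right powers. *)
Lemma lift_basis_exists : exists ds, lift_basis p nu R ds.
Proof.
have pr_p := corr_p C.
have nL h : h \in 'N('L_2(H)) by rewrite (subsetP (lcn_norm _ _)) ?inE.
have abA : abelian (H / 'L_2(H)) by apply: sub_der1_abelian.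
have pA : p.-group (H / 'L_2(H)) by apply: quotient_pgroup; apply: corr_pH C.
have [b defA ob] := abelian_structure abA.
have hb x : x \in b -> exists d : gT * hT, [/\ coset 'L_2(H) d.2 = x, d \in R,
     (p %| #[coset 'L_2(H) d.2])%N &
         d.1 ^+ #[coset 'L_2(H) d.2] = nu (d.2 ^+ #[coset 'L_2(H) d.2])].
  move=> bx; have Ax : x \in H / 'L_2(H).
    rewrite -(bigdprodWY defA) mem_gen // (big_rem x) //= inE cycle_id //.
  have [h nh Hh eh] := morphimP Ax.
  have o_gt1 : (1 < #[x])%N.
    have : #[x] \in abelian_type (H / 'L_2(H)) by rewrite -ob map_f.
    by move/(allP (abelian_type_gt1 _)).
  have /p_natP[e oe] : p.-nat #[x] by apply: mem_p_elt pA Ax.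
  have e_gt0 : (0 < e)%N by move: o_gt1; rewrite oe; case: (e).
  have Lh : h ^+ (p ^ e) \in 'L_2(H).
    by apply: coset_idr; rewrite // morphX // -eh -oe expg_order.
  have [g Rg eg] := powlift e_gt0 Lh.
  by exists (g, h); rewrite /= -eh oe; split=> //; rewrite -(prednK e_gt0) expnS dvdn_mulr.
have [ds [eb hds]] : exists ds : seq (gT * hT), b = [seq coset 'L_2(H) d.2 | d <- ds] /\
   forall d, d \in ds -> [/\ d \in R, (p %| #[coset 'L_2(H) d.2])%N &
         d.1 ^+ #[coset 'L_2(H) d.2] = nu (d.2 ^+ #[coset 'L_2(H) d.2])].
  elim: (b) hb => [|x s IHs] hs; first by exists [::].
  have [|ds [-> hds]] := IHs; first by move=> y sy; apply: hs; rewrite inE sy orbT.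
  have [|d [<- h1 h2 h3]] := hs x; first exact: mem_head.
  by exists (d :: ds); split=> // d'; rewrite inE => /predU1P[->|/hds].
exists ds; split=> // [K sK Kds|].
  have sA : H / 'L_2(H) \subset K / 'L_2(H).
    rewrite -(bigdprodWY defA) gen_subG eb big_map big_seq.
    apply: (big_ind (fun A : {set coset_of _} => A \subset K / 'L_2(H))) => [|A B sA sB|d hd]; [exact: sub0set | by rewrite subUset sA |].
    by rewrite cycle_subG mem_quotient ?Kds.
  by rewrite quotientSGK ?lcn_norm in sA.
by rewrite -(card_quotient (lcn_norm 2 H)) -(bigdprod_card defA) eb big_map.
Qed.

(* Pairs whose commutator is central although they are independent modulo the
   Frattini subgroup: for these [~ v, w] may fail to match [nu [~ v', w']]. *)
Definition bad_pair (v w : gT) :=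
  [&& [~ v, w] \in 'Z(G), v \notin [set w] <*> 'Phi(G) & w \notin [set v] <*> 'Phi(G)].

Lemma lift_isom_nobad ds v w v' w' x y z : lift_basis p nu R ds ->
  G \subset <<[set x; y; z]>> ->
  (v, v') \in lift_group nu ds -> (w, w') \in lift_group nu ds ->
  [~ (v, v'), (w, w')] \in diag_cent nu ->
  (forall g h, bad_pair g h -> (g \in [set v; w] <*> 'Phi(G)) && (h \in [set v; w] <*> 'Phi(G))) ->
  exists2 f : gT -> hT, {morph f : a b / a * b} & bijective f.
Proof.
move=> dsP sG Dv Dw vw bad; apply: (lift_isom C dsP sG) => d d' Dd Dd' Zdd.
have [/bad/andP[sd sd']|] := boolP (bad_pair d.1 d'.1).
  exact: (lift_comm_span C dsP Dv Dw vw).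
have self (g : gT) (X : {set gT}) : g \in X -> g \in X <*> 'Phi(G).
  by move=> Xg; apply: (subsetP (joing_subl _ _)).
(* A dependent pair lies over the span of a single element, which commutes with itself. *)
rewrite /bad_pair Zdd /= negb_and !negbK => /orP[] sd.
  case: d' Dd' {Zdd} sd => g h Dg /= sd.
  apply: (lift_comm_span C dsP Dg Dg) => //; rewrite ?setUid //.
    by rewrite commgg (group1 (diag_cent_gp C)).
  by apply: self; rewrite inE.
case: d Dd {Zdd} sd => g h Dg /= sd.
apply: (lift_comm_span C dsP Dg Dg) => //; rewrite ?setUid //.
  by rewrite commgg (group1 (diag_cent_gp C)).
by apply: self; rewrite inE.
Qed.

Hypothesis PhiC : 'Phi(G) \subset 'C('L_2(G)).

Let L2Phi : 'L_2(G) \subset 'Phi(G).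
Proof. by rewrite (Phi_joing (corr_pG C)) joing_subl. Qed.

Let abL2 : abelian 'L_2(G).
Proof. exact: subset_trans PhiC. Qed.

Let cL2 m n : m \in 'L_2(G) -> n \in 'L_2(G) -> commute m n.
Proof. by move=> Lm Ln; apply: (centsP abL2). Qed.

Lemma L2_commM m n g : m \in 'L_2(G) -> n \in 'L_2(G) ->
  [~ m * n, g] = [~ m, g] * [~ n, g] /\ [~ g, m * n] = [~ g, m] * [~ g, n].
Proof.
move=> Lm Ln; rewrite commMgJ commgMJ.
have c k x : k \in 'L_2(G) -> [~ k, g] ^ x = [~ k, g].
  by move=> Lk; apply/conjg_fixP/eqP/(L3G_comm C)/comL3.
have -> : [~ g, m] ^ n = [~ g, m] by rewrite -[[~ g, m]]invg_comm conjVg c.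
by rewrite c //; split=> //; apply: cL2; apply: comL2.
Qed.

Lemma L2_commMl m k g : m \in 'L_2(G) -> [~ k * m, g] = [~ k, g] * [~ m, g].
Proof.
move=> Lm; rewrite commMgJ; congr (_ * _); apply/conjg_fixP/commgP.
by apply: cL2 => //; apply: comL2.
Qed.

Lemma L2_commMr m k g : m \in 'L_2(G) -> [~ g, k * m] = [~ g, m] * [~ g, k].
Proof.
move=> Lm; rewrite commgMJ; congr (_ * _); apply/conjg_fixP/commgP.
by apply: cL2 => //; apply: comL2.
Qed.

(** The maps m -> [m, w] and n -> [v, n] are homomorphisms on the abelian group gamma_2(G), so the
    products form a subgroup. It contains the generators of the commutator subgroup because Phi(G)
    centralizes gamma_2(G). *)
Lemma L3_span v w e : 'L_3(G) \subset [~: [set v; w] <*> 'Phi(G), 'L_2(G)] ->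
  e \in 'L_3(G) ->
  exists m n, [/\ m \in 'L_2(G), n \in 'L_2(G) & e = [~ m, w] * [~ v, n]].
Proof.
move=> sL3; pose S := [set e | [exists m in 'L_2(G), exists n in 'L_2(G),
                                 e == [~ m, w] * [~ v, n]]].
have SP e' : reflect (exists m n, [/\ m \in 'L_2(G), n \in 'L_2(G) &
                         e' = [~ m, w] * [~ v, n]]) (e' \in S).
  rewrite inE; apply: (iffP exists_inP) => [[m Lm /exists_inP[n Ln /eqP ->]]|[m [n [Lm Ln ->]]]].
    by exists m, n.
  by exists m => //; apply/exists_inP; exists n.
have gS : group_set S.
  apply/group_setP; split.
    by apply/SP; exists 1, 1; rewrite comm1g commg1 mulg1 !group1.
  move=> _ _ /SP[m [n [Lm Ln ->]]] /SP[m' [n' [Lm' Ln' ->]]].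
  apply/SP; exists (m * m'), (n * n'); rewrite !groupM //; split=> //.
  rewrite (proj1 (L2_commM w Lm Lm')) (proj2 (L2_commM v Ln Ln')).
  have := cL2 (comL2 m' w) (comL2 v n).
  move: [~ m, w] [~ m', w] [~ v, n] [~ v, n'] => a b c d cbc.
  by rewrite -!mulgA; congr (_ * _); rewrite !mulgA cbc.
have S1 m : m \in 'L_2(G) -> [~ m, w] \in S.
  by move=> Lm; apply/SP; exists m, 1; rewrite commg1 mulg1 group1.
have S2 n : n \in 'L_2(G) -> [~ v, n] \in S.
  by move=> Ln; apply/SP; exists 1, n; rewrite comm1g mul1g group1.
have gK : group_set [set k | [forall n in 'L_2(G), [~ k, n] \in S]].
  apply/group_setP; split=> [|k k']; rewrite !inE.
    by apply/forall_inP=> n _; rewrite comm1g (group1 (Group gS)).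
  move=> /forall_inP hk /forall_inP hk'; apply/forall_inP=> n Ln.
  rewrite commMgJ.
  have -> : [~ k, n] ^ k' = [~ k, n].
    rewrite -[[~ k, n]]invg_comm conjVg; congr _^-1.
    by apply/conjg_fixP/eqP/(L3G_comm C)/comL3.
  by apply: (groupM (G := Group gS)); [apply: hk | apply: hk'].
move/(subsetP sL3) => he; apply/SP; apply: (subsetP _ _ he).
rewrite -[S]/(gval (Group gS)) gen_subG; apply/subsetP=> _ /imset2P[k n Kk Ln ->].
have : k \in Group gK.
  apply: (subsetP _ _ Kk); rewrite join_subG subUset !sub1set -andbA.
  apply/and3P; split.
  - by rewrite inE; apply/forall_inP.
  - rewrite inE; apply/forall_inP=> m Lm.
    have -> : [~ w, m] = [~ m^-1, w].
      rewrite -[LHS]invg_comm; apply/eqP; rewrite eq_invg_mul; apply/eqP.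
      by rewrite -(proj1 (L2_commM w Lm _)) ?groupV // mulgV comm1g.
    by apply: S1; rewrite groupV.
  apply/subsetP=> f Pf; rewrite inE; apply/forall_inP=> m Lm.
  have -> : [~ f, m] = 1 by apply/eqP/commgP; apply: (centP (subsetP PhiC _ Pf)).
  exact: (group1 (Group gS)).
by rewrite inE => /forall_inP; apply.
Qed.

(** [lift_ker] becomes central modulo [diag_cent], so changing lifts by its elements leaves
    commutators unchanged there. *)
Lemma lift_comm_cong ds d1 d2 l1 l2 : lift_basis p nu R ds ->
  d1 \in lift_group nu ds -> d2 \in lift_group nu ds ->
  l1 \in lift_ker nu ds -> l2 \in lift_ker nu ds ->
  [~ d1 * l1, d2 * l2]^-1 * [~ d1, d2] \in diag_cent nu.
Proof.
move=> dsP D1 D2 L1 L2; pose Dc := diag_cent_gp C.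
have nD d : d \in lift_group nu ds -> d \in 'N(Dc).
  exact/(subsetP (diag_lift_norm C dsP)).
have Dl l : l \in lift_ker nu ds -> l \in lift_group nu ds.
  exact/(subsetP (ker_sub_lift nu ds)).
have [N1 N2 N3 N4] : [/\ d1 \in 'N(Dc), d2 \in 'N(Dc), l1 \in 'N(Dc) & l2 \in 'N(Dc)].
  by split; apply: nD => //; apply: Dl.
have c2 := lift_quo_class2 C dsP.
have E1 := mem_quotient Dc D1; have E2 := mem_quotient Dc D2.
have Z1 : coset Dc l1 \in 'Z(lift_group nu ds / Dc) by exact: (lift_ker_center C dsP L1).
have Z2 : coset Dc l2 \in 'Z(lift_group nu ds / Dc) by exact: (lift_ker_center C dsP L2).
have Q1 := mem_quotient Dc (Dl _ L1); have Q2 := mem_quotient Dc (Dl _ L2).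
suff: coset Dc ([~ d1 * l1, d2 * l2]^-1 * [~ d1, d2]) = 1.
  by move/coset_idr; apply; rewrite groupM ?groupV ?groupR ?groupM.
rewrite morphM ?groupV ?groupR ?groupM // morphV ?groupR ?groupM //.
rewrite !morphR ?groupM //= !morphM //.
rewrite (proj1 (comm_cent2M c2 E1 Q1 (groupM E2 Q2))).
rewrite (proj2 (comm_cent2M c2 E2 Q2 E1)) (proj2 (comm_cent2M c2 E2 Q2 Q1)).
have cZ a b : a \in 'Z(lift_group nu ds / Dc) -> b \in lift_group nu ds / Dc ->
    [~ a, b] = 1 /\ [~ b, a] = 1.
  by case/centerP=> _ ca /ca c; split; apply/eqP/commgP => //; apply: commute_sym.
by rewrite (proj1 (cZ _ _ Z1 E2)) (proj1 (cZ _ _ Z1 Q2)) (proj2 (cZ _ _ Z2 E1)) !mulg1 mulVg.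
Qed.

Section Twist.
Variables (ds : seq (gT * hT)) (mu : gT -> gT).
Hypothesis dsP : lift_basis p nu R ds.
Hypothesis muL : forall g, mu g \in 'L_2(G).
Hypothesis muM : forall g g', mu (g * g') = mu g * mu g'.
Hypothesis muPhi : forall g, g \in 'Phi(G) -> mu g = 1.

(* Multiplying g-components by elements of L_2(G) preserves the powers that
   [lift_basis] is concerned with. *)
Definition twist := [seq (d.1 * mu d.1, d.2) | d <- ds].

Lemma twist_lift_basis : lift_basis p nu R twist.
Proof.
case: dsP => dsR dsK dsc; split=> [_ /mapP[d hd ->] /=|K sK hK|].
- have [Rd pd ed] := dsR d hd; split=> //.
    have -> : (d.1 * mu d.1, d.2) = d * (mu d.1, 1).
      by case: (d) => a b; rewrite pairM mulg1.
    by rewrite groupM // (corr_ker C) (subsetP L2Phi).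
  by rewrite (expMg_L2 _ p_odd pd (corr_L3 C) (corr_exp C)).
- by apply: dsK => // d hd; apply: (hK (d.1 * mu d.1, d.2)); apply/mapP; exists d.
by rewrite big_map.
Qed.

(** As [mu] takes values in gamma_2(G), the map g -> g mu(g) is multiplicative modulo the central
    gamma_3(G). *)
Lemma twist_sub g' h : (g', h) \in lift_group nu twist ->
  exists2 g, (g, h) \in lift_group nu ds & (g * mu g)^-1 * g' \in 'L_3(G).
Proof.
pose Q := [set d : gT * hT | [exists g, ((g, d.2) \in lift_group nu ds) &&
                                ((g * mu g)^-1 * d.1 \in 'L_3(G))]].
have gQ : group_set Q.
  apply/group_setP; split=> [|[a1 h1] [a2 h2]].
    rewrite inE; apply/existsP; exists 1.
    by rewrite muPhi ?group1 // !mulg1 invg1 group1.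
  rewrite !inE /= => /existsP[g1 /andP[D1 Z1]] /existsP[g2 /andP[D2 Z2]].
  apply/existsP; exists (g1 * g2); rewrite -pairM groupM //= muM.
  set z1 := _ * a1 in Z1; set z2 := _ * a2 in Z2.
  have -> : a1 = g1 * mu g1 * z1 by rewrite mulKVg.
  have -> : a2 = g2 * mu g2 * z2 by rewrite mulKVg.
  have c z x : z \in 'L_3(G) -> z * x = x * z.
    by move=> Lz; apply/commgP/eqP/(L3G_comm C).
  have -> : (g1 * g2 * (mu g1 * mu g2))^-1 * (g1 * mu g1 * z1 * (g2 * mu g2 * z2))
          = [~ mu g1, g2] ^ mu g2 * (z2 * z1).
    rewrite -[g1 * mu g1 * z1 * _]mulgA (c z1) //.
    by rewrite /commg /conjg !invMg !mulgA !mulgKV.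
  apply: groupM; last exact: groupM.
  by rewrite memJ_norm ?comL3 // (subsetP (lcn_norm _ _)) ?inE.
have : lift_group nu twist \subset Group gQ.
  rewrite gen_subG subUset; apply/andP; split; apply/subsetP=> -[a b].
    rewrite inE => /mapP[d hd [-> ->]]; rewrite inE /=; apply/existsP; exists d.1.
    by rewrite mulVg group1 andbT -surjective_pairing mem_gen // !inE hd.
  move=> Cab; rewrite inE; apply/existsP; exists a.
  rewrite (subsetP (diag_sub_lift nu ds) _ Cab).
  move/diag_centP: Cab => [Lb -> _] /=.
  by rewrite muPhi ?mulg1 ?mulVg ?group1 // (subsetP L2Phi) // (corr_nuN C).
move/subsetP=> sQ /sQ; rewrite inE => /existsP[g /andP[Dg Zg]].
by exists g.
Qed.

End Twist.

Lemma correspondence_isom (K : {group gT}) x y z : G \subset <<[set x; y; z]>> ->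
  (forall v w, bad_pair v w ->
     K :=: [set v; w] <*> 'Phi(G) /\ 'L_3(G) \subset [~: K, 'L_2(G)]) ->
  exists2 f : gT -> hT, {morph f : a b / a * b} & bijective f.
Proof.
move=> sG hK; have [ds dsP] := lift_basis_exists.
have [/existsP[v /existsP[w bvw]]|nbad] := boolP [exists v, exists w, bad_pair v w]; last first.
  (* With no bad pair the span condition is vacuous, and trivial pairs serve. *)
  apply: (@lift_isom_nobad ds 1 1 1 1 x y z dsP sG).
  - exact: (group1 <<_>>%G).
  - exact: (group1 <<_>>%G).
  - by rewrite commgg (group1 (diag_cent_gp C)).
  by move=> v w bvw; case/existsP: nbad; exists v; apply/existsP; exists w.
have [eK sL3] := hK v w bvw; rewrite eK in sL3.
have /and3P[Zvw nv nw] := bvw.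
have [v' Dv] := lift_fst C dsP v; have [w' Dw] := lift_fst C dsP w.
have sR := subsetP (lift_sub_R C dsP).
have Lf : [~ v, w]^-1 * nu [~ v', w'] \in 'L_3(G) by apply: (corr_comm C); apply: sR.
have [mv [mw [Lmv Lmw ef]]] := L3_span sL3 Lf.
have [al [alM alPhi alw alv]] := Phi_coord (corr_p C) (corr_pG C) nv.
have [be [beM bePhi bev bew]] := Phi_coord (corr_p C) (corr_pG C) nw.
have pr_p := corr_p C.
have expL2 := corr_exp C.
(* The twist by [mu] changes [~ v, w] by the factor [~ mv, w] * [~ v, mw], which
   is exactly the discrepancy with [nu [~ v', w']]. *)
pose mu g := mv ^+ (al g) * mw ^+ (be g).
have muL g : mu g \in 'L_2(G) by rewrite groupM ?groupX.
have muM g g' : mu (g * g') = mu g * mu g'.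
  rewrite /mu alM beM !expg_FpD ?expL2 // -!mulgA; congr (_ * _).
  by rewrite !mulgA; congr (_ * _); apply: cL2; apply: groupX.
have muPhi g : g \in 'Phi(G) -> mu g = 1.
  by move=> Pg; rewrite /mu alPhi // bePhi // !expg0 mulg1.
have muv : mu v = mv by rewrite /mu alv bev expg0 mulg1 /= (_ : (1 %% _)%N = 1%N) ?expg1.
have muw : mu w = mw by rewrite /mu alw bew expg0 mul1g /= (_ : (1 %% _)%N = 1%N) ?expg1.
have tP := twist_lift_basis dsP muL.
have [v1 Tv] := lift_fst C tP v; have [w1 Tw] := lift_fst C tP w.
apply: (@lift_isom_nobad _ v w v1 w1 x y z tP sG Tv Tw) => [|g h bgh]; last first.
  have [eK' _] := hK g h bgh; rewrite -eK eK'.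
  by rewrite !(subsetP (joing_subl _ _)) // !inE eqxx ?orbT.
(* [g] and [h] are the untwisted partners of [v1] and [w1]: modulo gamma_3(G), v = g mv and w = h
   mw. *)
have [g Dg zg] := twist_sub muL muM muPhi Tv.
have [h Dh zh] := twist_sub muL muM muPhi Tw.
pose n1 := g^-1 * v; pose n2 := h^-1 * w.
have L2n a b : (a * mu a)^-1 * b \in 'L_3(G) -> a^-1 * b \in 'L_2(G).
  move=> /(subsetP (lcn_subS 2 G)) L2; rewrite -(groupMl _ (groupVr (muL a))).
  by rewrite mulgA -invMg.
have Ln1 : n1 \in 'L_2(G) by apply: L2n.
have Ln2 : n2 \in 'L_2(G) by apply: L2n.
have ev : v = g * n1 by rewrite mulKVg.
have ew : w = h * n2 by rewrite mulKVg.
have mug : mu g = mv by rewrite -muv ev muM (muPhi n1) ?mulg1 ?(subsetP L2Phi).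
have muh : mu h = mw by rewrite -muw ew muM (muPhi n2) ?mulg1 ?(subsetP L2Phi).
have L1 : (v, v')^-1 * (g, v1) \in lift_ker nu ds.
  have : (v, v')^-1 * (g, v1) \in lift_group nu ds by rewrite groupM ?groupV.
  rewrite pairV pairM => /(lift_L2 C dsP); apply.
  by rewrite ev invMg mulgKV groupV.
have L2 : (w, w')^-1 * (h, w1) \in lift_ker nu ds.
  have : (w, w')^-1 * (h, w1) \in lift_group nu ds by rewrite groupM ?groupV.
  rewrite pairV pairM => /(lift_L2 C dsP); apply.
  by rewrite ew invMg mulgKV groupV.
have := lift_comm_cong dsP Dv Dw L1 L2.
rewrite !mulKVg !pairR pairV pairM => /diag_centP[_ eA _].
rewrite (corr_nuM C) ?groupV ?comL2 // (nuV C) ?comL2 // in eA.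
apply/diag_centP; split; rewrite ?comL2 //.
have n1w : [~ n1, w] = [~ mv, w].
  have Lz : mv^-1 * n1 \in 'L_3(G) by rewrite -mug mulgA -invMg.
  rewrite -(mulKVg mv n1) (proj1 (L2_commM w Lmv _)) ?(L3_sub2 Lz) //.
  by rewrite (L3G_comm C w Lz) mulg1.
have gn2 : [~ g, n2] = [~ v, mw].
  have Lz : mw^-1 * n2 \in 'L_3(G) by rewrite -muh mulgA -invMg.
  rewrite -(mulKVg mw n2) (proj2 (L2_commM g Lmw _)) ?(L3_sub2 Lz) //.
  have -> : [~ g, mw^-1 * n2] = 1.
    by apply/eqP/commgP/commute_sym/commgP/eqP/(L3G_comm C).
  rewrite mulg1 ev L2_commMl //.
  have -> : [~ n1, mw] = 1 by apply/eqP/commgP; apply: cL2.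
  by rewrite mulg1.
have eB : [~ v, w] = [~ v, mw] * [~ g, h] * [~ mv, w].
  by rewrite {1}ev L2_commMl // n1w {1}ew L2_commMr // gn2.
have eY : nu [~ v', w'] = [~ v, w] * ([~ mv, w] * [~ v, mw]) by rewrite -ef mulKVg.
have eX : nu [~ v1, w1] = nu [~ v', w'] * ([~ g, h]^-1 * [~ v, w])^-1.
  by rewrite eA invMg invgK mulKVg.
rewrite {}eX {}eY.
have Lm : [~ mv, w] \in 'L_2(G) by apply: comL2.
have La : [~ v, mw] \in 'L_2(G) by apply: comL2.
have LA : [~ g, h] \in 'L_2(G) by apply: comL2.
rewrite (cL2 (comL2 v w) (groupM Lm La)) [in RHS]invMg invgK.
rewrite [RHS]mulgA mulgK eB.
by rewrite -[RHS]mulgA (cL2 Lm (groupM La LA)).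
Qed.

End LiftBasis.

(** * Small group algebras *)

Local Open Scope ring_scope.

Lemma exprDp_comm (S : pzRingType) p e (x y : S) : prime p -> p%:R = 0 :> S ->
  GRing.comm x y -> (x + y) ^+ (p ^ e)%N = x ^+ (p ^ e)%N + y ^+ (p ^ e)%N.
Proof.
move=> pr_p p0; elim: e x y => [|e IHe] x y cxy; first by rewrite expn0 !expr1.
have Dp a b : GRing.comm a b -> (a + b : S) ^+ p = a ^+ p + b ^+ p.
  move=> cab; rewrite (exprDn_comm _ cab).
  move: pr_p p0; case: (p) => // q pr_q q0.
  rewrite big_ord_recl big_ord_recr /= subn0 expr0 mulr1 bin0 mulr1n.
  rewrite /bump /= add1n subnn expr0 mul1r binn mulr1n big1 ?add0r // => i _.
  rewrite /bump /= add1n.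
  have /dvdnP[k ->] : (q.+1 %| 'C(q.+1, i.+1))%N.
    by rewrite prime_dvd_bin //= ltnS.
  by rewrite mulrnA -mulr_natr q0 mulr0.
rewrite expnS !exprM Dp // IHe //.
exact/commrX/commr_sym/commrX/commr_sym.
Qed.

Lemma mulrn_FpD (V : zmodType) p (x : V) (a b : 'F_p) : prime p -> x *+ p = 0 ->
  x *+ (a + b)%R = x *+ a + x *+ b.
Proof.
move=> pr_p xp.
have mod n : x *+ (n %% p) = x *+ n.
  by rewrite [in RHS](divn_eq n p) mulrnDr mulnC mulrnA xp mul0rn add0r.
rewrite -mulrnDr -[in RHS]mod; congr (_ *+ _); congr (_ %% _)%N; exact: Fp_cast.
Qed.

(* The properties of the map from a group to its small group algebra that are
   used. The hypothesis on [chi] in [sa_ext] says that the linear extension of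
   [chi] to the group algebra kills the elements (g - 1)(n - 1). *)
Record small_alg (p : nat) (gT : finGroupType) (S : pzRingType) (i : gT -> S) : Prop :=
  SmallAlg {
  sa_prime : prime p;
  sa1 : i 1%g = 1;
  saM : forall g h, i (g * h)%g = i g * i h;
  sa_ind : forall P : S -> Prop,
    P 0 -> (forall x g, P x -> P (x + i g)) -> forall x, P x;
  sa_p : p%:R = 0 :> S;
  sa_mul : forall g n, n \in 'L_2([set: gT])%g -> (i g - 1) * (i n - 1) = 0;
  sa_ext : forall chi : gT -> 'F_p,
    (forall g n, n \in 'L_2([set: gT])%g -> chi (g * n)%g + chi 1%g = chi g + chi n) ->
    exists chi' : {additive S -> 'F_p}, forall g, chi' (i g) = chi g
}.

Section SmallAlgTheory.
Variables (p : nat) (gT : finGroupType) (S : pzRingType) (i : gT -> S).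
Hypothesis SA : small_alg p i.
Let pr_p := sa_prime SA.
Local Notation G := [set: gT]%G.

Lemma sa_eps_exists : exists eps : {additive S -> 'F_p}, forall g, eps (i g) = 1.
Proof. by apply: (sa_ext SA (chi := fun=> 1)). Qed.

Variable eps : {additive S -> 'F_p}.
Hypothesis epsi : forall g, eps (i g) = 1.

Lemma saMnp (x : S) : x *+ p = 0.
Proof. by rewrite -mulr_natr (sa_p SA) mulr0. Qed.

Lemma saMnD (x : S) (a b : 'F_p) : x *+ (a + b)%R = x *+ a + x *+ b.
Proof. exact: mulrn_FpD (saMnp x). Qed.

Lemma eps1 : eps 1 = 1. Proof. by rewrite -(sa1 SA). Qed.

Lemma epsM x y : eps (x * y) = eps x * eps y.
Proof.
move: x; apply: (sa_ind SA) => [|x g IH]; first by rewrite mul0r !raddf0 mul0r.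
rewrite mulrDl !raddfD IH epsi mulrDl; congr (_ + _).
move: y {IH}; apply: (sa_ind SA) => [|y h IH]; first by rewrite mulr0 !raddf0 mulr0.
by rewrite mulrDr !raddfD IH -(saM SA) !epsi !mul1r.
Qed.

Lemma saV g : i g * i g^-1%g = 1 /\ i g^-1%g * i g = 1.
Proof. by rewrite -!(saM SA) mulgV mulVg (sa1 SA). Qed.

Lemma eps_sub g : eps (i g - 1) = 0.
Proof. by rewrite raddfB epsi eps1 subrr. Qed.

(** The relation I I(k gamma_2(G)) = 0: the left action on the second layer factors through the
    augmentation. *)
Lemma sa_mulJ y n : n \in 'L_2(G)%g -> y * (i n - 1) = (i n - 1) *+ eps y.
Proof.
move=> Ln; move: y; apply: (sa_ind SA) => [|y g IH]; first by rewrite mul0r raddf0.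
rewrite mulrDl IH raddfD epsi saMnD; congr (_ + _).
by apply/eqP; rewrite mulr1n -subr_eq0 -{2}[i n - 1]mul1r -mulrBl (sa_mul SA).
Qed.

(* The set [L_k(G) - 1] is already an additive subgroup of [S] for [k >= 2]. *)
Definition Jlay k (x : S) := exists2 n, n \in 'L_k(G)%g & x = i n - 1.

Lemma lcn_sub2 k n : n \in 'L_k.+2(G)%g -> n \in 'L_2(G)%g.
Proof. by apply/subsetP; apply: lcn_sub_leq. Qed.

Lemma sa_L2M n m : m \in 'L_2(G)%g ->
  i (n * m)%g - 1 = (i n - 1) + (i m - 1).
Proof.
move=> Lm; have := sa_mulJ (i n) Lm; rewrite epsi mulr1n mulrBr mulr1 => <-.
by rewrite (saM SA) [RHS]addrC addrA subrK.
Qed.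

Lemma JD k x y : Jlay k.+2 x -> Jlay k.+2 y -> Jlay k.+2 (x + y).
Proof.
move=> [n Ln ->] [m Lm ->]; exists (n * m)%g; first exact: groupM.
by rewrite sa_L2M ?(lcn_sub2 Lm).
Qed.

Lemma J0 k : Jlay k 0.
Proof. by exists 1%g; rewrite ?group1 // (sa1 SA) subrr. Qed.

Lemma JN k x : Jlay k.+2 x -> Jlay k.+2 (- x).
Proof.
move=> [n Ln ->]; exists n^-1%g; rewrite ?groupV //; apply/esym/eqP.
by rewrite -addr_eq0 -sa_L2M ?groupV ?(lcn_sub2 Ln) // mulVg (sa1 SA) subrr.
Qed.

Lemma JMn k x n : Jlay k.+2 x -> Jlay k.+2 (x *+ n).
Proof.
move=> Jx; elim: n => [|n IHn]; first exact: J0.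
by rewrite mulrS; apply: JD.
Qed.

Lemma JMl k x y : Jlay k.+2 x -> Jlay k.+2 (y * x).
Proof. by move=> [n Ln ->]; rewrite sa_mulJ ?(lcn_sub2 Ln) //; apply: JMn; exists n. Qed.

Lemma IJ0 x y : eps x = 0 -> Jlay 2 y -> x * y = 0.
Proof. by move=> ex [n Ln ->]; rewrite sa_mulJ // ex. Qed.

Lemma sa_lie x y : Jlay 2 (x * y - y * x).
Proof.
move: x; apply: (sa_ind SA) => [|x g IH]; first by rewrite mul0r mulr0 subrr; apply: J0.
rewrite mulrDl mulrDr opprD addrACA; apply: JD => //.
move: y {IH}; apply: (sa_ind SA) => [|y h IH]; first by rewrite mul0r mulr0 subrr; apply: J0.
rewrite mulrDl mulrDr opprD addrACA; apply: JD => //.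
have -> : i g * i h - i h * i g = i (h * g)%g * (i [~ g, h]%g - 1).
  by rewrite mulrBr mulr1 -!(saM SA) -commgC.
by apply: JMl; exists [~ g, h]%g; rewrite ?mem_commg ?inE.
Qed.

Lemma I_ind (P : S -> Prop) : P 0 -> (forall x g, P x -> P (x + (i g - 1))) ->
  forall x, eps x = 0 -> P x.
Proof.
move=> P0 PD x ex; suff : P (x - 1 *+ eps x) by rewrite ex subr0.
move: x {ex}; apply: (sa_ind SA) => [|x g IH]; first by rewrite raddf0 subr0.
by rewrite raddfD epsi saMnD mulr1n opprD addrACA; apply: PD.
Qed.

(** From (n - 1) g = g (n^g - 1) = n^g - 1 follows (n - 1)(g - 1) = [n, g] - 1: right factors from I
    raise the layer, left ones annihilate it. *)
Lemma JI k x y : Jlay k.+2 x -> eps y = 0 -> Jlay k.+3 (x * y).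
Proof.
move=> [n Ln ->]; move: y; apply: I_ind => [|y g IH].
  by rewrite mulr0; apply: J0.
rewrite mulrDr; apply: JD => //.
have Ln2 := lcn_sub2 Ln.
have Lng : ([~ n, g] \in 'L_k.+3(G))%g by rewrite mem_commg ?inE.
exists [~ n, g]%g => //.
have e1 : i (n ^ g)%g - 1 = (i n - 1) * i g.
  have := sa_mulJ (i g) (_ : n ^ g \in 'L_2(G))%g.
  rewrite memJ_norm ?(subsetP (lcn_norm _ _)) ?inE // => /(_ Ln2).
  rewrite epsi mulr1n mulrBr mulr1 => <-; rewrite mulrBl mul1r.
  by rewrite -!(saM SA) -conjgC.
rewrite mulrBr mulr1 -e1.
rewrite conjg_mulR sa_L2M ?(lcn_sub2 Lng) //.
by rewrite addrAC subrr add0r.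
Qed.

Definition augI : {pred S} := [pred x | eps x == 0].
Definition augI2 : {pred S} := idealM augI augI.

Lemma augI2_ind (P : S -> Prop) : P 0 -> (forall a b, P a -> P b -> P (a + b)) ->
  (forall g h, P ((i g - 1) * (i h - 1))) -> {in augI2, forall x, P x}.
Proof.
move=> P0 PD PM; apply: idealM_ind => // x y /eqP + /eqP ey.
move: x; apply: I_ind => [|x g IH]; first by rewrite mul0r.
rewrite mulrDl; apply: (PD) => // {x IH}.
move: y ey; apply: I_ind => [|y h IH]; first by rewrite mulr0.
by rewrite mulrDr; apply: PD.
Qed.

Lemma augI2_eps x : x \in augI2 -> eps x = 0.
Proof.
move: x; apply: idealM_ind => [|a b ea eb|x y /eqP ex _]; rewrite ?raddf0 //.
  by rewrite raddfD ea eb addr0.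
by rewrite epsM ex mul0r.
Qed.

Lemma augI2Ml a x : x \in augI2 -> a * x \in augI2.
Proof.
move: x; apply: idealM_ind => [|x y|x y ex ey]; first by rewrite mulr0 idealM0.
  by rewrite mulrDr; apply: idealMD.
by rewrite mulrA; apply: idealM1 => //; rewrite inE epsM (eqP ex) mulr0.
Qed.

Lemma augI2Mr a x : x \in augI2 -> x * a \in augI2.
Proof.
move: x; apply: idealM_ind => [|x y|x y ex ey]; first by rewrite mul0r idealM0.
  by rewrite mulrDl; apply: idealMD.
by rewrite -mulrA; apply: idealM1 => //; rewrite inE epsM (eqP ey) mul0r.
Qed.

Lemma augI2N x : x \in augI2 -> - x \in augI2.
Proof. by rewrite -mulN1r; apply: augI2Ml. Qed.

Lemma augI2B x y : x \in augI2 -> y \in augI2 -> x - y \in augI2.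
Proof. by move=> hx hy; apply: idealMD => //; apply: augI2N. Qed.

Lemma augI2_sub g h : (i g - 1) * (i h - 1) \in augI2.
Proof. by apply: idealM1; rewrite inE eps_sub. Qed.

(** Since (h - 1) + (g - 1) = (h g - 1) - (h - 1)(g - 1), the elements g - 1 are closed under
    addition modulo I^2. *)
Lemma augI_lift x : eps x = 0 -> exists g, x - (i g - 1) \in augI2.
Proof.
move: x; apply: I_ind => [|x g [h hx]].
  by exists 1%g; rewrite (sa1 SA) subrr subr0 idealM0.
exists (h * g)%g.
have -> : x + (i g - 1) - (i (h * g)%g - 1) = x - (i h - 1) - (i h - 1) * (i g - 1).
  rewrite (saM SA) [(_ - 1) * (_ - 1)]mulrBr mulr1 mulrBl mul1r.
  rewrite -[LHS]addrA -[RHS]addrA [in RHS]opprB; congr (_ + _).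
  by rewrite [in RHS]opprD addrCA subrr addr0 !opprB addrA subrK.
by apply: augI2B => //; apply: augI2_sub.
Qed.

(** In [a b, z] = a [b, z] + [a, z] b the first term vanishes, and the factor b moves the second
    into the third layer. *)
Lemma augI2_lie q z : q \in augI2 -> Jlay 3 (q * z - z * q).
Proof.
move: q; apply: idealM_ind => [|a b|a b /eqP ea /eqP eb].
- by rewrite mul0r mulr0 subrr; apply: J0.
- by move=> ha hb; rewrite mulrDl mulrDr opprD addrACA; apply: JD.
have -> : a * b * z - z * (a * b) = a * (b * z - z * b) + (a * z - z * a) * b.
  by rewrite mulrBr mulrBl !mulrA addrA subrK.
rewrite IJ0 ?add0r //; last exact: sa_lie.
by apply: JI => //; apply: sa_lie.
Qed.

Lemma IMcomm a x y z : eps a = 0 -> a * (x * y) * z = a * (y * x) * z.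
Proof.
move=> ea; apply/eqP; rewrite -subr_eq0 -mulrBl -mulrBr (IJ0 ea) ?mul0r //.
exact: sa_lie.
Qed.

(** Behind a factor from I products may be reordered, because I annihilates additive commutators
    from the left. *)
Lemma IM_expr a b m : eps a = 0 -> (a * b) ^+ m.+1 = a ^+ m.+1 * b ^+ m.+1.
Proof.
move=> ea; elim: m => [|m IHm] //.
rewrite exprS IHm [a ^+ m.+2]exprS [b ^+ m.+2]exprS.
rewrite -(mulrA a b) (mulrA b) !mulrA -[a * b * _]mulrA (IMcomm _ _ _ ea).
by rewrite !mulrA.
Qed.

Lemma sa_subX g e : (i g - 1) ^+ (p ^ e)%N = i (g ^+ (p ^ e))%g - 1.
Proof.
have saX n : i (g ^+ n)%g = i g ^+ n.
  by elim: n => [|n IHn]; rewrite ?expg0 ?(sa1 SA) // expgS (saM SA) IHn exprS.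
have := exprDp_comm e pr_p (sa_p SA) (x := i g - 1) (y := 1).
rewrite subrK expr1n -saX => ->; first by rewrite addrK.
exact: commr1.
Qed.

Section Class3.
Hypothesis L4 : 'L_4(G)%g = 1%g.

Lemma J4_0 x : Jlay 4 x -> x = 0.
Proof. by move=> [n]; rewrite L4 => /set1gP-> ->; rewrite (sa1 SA) subrr. Qed.

Lemma augI2_comm q q' : q \in augI2 -> q' \in augI2 -> GRing.comm q q'.
Proof.
move=> hq; move: q'; apply: idealM_ind => [|a b|c d ec /eqP ed]; first exact: commr0.
  exact: commrD.
apply/eqP; rewrite -subr_eq0; apply/eqP.
have -> : q * (c * d) - c * d * q = (q * c - c * q) * d + c * (q * d - d * q).
  by rewrite mulrBr mulrBl !mulrA addrA subrK.
rewrite (IJ0 (eqP ec) (sa_lie q d)) addr0.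
by apply: J4_0; apply: JI => //; apply: augI2_lie.
Qed.

Lemma augI3_central q c z : q \in augI2 -> eps c = 0 -> GRing.comm (q * c) z.
Proof.
move=> hq ec; apply/eqP; rewrite -subr_eq0; apply/eqP.
have -> : q * c * z - z * (q * c) = q * (c * z - z * c) + (q * z - z * q) * c.
  by rewrite mulrBr mulrBl !mulrA addrA subrK.
rewrite IJ0 ?add0r ?(augI2_eps hq) //; last exact: sa_lie.
by apply: J4_0; apply: JI => //; apply: augI2_lie.
Qed.

Lemma augI2_expD q q' e : q \in augI2 -> q' \in augI2 ->
  (q + q') ^+ (p ^ e)%N = q ^+ (p ^ e)%N + q' ^+ (p ^ e)%N.
Proof. by move=> hq hq'; rewrite (exprDp_comm e pr_p (sa_p SA)) //; apply: augI2_comm. Qed.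

(** Elements of I^2 commute, so the p^e-th power is additive there; on (g - 1)(h - 1) it gives
    (g^(p^e) - 1)(h^(p^e) - 1). *)
Lemma augI2_expr_ind (P : S -> Prop) e : P 0 -> (forall a b, P a -> P b -> P (a + b)) ->
  (forall g h, P ((i (g ^+ (p ^ e))%g - 1) * (i (h ^+ (p ^ e))%g - 1))) ->
  forall q, q \in augI2 -> P (q ^+ (p ^ e)%N).
Proof.
have pe : (0 < p ^ e)%N by rewrite expn_gt0 prime_gt0.
move=> P0 PD PM q hq; suff [] : q \in augI2 /\ P (q ^+ (p ^ e)%N) by [].
move: q hq; apply: augI2_ind => [|a b [ha Pa] [hb Pb]|g h].
- by rewrite idealM0 expr0n -(prednK pe).
- by split; [apply: idealMD | rewrite augI2_expD //; apply: PD].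
split; first exact: augI2_sub.
by rewrite -(prednK pe) IM_expr ?eps_sub // (prednK pe) !sa_subX.
Qed.

End Class3.

End SmallAlgTheory.

(** * Functionals, p-power maps and units of a small algebra *)

(** [sa_ext] asks for additivity along gamma_2(G) only, so [chi] need not be a homomorphism on G.
    For x outside M the indicator of x M serves; for x in M a functional of M / B is spread over the
    left cosets of M by representatives. *)
Lemma chi_exists p (gT : finGroupType) (M B : {group gT}) x :
  prime p -> B <| M -> p.-abelem (M / B)%g -> x \notin B ->
  exists chi : gT -> 'F_p,
    [/\ forall g n, n \in M -> chi (g * n)%g = chi g + chi n,
        chi 1%g = 0 & chi x = 1].
Proof.
move=> pr_p nBM abMB Bx; have [Mx|nMx] := boolP (x \in M); last first.
  exists (fun g => (g \in (x *: M)%g)%:R); split=> [g n Mn||].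
  - have -> : (n \in x *: M)%g = false.
      by rewrite mem_lcoset groupMr // groupV; apply: negbTE.
    by rewrite addr0 !mem_lcoset mulgA groupMr.
  - by rewrite mem_lcoset mulg1 groupV (negPf nMx).
  by rewrite lcoset_refl.
have [l [lM _ lx]] := abelem_separate pr_p nBM abMB Mx Bx.
have rM g : ((fingroup.repr (g *: M))^-1 * g \in M)%g.
  have := mem_repr g (lcoset_refl M g); rewrite mem_lcoset => h.
  by rewrite -groupV invMg invgK.
have l1 : l 1%g = 0 by apply: (addrI (l 1%g)); rewrite -lM ?group1 // mulg1 addr0.
have rid n : n \in M -> fingroup.repr (n *: M)%g = 1%g.
  by move=> Mn; rewrite lcoset_id // repr_group.
exists (fun g => l ((fingroup.repr (g *: M))^-1 * g)%g); split=> [g n Mn||].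
- by rewrite lcosetM (lcoset_id Mn) mulgA lM // repr_group invg1 mul1g.
- by rewrite rid ?group1 // invg1 mulg1.
by rewrite rid // invg1 mul1g.
Qed.

Lemma Fp_expX p e (a : 'F_p) : prime p -> a ^+ (p ^ e)%N = a.
Proof.
move=> pr_p; elim: e => [|e IHe]; first by rewrite expn0 expr1.
have ap : a ^+ p = a.
  by have := expf_card a; rewrite (card_Fp pr_p).
by rewrite expnS exprM ap.
Qed.

Lemma exprMn_central (S : pzRingType) (a b c : S) m :
  b * a = a * b * c -> GRing.comm c a -> GRing.comm c b ->
  (a * b) ^+ m = a ^+ m * b ^+ m * c ^+ 'C(m, 2).
Proof.
move=> ba ca cb.
have bma n : b ^+ n * a = a * b ^+ n * c ^+ n.
  elim: n => [|n IHn]; first by rewrite !expr0 mul1r !mulr1.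
  rewrite exprS -mulrA IHn !mulrA ba -(mulrA _ c).
  by rewrite (commrX n cb : _ = _) !mulrA -mulrA -exprS.
have cX n y : GRing.comm c y -> c ^+ n * y = y * c ^+ n.
  by move=> cy; apply/commr_sym/commrX/commr_sym.
elim: m => [|m IHm]; first by rewrite !expr0 !mulr1.
rewrite exprSr IHm binS bin1 exprD -mulrA cX; last exact: commrM.
rewrite !mulrA -(mulrA _ _ a) bma !mulrA -exprSr -(mulrA _ _ b) cX // mulrA.
by rewrite -(mulrA _ (b ^+ m)) -exprSr -!mulrA -!exprD addnC.
Qed.

Section UnitTheory.
Variables (p : nat) (gT : finGroupType) (S : pzRingType) (i : gT -> S).
Local Notation G := [set: gT]%G.
Hypotheses (p_odd : odd p) (pG : p.-group G).
Hypothesis SA : small_alg p i.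
Let pr_p := sa_prime SA.
Variable eps : {additive S -> 'F_p}.
Hypothesis epsi : forall g, eps (i g) = 1.
Hypothesis L4 : 'L_4(G)%g = 1%g.
Hypothesis expL2 : forall n, n \in 'L_2(G)%g -> (n ^+ p = 1)%g.
Hypothesis abL2 : abelian 'L_2(G).

(** [chi_exists] with M = gamma_2(G) and B = 1 separates x^-1 y from 1. *)
Lemma sa_inj : injective i.
Proof.
move=> x y exy; apply/eqP; rewrite eq_mulVg1; apply: contraT => nxy.
have : (x^-1 * y)%g \notin [1 gT]%G by rewrite inE.
have ab1 : p.-abelem ('L_2(G) / [1 gT]%G)%g by apply/quotient_abelem/(abelemP pr_p).
case/(chi_exists pr_p (normal1 _) ab1) => chi [chiM chi1 chix].
have [g n Ln|chi' chiE] := sa_ext SA (chi := chi).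
  by rewrite chi1 addr0 chiM.
have ex : i (x^-1 * y)%g = 1 by rewrite (saM SA) -exy -(saM SA) mulVg (sa1 SA).
have := chiE (x^-1 * y)%g; rewrite ex -(sa1 SA) chiE chi1 chix => /esym/eqP.
by rewrite oner_eq0.
Qed.

Lemma sa_center g : (forall h, GRing.comm (i g) (i h)) -> g \in 'Z(G)%g.
Proof.
move=> cg; apply/centerP; split=> [|h _]; first by rewrite inE.
by apply: sa_inj; rewrite !(saM SA); apply: cg.
Qed.

(** x^p - 1 = (x - 1)^p lies in I^3 because p >= 3, and I^3 is central. *)
Lemma sa_MhoZ : ('Mho^1(G) \subset 'Z(G))%g.
Proof.
rewrite (MhoE 1 pG) gen_subG; apply/subsetP=> _ /imsetP[x _ ->].
apply: sa_center => h; apply: commr_sym.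
rewrite -[i (x ^+ _)%g](subrK 1) -(sa_subX SA); apply: commrD; last exact: commr1.
have p_gt2 := odd_prime_gt2 p_odd pr_p.
rewrite expn1 -(subnK p_gt2) addnC; apply: commr_sym.
rewrite -[(3 + _)%N]/((p - 3).+3) exprS [_ ^+ (_).+2]exprS mulrA.
apply: (augI3_central SA epsi L4); first exact: (augI2_sub SA epsi).
by rewrite exprS (epsM SA epsi) (eps_sub SA epsi) mul0r.
Qed.

Lemma sa_L3Z : ('L_3(G) \subset 'Z(G))%g.
Proof.
apply/subsetP=> n Ln; apply/centerP; split=> [|h _]; first by rewrite inE.
by apply/commgP; rewrite -in_set1 -[[set _]]L4 mem_commg ?inE.
Qed.

(** Powers are multiplicative on the central subgroup Mho^e(G), and (g^(p^e))^p = (g^p)^(p^e). *)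
Lemma sa_Mho_root e x : (0 < e)%N -> x \in 'Mho^1('Mho^e(G))%g ->
  exists2 y, y \in 'Mho^1(G)%g & x = (y ^+ (p ^ e))%g.
Proof.
move=> e_gt0; have sPZ : ('Mho^e(G) \subset 'Z(G))%g.
  exact: subset_trans (Mho_leq _ e_gt0) sa_MhoZ.
have abP : abelian 'Mho^e(G) := abelianS sPZ (center_abelian G).
rewrite (MhoEabelian 1 (pgroupS (Mho_sub e G) pG) abP) => /imsetP[s Ps ->].
have gQ : group_set [set s in 'Z(G)%g | [exists y in 'Mho^1(G)%g, s ^+ (p ^ 1) == y ^+ (p ^ e)]%g].
  apply/group_setP; split=> [|a b].
    by apply/setIdP; split; rewrite ?group1 //; apply/exists_inP; exists 1%g; rewrite ?group1 ?expg1n.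
  move=> /setIdP[Za /exists_inP[c Mc /eqP ec]] /setIdP[Zb /exists_inP[d Md /eqP ed]].
  apply/setIdP; split; first exact: groupM.
  apply/exists_inP; exists (c * d)%g; first exact: groupM.
  have cc t u : t \in 'Z(G)%g -> commute t u.
    by case/centerP=> _ /(_ u (in_setT _)).
  have cab : commute a b by apply: cc.
  have ccd : commute c d by apply: cc; apply: (subsetP sa_MhoZ).
  by rewrite !expgMn // ec ed.
have sQ : 'Mho^e(G)%g \subset Group gQ.
  rewrite (MhoE e pG) gen_subG.
  apply/subsetP=> _ /imsetP[g _ ->].
  have pg : p.-elt g by apply: mem_p_elt pG _; rewrite inE.
  apply/setIdP; split.
    exact: (subsetP sPZ _ (Mho_p_elt e (in_setT g) pg)).
  apply/exists_inP; exists (g ^+ (p ^ 1))%g; first exact: (Mho_p_elt 1 (in_setT g) pg).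
  by rewrite -!expgM mulnC.
by have /setIdP[_ /exists_inP[y My /eqP ->]] := subsetP sQ s Ps; exists y.
Qed.

(* If x were not in Mho^1(Mho^e(G)), a functional [chi] with
   [chi \o i] a homomorphism on the abelian group L_2(G) Mho^e(G) would separate
   [i x] from 1; but such a functional kills q^(p^e). *)
Lemma sa_pow_key e x q : (0 < e)%N -> q \in augI2 eps ->
  i x - 1 = q ^+ (p ^ e)%N -> x \in 'Mho^1('Mho^e(G))%g.
Proof.
move=> e_gt0 qI ex; apply: contraT => nx.
have sPZ : ('Mho^e(G) \subset 'Z(G))%g.
  exact: subset_trans (Mho_leq _ e_gt0) sa_MhoZ.
have abP : abelian 'Mho^e(G) := abelianS sPZ (center_abelian G).
(* [M] is abelian and contains all p^e-th powers; its own p-th powers lie in Mho^1(Mho^e(G)) because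
   gamma_2(G) has exponent p. *)
pose M := ('L_2(G) <*> 'Mho^e(G))%G.
have sLP : 'L_2(G) \subset 'C('Mho^e(G)).
  by rewrite centsC (subset_trans sPZ) // (subset_trans (subsetIr _ _)) // centS ?subsetT.
have abM : abelian M by rewrite abelianY abL2 abP centsC.
have sBM : 'Mho^1('Mho^e(G)) \subset M.
  by rewrite (subset_trans (Mho_sub _ _)) ?joing_subr.
have nBM : 'Mho^1('Mho^e(G)) <| M by rewrite /normal sBM (sub_abelian_norm abM).
have abMB : p.-abelem (M / 'Mho^1('Mho^e(G)))%g.
  apply/(abelemP pr_p); split; first exact: quotient_abelian.
  move=> _ /morphimP[m Nm Mm ->]; rewrite -morphX //=; apply: coset_id.
  move: Mm; rewrite /= cent_joinEl // => /mulsgP[n s Ln Ps ->].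
  rewrite expgMn; last by apply: (centsP sLP).
  rewrite expL2 // mul1g.
  have ps : p.-elt s by apply: mem_p_elt pG _; rewrite inE.
  by have := Mho_p_elt 1 Ps ps; rewrite expn1.
have [chi [chiM chi1 chix]] := chi_exists pr_p nBM abMB nx.
have sLM : 'L_2(G) \subset M by apply: joing_subl.
have [g n Ln|chi' chiE] := sa_ext SA (chi := chi).
  by rewrite chi1 addr0 chiM // (subsetP sLM).
have : chi' (i x - 1) = 0.
  rewrite ex; apply: (augI2_expr_ind SA epsi L4 (P := fun z => chi' z = 0)) => //.
  - exact: raddf0.
  - by move=> a b ea eb; rewrite raddfD ea eb addr0.
  move=> g h; set a := (g ^+ _)%g; set b := (h ^+ _)%g.
  rewrite mulrBr mulr1 mulrBl mul1r -(saM SA) opprB raddfD !raddfB !chiE -(sa1 SA) chiE chi1.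
  have Mb : b \in M.
    apply: (subsetP (joing_subr _ _)); apply: Mho_p_elt; rewrite ?inE //.
    by apply: mem_p_elt pG _; rewrite inE.
  by rewrite chiM // sub0r addrK subrr.
by rewrite raddfB chiE -(sa1 SA) chiE chi1 chix subr0 => /eqP; rewrite oner_eq0.
Qed.

Lemma sa_Phi_I2 y : y \in 'Phi(G)%g -> i y - 1 \in augI2 eps.
Proof.
have gK : group_set [set y | i y - 1 \in augI2 eps].
  apply/group_setP; split=> [|a b]; rewrite !inE.
    by rewrite (sa1 SA) subrr idealM0.
  move=> ha hb; have -> : i (a * b)%g - 1 = (i a - 1) * i b + (i b - 1).
    by rewrite mulrBl mul1r addrA subrK (saM SA).
  by apply: idealMD => //; apply: (augI2Mr SA epsi).
suff sK : 'Phi(G)%g \subset Group gK by move/(subsetP sK); rewrite inE.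
rewrite (Phi_joing pG) join_subG; apply/andP; split.
  rewrite gen_subG; apply/subsetP=> _ /imset2P[a b _ _ ->]; rewrite inE.
  have -> : i [~ a, b]%g - 1 = i (a^-1 * b^-1)%g * (i a * i b - i b * i a).
    have e1 : [~ a, b]%g = (a^-1 * b^-1 * (a * b))%g by rewrite commgEl /conjg !mulgA.
    have e2 : (a^-1 * b^-1 * (b * a) = 1)%g by rewrite mulgA mulgKV mulVg.
    by rewrite mulrBr -!(saM SA) e1 e2 (sa1 SA).
  have -> : i a * i b - i b * i a = (i a - 1) * (i b - 1) - (i b - 1) * (i a - 1).
    rewrite [(i a - 1) * _]mulrBr [(i b - 1) * _]mulrBl !mulr1 !mul1r.
    rewrite [- (_ * _ - _)]opprB addrA subrK.
    by rewrite mulrBl mulrBr mul1r mulr1 opprB addrA subrK.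
  by apply: (augI2Ml SA epsi); apply: (augI2B SA epsi); apply: (augI2_sub SA epsi).
rewrite (MhoE 1 pG) gen_subG; apply/subsetP=> _ /imsetP[x _ ->]; rewrite inE.
have -> : i (x ^+ (p ^ 1))%g - 1 = (i x - 1) ^+ 2 * (i x - 1) ^+ (p - 2)%N.
  by rewrite -(sa_subX SA) expn1 -exprD subnKC // prime_gt1.
by apply: (augI2Mr SA epsi); rewrite expr2; apply: (augI2_sub SA epsi).
Qed.

Lemma sa_X g n : i (g ^+ n)%g = i g ^+ n.
Proof. by elim: n => [|n IHn]; rewrite ?expg0 ?(sa1 SA) // expgS (saM SA) IHn exprS. Qed.

Lemma sa_decomp x : eps x = 1 -> exists g q, [/\ x = i g * (1 + q), q \in augI2 eps &
   x - i g \in augI2 eps].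
Proof.
move=> ex; have [|g hg] := augI_lift SA epsi (x := x - 1).
  by rewrite raddfB ex (eps1 SA epsi) subrr.
rewrite opprB addrA subrK in hg.
exists g, (i g^-1%g * (x - i g)); split=> //.
  have [Vg _] := saV SA g.
  by rewrite mulrDr mulr1 mulrA Vg mul1r addrC subrK.
exact: (augI2Ml SA epsi).
Qed.

(** 1 + q and g commute up to a central element c of gamma_3(G), which contributes c^C(p^e, 2) = 1
    as p is odd. *)
Lemma sa_decomp_expr g q e : (0 < e)%N -> q \in augI2 eps ->
  (i g * (1 + q)) ^+ (p ^ e)%N = i (g ^+ (p ^ e))%g * (1 + q ^+ (p ^ e)%N).
Proof.
move=> e_gt0 qI.
have [c Lc ec] := augI2_lie SA epsi (i g) qI.
have cC y : GRing.comm (i c) y.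
  move: y; apply: (sa_ind SA) => [|y h IH]; first exact: commr0.
  apply: commrD => //; rewrite /GRing.comm -!(saM SA).
  by case/centerP: (subsetP sa_L3Z _ Lc) => _ -> //; rewrite inE.
have com : (1 + q) * i g = i g * (1 + q) * i c.
  have := sa_mulJ SA epsi (i g * (1 + q)) (L3_sub2 Lc).
  rewrite (epsM SA epsi) epsi raddfD (eps1 SA epsi) (augI2_eps SA epsi qI) addr0 mulr1 mulr1n.
  rewrite mulrBr mulr1 -ec => /eqP; rewrite subr_eq => /eqP->.
  by rewrite mulrDl mulrDr mul1r mulr1 [RHS]addrCA subrK.
rewrite (exprMn_central _ com) // -!sa_X.
have pC : (p %| 'C(p ^ e, 2))%N.
  by rewrite dvdn_bin2_odd // -(prednK e_gt0) expnS dvdn_mulr.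
rewrite (_ : (c ^+ _)%g = 1%g) ?(sa1 SA) ?mulr1; last first.
  by case/dvdnP: pC => k ->; rewrite mulnC expgM expL2 ?expg1n // (L3_sub2 Lc).
rewrite (exprDp_comm e pr_p (sa_p SA)) ?expr1n //; exact/commr_sym/commr1.
Qed.

(** Comparing powers, (g^(p^e))^-1 n - 1 = q^(p^e), so the discrepancy is y^(p^e) with y in
    Mho^1(G). As y is central and lies in Phi(G), g may be replaced by g y without a change modulo
    I^2. *)
Lemma sa_pow_lift e x n : (0 < e)%N -> eps x = 1 -> n \in 'L_2(G)%g ->
  x ^+ (p ^ e)%N = i n ->
  exists g, x - i g \in augI2 eps /\ (g ^+ (p ^ e))%g = n.
Proof.
move=> e_gt0 ex Ln xn; have [g [q [xE qI hg]]] := sa_decomp ex.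
rewrite xE (sa_decomp_expr _ e_gt0 qI) in xn.
have eq_q : i ((g ^+ (p ^ e))^-1 * n)%g - 1 = q ^+ (p ^ e)%N.
  have [_ Vg] := saV SA (g ^+ (p ^ e))%g.
  by rewrite (saM SA) -xn mulrA Vg mul1r addrC addKr.
have [y My ey] := sa_Mho_root e_gt0 (sa_pow_key e_gt0 qI eq_q).
exists (g * y)%g; split.
  have -> : x - i (g * y)%g = (x - i g) - i g * (i y - 1).
    by rewrite mulrBr mulr1 opprB addrA subrK (saM SA).
  apply: (augI2B SA epsi) => //; apply: (augI2Ml SA epsi).
  apply: sa_Phi_I2; apply: (subsetP _ _ My).
  by rewrite (Phi_joing pG) joing_subr.
rewrite expgMn -?ey ?mulKVg //; apply: commute_sym.
by case/centerP: (subsetP sa_MhoZ _ My) => _ /(_ g (in_setT _)).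
Qed.

Lemma sa_unit1 x : eps x = 1 -> exists y, x * y = 1 /\ y * x = 1.
Proof.
move=> ex; have [g [q [-> qI _]]] := sa_decomp ex.
have [k [k_gt0 q0]] : exists k, (0 < k)%N /\ (1 + q) ^+ k = 1.
  (* The exponent is |G|: the |G|-th power of q is a sum of terms (a^|G| - 1)(b^|G| - 1) = 0. *)
  have /p_natP[e oG] : p.-nat #|G| by [].
  exists (p ^ e)%N; split; first by rewrite expn_gt0 prime_gt0.
  rewrite (exprDp_comm e pr_p (sa_p SA)) ?expr1n; last exact/commr_sym/commr1.
  suff -> : q ^+ (p ^ e)%N = 0 by rewrite addr0.
  apply: (augI2_expr_ind SA epsi L4 (P := fun z => z = 0)) => // [a b -> ->|a b].
    by rewrite addr0.
  by rewrite -oG expg_cardG ?inE // (sa1 SA) subrr mul0r.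
have [Vg Vg'] := saV SA g.
exists ((1 + q) ^+ k.-1 * i g^-1%g); split.
  by rewrite mulrA -(mulrA (i g)) -exprS prednK // q0 mulr1.
by rewrite mulrA -(mulrA _ (i g^-1)%g) Vg' mulr1 -exprSr prednK.
Qed.

Lemma sa_unit x : eps x != 0 -> exists y, x * y = 1 /\ y * x = 1.
Proof.
move=> nz; have [|y [xy yx]] := sa_unit1 (x := x *+ (eps x)^-1%R).
  by rewrite raddfMn -mulr_natr natr_Zp divff.
exists (y *+ (eps x)^-1%R).
by rewrite mulrnAl in xy; rewrite mulrnAr in yx; rewrite mulrnAr mulrnAl.
Qed.

(** The p-power map fixes the augmentation, an element of the prime field. So any homomorphism from
    a p-group to the units of S takes values of augmentation 1. *)
Lemma sa_pelt_eps x e : x ^+ (p ^ e)%N = 1 -> eps x = 1.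
Proof.
move=> xe; rewrite -(Fp_expX e (eps x)) // -(eps1 SA epsi) -xe.
by elim: (p ^ e)%N => [|n IHn]; rewrite ?expr0 ?(eps1 SA epsi) // !exprS (epsM SA epsi) IHn.
Qed.

End UnitTheory.

(** * Counting units *)

Definition nzsum p (A : finType) := [set f : {ffun A -> 'F_p} | \sum_a f a != 0].

(** Strict monotonicity is enough to compare the sets, so the number is not computed. Functions are
    extended by zero along an injection, and the indicator of a missed point is new. *)
Lemma card_nzsum_lt p (A B : finType) :
  (#|A| < #|B|)%N -> (#|nzsum p A| < #|nzsum p B|)%N.
Proof.
move=> ltAB; have leAB := ltnW ltAB.
pose e (a : A) : B := enum_val (widen_ord leAB (enum_rank a)).
have eI : injective e.
  by move=> a b /enum_val_inj/(congr1 val) /= /val_inj/enum_rank_inj.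
have [b0 nb0] : exists b, b \notin codom e.
  apply/existsP; rewrite -negb_forall; apply/negP => /forallP h.
  have : (#|B| <= #|codom e|)%N by apply/subset_leq_card/subsetP=> b _; apply: h.
  by rewrite card_codom // leqNgt ltAB.
pose ext (f : {ffun A -> 'F_p}) : {ffun B -> 'F_p} :=
  [ffun b => if [pick a | e a == b] is Some a then f a else 0].
have extE f a : ext f (e a) = f a.
  by rewrite ffunE; case: pickP => [a' /eqP/eI->|/(_ a)] //; rewrite eqxx.
have ext0 f b : b \notin codom e -> ext f b = 0.
  by rewrite ffunE; case: pickP => [a /eqP<-|//]; rewrite codom_f.
have extI : injective ext.
  by move=> f g efg; apply/ffunP=> a; rewrite -!extE efg.
have sum_ext f : \sum_b ext f b = \sum_a f a.
  rewrite (bigID (mem (codom e))) /= [X in _ + X]big1 ?addr0; last by move=> b; apply: ext0.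
  rewrite (eq_bigl (mem (e @: [set: A]))) => [|b]; last first.
    apply/codomP/imsetP => [[a ->]|[a _ ->]]; last by exists a.
    by exists a; rewrite ?inE.
  rewrite big_imset /=; last by move=> a b _ _; apply: eI.
  by apply: eq_big => [a|a _]; rewrite ?inE ?extE.
rewrite -(card_imset _ extI); apply: proper_card; apply/properP; split.
  apply/subsetP=> _ /imsetP[f Tf ->]; rewrite inE in Tf.
  by rewrite inE sum_ext.
exists [ffun b => (b == b0)%:R]; last first.
  apply/imsetP=> -[f _ /ffunP/(_ b0)]; rewrite ext0 // ffunE eqxx => /eqP.
  by rewrite oner_eq0.
rewrite inE (bigD1 b0) //= ffunE eqxx big1 ?addr0 ?oner_eq0 // => b /negPf nb.
by rewrite ffunE nb.
Qed.

Section Coordinates.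
Variables (p : nat) (gT : finGroupType) (S : pzRingType) (i : gT -> S).
Hypothesis SA : small_alg p i.
Let pr_p := sa_prime SA.
Local Notation G := [set: gT]%G.
Variable eps : {additive S -> 'F_p}.
Hypothesis epsi : forall g, eps (i g) = 1.
Local Notation A := (coset_of 'L_2(G)).

Let nL g : g \in 'N('L_2(G))%g.
Proof. by rewrite (subsetP (lcn_norm _ _)) ?inE. Qed.

Lemma card_abelianization : #|{: A}| = #|G : 'L_2(G)|.
Proof.
rewrite -card_quotient ?lcn_norm // -cardsT; congr #|pred_of_set _|.
apply/esym/eqP; rewrite eqEsubset subsetT; apply/subsetP=> c _.
by rewrite -(coset_reprK c) mem_quotient ?inE.
Qed.

(** The indicator of a coset of gamma_2(G) meets the condition of [sa_ext]; [F c] is the sum of the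
    coefficients over [c]. *)
Lemma coord_exists_fun : exists F : A -> {additive S -> 'F_p},
  forall c g, F c (i g) = (coset 'L_2(G) g == c)%:R.
Proof.
suff /fin_all_exists : forall c : A, exists f : {additive S -> 'F_p},
  forall g, f (i g) = (coset 'L_2(G) g == c)%:R by [].
move=> c; apply: (sa_ext SA) => g n Ln.
by rewrite morphM ?nL //= (coset_id Ln) mulg1 (coset_id (group1 _)).
Qed.

Variable F : A -> {additive S -> 'F_p}.
Hypothesis FE : forall c g, F c (i g) = (coset 'L_2(G) g == c)%:R.

Lemma coordJ c x : Jlay i 2 x -> F c x = 0.
Proof.
by case=> n Ln ->; rewrite raddfB -(sa1 SA) !FE coset_id // morph1 subrr.
Qed.

Definition coset_comb (f : A -> 'F_p) : S := \sum_(c : A) i (fingroup.repr c) *+ f c.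

Lemma coord_coset_comb f c : F c (coset_comb f) = f c.
Proof.
rewrite raddf_sum (bigD1 c) //= raddfMn FE coset_reprK eqxx.
rewrite -mulr_natr mul1r natr_Zp big1 ?addr0 // => c' /negPf nc.
by rewrite raddfMn FE coset_reprK nc mul0rn.
Qed.

Lemma eps_coset_comb f : eps (coset_comb f) = \sum_c f c.
Proof.
rewrite raddf_sum; apply: eq_bigr => c _.
by rewrite raddfMn epsi natr_Zp.
Qed.

Lemma coord_decomp x : Jlay i 2 (x - coset_comb (fun c => F c x)).
Proof.
move: x; apply: (sa_ind SA) => [|x g IH].
  rewrite /coset_comb big1 ?subr0; first exact: J0 SA _.
  by move=> c _; rewrite raddf0.
have -> : coset_comb (fun c => F c (x + i g)) =
   coset_comb (fun c => F c x) + i (fingroup.repr (coset 'L_2(G) g)).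
  rewrite /coset_comb [X in _ = _ + X](_ : _ = \sum_(c : A) i (fingroup.repr c) *+ (coset 'L_2(G) g == c)).
    rewrite -big_split; apply: eq_bigr => c _.
    by rewrite raddfD FE (saMnD SA); congr (_ + _); case: eqP.
  rewrite (bigD1 (coset 'L_2(G) g)) //= eqxx mulr1n big1 ?addr0 // => c.
  by rewrite eq_sym => /negPf->.
rewrite opprD addrACA; apply: (JD SA epsi) => //.
pose r := fingroup.repr (coset 'L_2(G) g); have Lr : (r^-1 * g)%g \in 'L_2(G)%g.
  apply: coset_idr; first exact: nL.
  by rewrite morphM ?nL // morphV ?nL //= coset_reprK mulVg.
have -> : i g - i r = i r * (i (r^-1 * g)%g - 1).
  by rewrite mulrBr mulr1 -(saM SA) mulKVg.
by apply: (JMl SA epsi); exists (r^-1 * g)%g.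
Qed.

Lemma eps_coord x : \sum_c F c x = eps x.
Proof.
have [n Ln e] := coord_decomp x.
have : eps (x - coset_comb (F^~ x)) = 0 by rewrite e (eps_sub SA epsi).
by rewrite raddfB eps_coset_comb => /eqP; rewrite subr_eq0 => /eqP.
Qed.

End Coordinates.

(* The units of a small algebra are in bijection with L_2(G) times the functions on
   G / L_2(G) of non-zero sum, whose number determines |G : L_2(G)|. The maps
   [j1] and [j2] compare the two factors L_2. *)
Lemma sa_count p (gT hT : finGroupType) (S1 S2 : pzRingType)
  (i : gT -> S1) (j : hT -> S2) (eps1 : {additive S1 -> 'F_p}) (eps2 : {additive S2 -> 'F_p})
  (psi : S2 -> S1) (B : finType) (b0 : B) (j1 : B -> S2) (j2 : S1 -> B) :
  small_alg p i -> small_alg p j ->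
  (forall g, eps1 (i g) = 1) -> (forall g, eps2 (j g) = 1) ->
  (forall x y, eps2 x != 0 -> eps2 y != 0 -> psi x = psi y -> x = y) ->
  (forall x, eps2 x != 0 -> eps1 (psi x) != 0) ->
  (forall b, Jlay j 2 (j1 b)) -> injective j1 ->
  (forall x y, Jlay i 2 x -> Jlay i 2 y -> j2 x = j2 y -> x = y) ->
  (#|[set: hT] : 'L_2([set: hT])%g| <= #|[set: gT] : 'L_2([set: gT])%g|)%N.
Proof.
move=> SA1 SA2 e1 e2 psiI psiE j1J j1I j2I.
rewrite -!card_abelianization leqNgt; apply/negP => /(card_nzsum_lt p).
rewrite ltnNge => /negP; apply.
have [F1 F1E] := coord_exists_fun SA1; have [F2 F2E] := coord_exists_fun SA2.
set A1 := coset_of 'L_2([set: gT]); set A2 := coset_of 'L_2([set: hT]).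
have B_gt0 : (0 < #|B|)%N by apply/card_gt0P; exists b0.
rewrite -(leq_pmul2r B_gt0) -!(cardsT B) -!cardsX.
(* [phi] makes an element of non-zero augmentation in S1 out of a function and an element of [B];
   [th] reads off the coset coordinates of such an element and its remainder in the second layer. *)
pose phi (u : {ffun A2 -> 'F_p} * B) : S1 := psi (coset_comb j u.1 + j1 u.2).
pose th (x : S1) := ([ffun c => F1 c x], j2 (x - coset_comb i (fun c => F1 c x))) : {ffun A1 -> 'F_p} * B.
have ne u : u.1 \in nzsum p A2 -> eps2 (coset_comb j u.1 + j1 u.2) != 0.
  rewrite inE raddfD (eps_coset_comb e2); have [n Ln ->] := j1J u.2.
  by rewrite (eps_sub SA2 e2) addr0.
have inX (u : {ffun A2 -> 'F_p} * B) : u \in setX (nzsum p A2) [set: B] -> u.1 \in nzsum p A2.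
  by case: u => f b; rewrite in_setX => /andP[].
rewrite -(@card_in_imset _ _ (th \o phi)).
  apply/subset_leq_card/subsetP=> w /imsetP[u hu ->{w}].
  have {}hu := inX _ hu.
  rewrite in_setX !inE andbT /=.
  under eq_bigr do rewrite ffunE.
  by rewrite (eps_coord SA1 e1 F1E); apply/psiE/ne.
move=> u v /inX hu /inX hv [/ffunP e3 e4].
have ephi : phi u = phi v.
  have ec : coset_comb i (F1^~ (phi u)) = coset_comb i (F1^~ (phi v)).
    by apply: eq_bigr => c _; have := e3 c; rewrite !ffunE => ->.
  have := j2I _ _ (coord_decomp SA1 e1 F1E _) (coord_decomp SA1 e1 F1E _) e4.
  by rewrite ec => /addIr.
have {}ephi := psiI _ _ (ne _ hu) (ne _ hv) ephi.
have eu : u.1 = v.1.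
  apply/ffunP=> c; have := congr1 (F2 c) ephi.
  by rewrite !raddfD !(coord_coset_comb F2E) !(coordJ SA2 F2E) // !addr0.
move: ephi; rewrite eu => /addrI/j1I ev.
by case: u v eu ev {hu hv e3 e4} => u1 u2 [v1 v2] /= -> ->.
Qed.

(** * Units of small group algebras *)

(** The three subgroups lemma, as [G, gamma_2(G), G] = gamma_4(G) = 1. *)
Lemma L2_abelian (gT : finGroupType) (G : {group gT}) :
  'L_4(G)%g = 1%g -> abelian 'L_2(G).
Proof.
move=> L4; apply/commG1P.
have e : [~: G, 'L_2(G), G]%g = 1%g by rewrite (commGC G) -!lcnSn.
rewrite {2}lcnSn.
rewrite commGC; apply: three_subgroup => //.
Qed.

Section Units.
Variable S : pzRingType.
Implicit Types u v : unit_group S.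

Definition uval u : S := (val u).1.

Lemma uvalM u v : uval (u * v)%g = uval u * uval v.
Proof. by []. Qed.

Lemma uvalV u : uval u * uval u^-1%g = 1 /\ uval u^-1%g * uval u = 1.
Proof. by rewrite -!uvalM mulgV mulVg. Qed.

Lemma uval_inj : injective uval.
Proof.
move=> u v e; apply: val_inj; have [uu' _] := uvalV u; have [_ v'v] := uvalV v.
have : uval u^-1%g = uval v^-1%g.
  by rewrite -[LHS]mul1r -v'v -mulrA -e uu' mulr1.
case: u v e {uu' v'v} => [[a b] ab] [[c d] cd] /=; rewrite /uval /= => -> ->.
by [].
Qed.

Lemma uvalX u n : uval (u ^+ n)%g = uval u ^+ n.
Proof. by elim: n => // n IHn; rewrite expgS exprS uvalM IHn. Qed.

Lemma unit_exists (x y : S) : x * y = 1 -> y * x = 1 -> exists u, uval u = x.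
Proof.
move=> xy yx; have h : ((x, y).1 * (x, y).2 == 1) && ((x, y).2 * (x, y).1 == 1).
  by rewrite /= xy yx eqxx.
by exists (exist _ (x, y) h).
Qed.

Lemma uvalR u v : uval [~ u, v]%g - 1 =
  uval u^-1%g * uval v^-1%g * (uval u * uval v - uval v * uval u).
Proof.
have e1 : [~ u, v]%g = (u^-1 * v^-1 * (u * v))%g by rewrite commgEl /conjg !mulgA.
have e2 : (u^-1 * v^-1 * (v * u) = 1)%g by rewrite mulgA mulgKV mulVg.
by rewrite e1 mulrBr -!uvalM e2.
Qed.

End Units.

Section UnitSA.
Variables (p : nat) (gT : finGroupType) (S : pzRingType) (i : gT -> S).
Local Notation G := [set: gT]%G.
Hypothesis SA : small_alg p i.
Variable eps : {additive S -> 'F_p}.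
Hypothesis epsi : forall g, eps (i g) = 1.
Let pr_p := sa_prime SA.

Lemma uni_subproof g : ((i g, i g^-1%g).1 * (i g, i g^-1%g).2 == 1) &&
   ((i g, i g^-1%g).2 * (i g, i g^-1%g).1 == 1).
Proof. by have [-> ->] := saV SA g; rewrite eqxx. Qed.

Definition uni g : unit_group S := exist _ (i g, i g^-1%g) (uni_subproof g).

Lemma uval_uni g : uval (uni g) = i g. Proof. by []. Qed.

Lemma uniM g h : uni (g * h)%g = (uni g * uni h)%g.
Proof. by apply: uval_inj; rewrite uvalM !uval_uni (saM SA). Qed.

Lemma uni1 : uni 1%g = 1%g.
Proof. by apply: uval_inj; rewrite uval_uni (sa1 SA). Qed.

Lemma uniV g : uni g^-1%g = (uni g)^-1%g.
Proof. by apply: (mulgI (uni g)); rewrite -uniM !mulgV uni1. Qed.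

Lemma uniR g h : uni [~ g, h]%g = [~ uni g, uni h]%g.
Proof. by rewrite !commgEl /conjg !(uniM, uniV). Qed.

Lemma eps_uval u : eps (uval u) != 0.
Proof.
have [uu _] := uvalV u; have := epsM SA epsi (uval u) (uval u^-1%g).
rewrite uu (eps1 SA epsi) => /esym e; apply: contra_eq_neq e => ->.
by rewrite mul0r eq_sym oner_neq0.
Qed.

Lemma eps_uvalV u : eps (uval u) = 1 -> eps (uval u^-1%g) = 1.
Proof.
move=> eu; have [uu _] := uvalV u; have := epsM SA epsi (uval u) (uval u^-1%g).
by rewrite uu (eps1 SA epsi) eu mul1r.
Qed.

Lemma unit_comm_lie u v : eps (uval u) = 1 -> eps (uval v) = 1 ->
  uval [~ u, v]%g - 1 = uval u * uval v - uval v * uval u.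
Proof.
move=> eu ev; rewrite uvalR; have [n Ln ->] := sa_lie SA epsi (uval u) (uval v).
by rewrite (sa_mulJ SA epsi) // (epsM SA epsi) !eps_uvalV // mulr1.
Qed.

(** If v has augmentation c, then v (u - 1) = c (u - 1), so u v - v u = (u - 1)(v - c). *)
Lemma unit_commJ k u v : Jlay i k.+2 (uval u - 1) ->
  Jlay i k.+3 (uval [~ u, v]%g - 1).
Proof.
move=> Ju; rewrite uvalR; apply: (JMl SA epsi).
have [n Ln e] := Ju.
have -> : uval u * uval v - uval v * uval u =
   (uval u - 1) * (uval v - 1 *+ eps (uval v)).
  rewrite mulrBr mulrnAr mulr1 {2}e -(sa_mulJ SA epsi) ?(lcn_sub2 Ln) // -e.
  by rewrite mulrBl mulrBr mul1r mulr1 opprB addrA subrK.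
apply: (JI SA epsi) => //.
by rewrite raddfB raddfMn (eps1 SA epsi) natr_Zp subrr.
Qed.

Lemma unit_commI2 u v : uval u - 1 \in augI2 eps -> Jlay i 3 (uval [~ u, v]%g - 1).
Proof.
move=> hu; rewrite uvalR; apply: (JMl SA epsi).
have := augI2_lie SA epsi (uval v) hu.
by rewrite mulrBl mulrBr mul1r mulr1 opprB addrA subrK.
Qed.

Lemma J2I2 j q : 'L_4(G)%g = 1%g -> Jlay i 2 j -> q \in augI2 eps ->
  j * q = 0 /\ q * j = 0.
Proof.
move=> L4 Jj qI; split; last exact: (IJ0 SA epsi (augI2_eps SA epsi qI) Jj).
move: q qI; apply: idealM_ind => [|a b ea eb|a b /eqP ea /eqP eb]; first exact: mulr0.
  by rewrite mulrDr ea eb addr0.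
rewrite mulrA; apply: (J4_0 SA L4); apply: (JI SA epsi) => //.
exact: (JI SA epsi).
Qed.

(* The second term of the upper central series of the unit group. *)
Definition cent2 (u : unit_group S) := forall v w, [~ [~ u, v], w]%g = 1%g.

Lemma cent2_I2 u : 'L_4(G)%g = 1%g -> uval u - 1 \in augI2 eps -> cent2 u.
Proof.
move=> L4 hu v w; apply: uval_inj; apply/eqP; rewrite -subr_eq0; apply/eqP.
by apply: (J4_0 SA L4); apply: unit_commJ; apply: unit_commI2.
Qed.

End UnitSA.

Lemma cent2M (S : pzRingType) (u v : unit_group S) : cent2 u -> cent2 v -> cent2 (u * v)%g.
Proof.
move=> cu cv a b; apply/eqP/commgP.
have e : [~ u * v, a]%g = ([~ u, a] ^ v * [~ v, a])%g.
  by rewrite !commgEl /conjg !invMg !mulgA !mulgK.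
have cc w : cent2 w -> forall x, commute [~ w, a]%g x.
  by move=> cw x; apply/commgP; rewrite cw.
have -> : [~ u * v, a]%g = ([~ u, a] * [~ v, a])%g.
  by rewrite e; congr (_ * _)%g; apply/conjg_fixP/eqP/cu.
by apply/commute_sym/commuteM; apply/commute_sym/cc.
Qed.

Section MorphFacts.
Variables (U V : groupType) (f : U -> V).
Hypothesis fM : {morph f : x y / (x * y)%g}.

Lemma morph_fun1 : f 1%g = 1%g.
Proof. by apply: (mulgI (f 1%g)); rewrite -fM !mulg1. Qed.

Lemma morph_funV x : f x^-1%g = (f x)^-1%g.
Proof. by apply: (mulgI (f x)); rewrite -fM !mulgV morph_fun1. Qed.

Lemma morph_funR x y : f [~ x, y]%g = [~ f x, f y]%g.
Proof. by rewrite !commgEl /conjg !(fM, morph_funV). Qed.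

Lemma morph_funX x n : f (x ^+ n)%g = (f x ^+ n)%g.
Proof. by elim: n => [|n IHn]; rewrite ?expg0 ?morph_fun1 // !expgS fM IHn. Qed.
End MorphFacts.

(** A commutator minus 1 is a left multiple of an additive commutator, and these lie in the second
    layer for arbitrary elements of S. *)
Lemma hom_L2 p (gT hT : finGroupType) (S : pzRingType)
    (i : gT -> S) (j : hT -> S) n : small_alg p i ->
  j 1%g = 1 -> (forall g h, j (g * h)%g = j g * j h) -> n \in 'L_2([set: hT])%g ->
  exists2 m, m \in 'L_2([set: gT])%g & j n = i m.
Proof.
move=> SA j1 jM Ln; have [eps e1] := sa_eps_exists SA.
have gQ : group_set [set n | [exists m in 'L_2([set: gT])%g, j n == i m]].
  apply/group_setP; split=> [|a b]; rewrite !inE.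
    by apply/exists_inP; exists 1%g; rewrite ?group1 // j1 (sa1 SA).
  move=> /exists_inP[a' La' /eqP ea] /exists_inP[b' Lb' /eqP eb].
  apply/exists_inP; exists (a' * b')%g; first exact: groupM.
  by rewrite jM ea eb (saM SA).
have sQ : 'L_2([set: hT])%g \subset Group gQ.
  rewrite gen_subG; apply/subsetP=> _ /imset2P[a b _ _ ->]; rewrite inE.
  have [m Lm em] := JMl SA e1 (j (a^-1 * b^-1)%g) (sa_lie SA e1 (j a) (j b)).
  apply/exists_inP; exists m; rewrite // -(subrK 1 (i m)) -em mulrBr -!jM.
  have -> : [~ a, b]%g = (a^-1 * b^-1 * (a * b))%g by rewrite commgEl /conjg !mulgA.
  have -> : (a^-1 * b^-1 * (b * a) = 1)%g by rewrite mulgA mulgKV mulVg.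
  by rewrite j1 subrK.
by have := subsetP sQ n Ln; rewrite inE => /exists_inP[m Lm /eqP em]; exists m.
Qed.

Lemma unit_map_L2 p (gT hT : finGroupType) (S1 S2 : pzRingType)
    (i : gT -> S1) (j : hT -> S2) (SA1 : small_alg p i) (SA2 : small_alg p j)
    (f : unit_group S2 -> unit_group S1) n :
  {morph f : x y / (x * y)%g} -> n \in 'L_2([set: hT])%g ->
  exists2 m, m \in 'L_2([set: gT])%g & f (uni SA2 n) = uni SA1 m.
Proof.
move=> fM Ln; have [||m Lm em] := hom_L2 (j := fun h => uval (f (uni SA2 h))) SA1 _ _ Ln.
- by rewrite uni1 (morph_fun1 fM).
- by move=> g h; rewrite uniM fM.
by exists m => //; apply: uval_inj.
Qed.

(** * The correspondence given by an isomorphism of unit groups *)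

Section SmallAlgIsom.
Variables (p : nat) (gT hT : finGroupType) (S1 S2 : pzRingType).
Variables (i : gT -> S1) (j : hT -> S2).
Hypotheses (SA1 : small_alg p i) (SA2 : small_alg p j).
Local Notation G := [set: gT]%G.
Local Notation H := [set: hT]%G.
Hypotheses (p_odd : odd p) (pG : p.-group G) (pH : p.-group H).
Hypotheses (L4G : 'L_4(G)%g = 1%g) (L4H : 'L_4(H)%g = 1%g).
Hypothesis expG : forall n, n \in 'L_2(G)%g -> (n ^+ p = 1)%g.
Hypothesis expH : forall n, n \in 'L_2(H)%g -> (n ^+ p = 1)%g.
Hypothesis PhiZ2 : 'Phi(G)%g = 'Z_2(G)%g.
Variables (psi : unit_group S2 -> unit_group S1) (phi : unit_group S1 -> unit_group S2).
Hypotheses (psiK : cancel psi phi) (phiK : cancel phi psi).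
Hypothesis psiM : {morph psi : x y / (x * y)%g}.
Variables (eps1 : {additive S1 -> 'F_p}) (eps2 : {additive S2 -> 'F_p}).
Hypotheses (e1 : forall g, eps1 (i g) = 1) (e2 : forall g, eps2 (j g) = 1).
Let pr_p := sa_prime SA1.

Let phiM : {morph phi : x y / (x * y)%g}.
Proof. by move=> x y; apply: (can_inj psiK); rewrite psiM !phiK. Qed.

Let abG := L2_abelian L4G.
Let abH := L2_abelian L4H.
Let iI : injective i := sa_inj SA1 expG abG.
Let jI : injective j := sa_inj SA2 expH abH.
Let uH := uni SA2.
Let uG := uni SA1.

Definition eta h : S1 := uval (psi (uH h)).

Lemma etaM g h : eta (g * h)%g = eta g * eta h.
Proof. by rewrite /eta /uH uniM psiM uvalM. Qed.

Lemma eta_eps h : eps1 (eta h) = 1.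
Proof.
have /p_natP[e oH] : p.-nat #|H| by [].
apply: (sa_pelt_eps SA1 e1 (e := e)).
have uX n : uH (h ^+ n)%g = (uH h ^+ n)%g.
  by elim: n => [|n IHn]; rewrite ?expg0 /uH ?uni1 // !expgS uniM -/uH IHn.
rewrite /eta -uvalX -(morph_funX psiM) -uX -oH expg_cardG ?inE //.
by rewrite /uH uni1 (morph_fun1 psiM).
Qed.

Lemma unit_eps2 g : eps2 (uval (phi (uG g))) = 1.
Proof.
have /p_natP[e oG] : p.-nat #|G| by [].
apply: (sa_pelt_eps SA2 e2 (e := e)).
have uX n : uG (g ^+ n)%g = (uG g ^+ n)%g.
  by elim: n => [|n IHn]; rewrite ?expg0 /uG ?uni1 // !expgS uniM -/uG IHn.
rewrite -uvalX -(morph_funX phiM) -uX -oG expg_cardG ?inE //.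
by rewrite /uG uni1 (morph_fun1 phiM).
Qed.

(** By [nufP] the default 1 is never taken on gamma_2(H). *)
Definition nuf n : gT := odflt 1%g [pick m in 'L_2(G)%g | i m == eta n].

Lemma nufP n : n \in 'L_2(H)%g -> nuf n \in 'L_2(G)%g /\ i (nuf n) = eta n.
Proof.
move=> Ln; rewrite /nuf; case: pickP => [m /andP[Lm /eqP em] //|].
have [m Lm em] := unit_map_L2 SA1 SA2 psiM Ln.
by move/(_ m); rewrite Lm /= /eta /uH em eqxx.
Qed.

Fact corr_group : group_set [set d : gT * hT | eta d.2 - i d.1 \in augI2 eps1].
Proof.
apply/group_setP; split=> [|[g h] [g' h']]; rewrite !inE /=.
  by rewrite /eta /uH uni1 (morph_fun1 psiM) (sa1 SA1) subrr idealM0.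
move=> hg hg'; rewrite etaM (saM SA1).
have -> : eta h * eta h' - i g * i g' = (eta h - i g) * eta h' + i g * (eta h' - i g').
  by rewrite mulrBl mulrBr addrA subrK.
by apply: idealMD; [apply: (augI2Mr SA1 e1) | apply: (augI2Ml SA1 e1)].
Qed.

Definition corr_gp := Group corr_group.

Lemma corr_gpP g h : ((g, h) \in corr_gp) = (eta h - i g \in augI2 eps1).
Proof. by rewrite inE. Qed.

Lemma corr_gp_pow h e : (0 < e)%N -> (h ^+ (p ^ e))%g \in 'L_2(H)%g ->
  exists2 g, (g, h) \in corr_gp & (g ^+ (p ^ e))%g = nuf (h ^+ (p ^ e))%g.
Proof.
move=> e_gt0 Lh; have [Ln en] := nufP Lh.
have etaX n : eta (h ^+ n)%g = eta h ^+ n.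
  elim: n => [|n IHn]; last by rewrite expgS exprS etaM IHn.
  by rewrite expg0 /eta /uH uni1 (morph_fun1 psiM).
have [|g [hg eg]] := sa_pow_lift p_odd pG SA1 e1 L4G expG abG e_gt0 (eta_eps h) Ln.
  by rewrite en etaX.
by exists g; rewrite ?corr_gpP.
Qed.

Lemma cent2_Phi g : cent2 (uG g) -> g \in 'Phi(G)%g.
Proof.
move=> cg; rewrite PhiZ2 ucnSnR; apply/setIdP; split; first by rewrite inE.
rewrite gen_subG; apply/subsetP=> _ /imset2P[x y /set1P-> _ ->].
rewrite /= ucn1; apply/centerP; split=> [|z _]; first by rewrite inE.
apply/commgP/eqP/iI; have := congr1 (@uval S1) (cg (uG y) (uG z)).
by rewrite /uG -!uniR uval_uni (sa1 SA1).
Qed.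

Lemma cent2_psi u : cent2 u -> cent2 (psi u).
Proof.
move=> cu a b; rewrite -(phiK a) -(phiK b) -!(morph_funR psiM) cu.
exact: (morph_fun1 psiM).
Qed.

(** [psi] is known to preserve the second centre, not 1 + I^2. Write phi(g) = h (1 + q) and psi(h) =
    g1 (1 + q1): then g1^-1 g lies in the second centre, hence in Z_2(G) = Phi(G), whose elements
    are 1 modulo I^2. *)
Lemma corr_gp_fst g : exists h, (g, h) \in corr_gp.
Proof.
have [h [q [xE qI _]]] := sa_decomp SA2 e2 (unit_eps2 g).
exists h.
pose t := ((uH h)^-1 * phi (uG g))%g.
have ct : cent2 t.
  apply: (cent2_I2 SA2 e2 L4H).
  rewrite /t uvalM xE -uniV uval_uni.
  have [_ V] := saV SA2 h.
  by rewrite mulrA V mul1r addrC addKr.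
have [g1 [q1 [yE q1I hg1]]] := sa_decomp SA1 e1 (eta_eps h).
pose s := ((uG g1)^-1 * psi (uH h))%g.
have cs : cent2 s.
  apply: (cent2_I2 SA1 e1 L4G).
  rewrite /s uvalM -[uval (psi _)]/(eta h) yE -uniV uval_uni.
  have [_ V] := saV SA1 g1.
  by rewrite mulrA V mul1r addrC addKr.
have eg : uG (g1^-1 * g)%g = (s * psi t)%g.
  rewrite /s /t psiM phiK (morph_funV psiM) -mulgA mulKVg.
  by rewrite /uG uniM uniV.
have Pg : (g1^-1 * g)%g \in 'Phi(G)%g.
  by apply: cent2_Phi; rewrite eg; apply: cent2M => //; apply: cent2_psi.
rewrite corr_gpP.
have -> : eta h - i g = (eta h - i g1) - i g1 * (i (g1^-1 * g)%g - 1).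
  by rewrite mulrBr mulr1 -(saM SA1) mulKVg opprB addrA subrK.
apply: (augI2B SA1 e1) => //; apply: (augI2Ml SA1 e1).
exact: (sa_Phi_I2 pG SA1 e1).
Qed.

Lemma corr_gp_ker g : ((g, 1%g) \in corr_gp) = (g \in 'Phi(G)%g).
Proof.
rewrite corr_gpP /eta /uH uni1 (morph_fun1 psiM).
apply/idP/idP => [hg|/(sa_Phi_I2 pG SA1 e1) hg].
  apply: cent2_Phi; apply: (cent2_I2 SA1 e1 L4G).
  by rewrite uval_uni -opprB; apply: (augI2N SA1 e1).
by rewrite -opprB; apply: (augI2N SA1 e1).
Qed.

Lemma lieB (S : pzRingType) (x a y : S) :
  x * y - y * x - (a * y - y * a) = (x - a) * y - y * (x - a).
Proof. by rewrite mulrBl mulrBr !opprD !opprK addrACA. Qed.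

Lemma eta_uvalR h h' : eta [~ h, h']%g - 1 = eta h * eta h' - eta h' * eta h.
Proof.
by rewrite {1}/eta /uH uniR (morph_funR psiM) (unit_comm_lie SA1 e1) ?eta_eps.
Qed.

Lemma i_uvalR g g' : i [~ g, g']%g - 1 = i g * i g' - i g' * i g.
Proof.
rewrite -[i [~ g, g']%g]/(uval (uG _)) /uG uniR.
by rewrite (unit_comm_lie SA1 e1) ?uval_uni ?e1.
Qed.

(** Replacing eta h by i g and then eta h' by i g' changes the additive commutator by brackets with
    elements of I^2, which lie in the third layer. *)
Lemma corr_gp_comm g g' h h' : (g, h) \in corr_gp -> (g', h') \in corr_gp ->
  ([~ g, g']^-1 * nuf [~ h, h'])%g \in 'L_3(G)%g.
Proof.
rewrite !corr_gpP => hg hg'.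
have [Lc ec] := nufP (comL2 h h').
have Ja := augI2_lie SA1 e1 (eta h') hg.
have Jb := JN SA1 e1 (augI2_lie SA1 e1 (i g) hg').
have : Jlay i 3 (i (nuf [~ h, h'])%g - i [~ g, g']%g).
  have -> : i (nuf [~ h, h'])%g - i [~ g, g']%g =
    (eta [~ h, h']%g - 1) - (i [~ g, g']%g - 1) by rewrite ec opprB addrA subrK.
  rewrite eta_uvalR i_uvalR.
  have := JD SA1 e1 Ja Jb; rewrite -!lieB.
  rewrite -[eta h' * i g - _]opprB -[i g' * i g - _]opprB.
  move: (i g * eta h' - _) (i g * i g' - _) (eta h * _ - _) => P Q X.
  by rewrite [- (- P - _)]opprB opprK [- Q + _]addrC addrA subrK.
case/(JMl SA1 e1 (i [~ g, g']^-1%g)) => n Ln.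
rewrite mulrBr -!(saM SA1) mulVg (sa1 SA1) => /addIr/iI en.
by rewrite en.
Qed.

(** I^2 annihilates the second layer from both sides, so eta h and i g have the same brackets with
    it. *)
Lemma corr_gp_comm3 n g h : n \in 'L_2(H)%g -> (g, h) \in corr_gp ->
  nuf [~ n, h]%g = [~ nuf n, g]%g.
Proof.
rewrite corr_gpP => Ln hg; apply: iI; apply: (addIr (-1)).
have [_ ->] := nufP (comL2 n h); have [Lm em] := nufP Ln.
rewrite eta_uvalR i_uvalR -em; set m := nuf n.
have Jm : Jlay i 2 (i m - 1) by exists m.
have [mq qm] := J2I2 SA1 e1 L4G Jm hg.
suff e : eta h * i m - i m * eta h = i g * i m - i m * i g.
  by rewrite -opprB e opprB.
apply/eqP; rewrite -subr_eq0 lieB.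
move: (eta h - i g) mq qm => q /eqP; rewrite mulrBl mul1r subr_eq0 => /eqP-> /eqP.
by rewrite mulrBr mulr1 subr_eq0 => /eqP->.
Qed.

Lemma unit_correspondence : (#|H : 'L_2(H)%g| <= #|G : 'L_2(G)%g|)%N ->
  correspondence p nuf corr_gp.
Proof.
move=> cardA; split=> //.
- exact: (sa_L3Z L4G).
- exact: (sa_MhoZ p_odd pG SA1 e1 L4G expG abG).
- move=> x y Lx Ly; apply: iI; have [_ ->] := nufP (groupM Lx Ly).
  by rewrite (saM SA1) (proj2 (nufP Lx)) (proj2 (nufP Ly)) etaM.
- move=> x y Lx Ly exy; have := proj2 (nufP Lx); rewrite exy (proj2 (nufP Ly)).
  by move/uval_inj/(can_inj psiK)/(congr1 (@uval S2))/jI.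
- by move=> n /nufP[].
- by move=> n /nufP[_ en]; rewrite corr_gpP en subrr idealM0.
- exact: corr_gp_fst.
- exact: corr_gp_ker.
- exact: corr_gp_comm.
- exact: corr_gp_comm3.
have phiL m : m \in 'L_2(G)%g -> exists2 n, n \in 'L_2(H)%g & phi (uG m) = uH n.
  exact: unit_map_L2.
pose f m := odflt 1%g [pick n in 'L_2(H)%g | phi (uG m) == uH n].
have fP m : m \in 'L_2(G)%g -> f m \in 'L_2(H)%g /\ phi (uG m) = uH (f m).
  move=> Lm; rewrite /f; case: pickP => [n /andP[Ln /eqP en] //|].
  by have [n Ln en] := phiL m Lm; move/(_ n); rewrite Ln en eqxx.
rewrite -(card_in_imset (f := f)).
  by apply/subset_leq_card/subsetP=> _ /imsetP[m /fP[Lm _] ->].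
move=> x y Lx Ly exy; have := proj2 (fP x Lx); rewrite exy -(proj2 (fP y Ly)).
by move/(can_inj phiK)/(congr1 (@uval S1))/iI.
Qed.

Lemma unit_index : (#|H : 'L_2(H)%g| <= #|G : 'L_2(G)%g|)%N.
Proof.
have unitS x : eps2 x != 0 -> exists u, uval u = x.
  move=> /(sa_unit pH SA2 e2 L4H)[y [xy yx]]; exact: unit_exists xy yx.
(* [psi] is extended by 0 to non-units; the count evaluates it at elements of non-zero augmentation,
   which are units. *)
have [psi' psi'E] : exists psi' : S2 -> S1, forall u, psi' (uval u) = uval (psi u).
  have h x : exists y, forall u, uval u = x -> y = uval (psi u).
    have [[u ux]|nu] := pselect (exists u, uval u = x).
      exists (uval (psi u)) => v vx; congr (uval (psi _)); apply: uval_inj.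
      by rewrite ux vx.
    by exists 0 => u ux; case: nu; exists u.
  by have [f fE] := choice h; exists f => u; apply: fE.
pose B := {n : gT | n \in 'L_2(G)%g}.
have b0 : B by exists 1%g; apply: group1.
have j1P (b : B) : exists2 n, n \in 'L_2(H)%g & phi (uG (val b)) = uH n.
  exact: (unit_map_L2 SA2 SA1 phiM (valP b)).
pose j1 (b : B) : S2 := uval (phi (uG (val b))) - 1.
pose j2 (x : S1) : B := insubd b0 (odflt 1%g [pick n in 'L_2(G)%g | x == i n - 1]).
have j2E x : Jlay i 2 x -> x = i (val (j2 x)) - 1.
  case=> n Ln ->; rewrite /j2; case: pickP => [m /andP[Lm /eqP em]|/(_ n)].
    by rewrite val_insubd Lm.
  by rewrite Ln eqxx.
apply: (@sa_count p gT hT S1 S2 i j eps1 eps2 psi' B b0 j1 j2) => //.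
- move=> x y /unitS[u <-] /unitS[v <-]; rewrite !psi'E => /uval_inj/(can_inj psiK).
  by move=> ->.
- by move=> x /unitS[u <-]; rewrite psi'E; apply: (eps_uval SA1 e1).
- by move=> b; have [n Ln en] := j1P b; exists n => //; rewrite /j1 en.
- by move=> a b /addIr/uval_inj/(can_inj phiK)/(congr1 (@uval S1))/iI/val_inj.
by move=> x y /j2E ex /j2E ey exy; rewrite ex exy -ey.
Qed.

Lemma small_alg_isom (K : {group gT}) x y z : G \subset <<[set x; y; z]>>%g ->
  (forall v w, bad_pair v w ->
     K :=: ([set v; w] <*> 'Phi(G))%g /\ 'L_3(G)%g \subset [~: K, 'L_2(G)]%g) ->
  exists2 f : gT -> hT, {morph f : a b / (a * b)%g} & bijective f.
Proof.
move=> sG hK; have C := unit_correspondence unit_index.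
have PhiC : 'Phi(G)%g \subset 'C('L_2(G))%g.
  rewrite (Phi_joing pG) join_subG; apply/andP; split; first exact: abG.
  apply: subset_trans (sa_MhoZ p_odd pG SA1 e1 L4G expG abG) _.
  by rewrite (subset_trans (subsetIr _ _)) // centS ?subsetT.
exact: (correspondence_isom C p_odd corr_gp_pow PhiC sG hK).
Qed.

End SmallAlgIsom.

Local Open Scope fset_scope.
Local Open Scope quotient_scope.
Local Open Scope ring_scope.

(** * Group algebras *)

Section MalgLift.
Variables (k : fieldType) (T : choiceType) (f : T -> k).

Definition malg_lift (u : {malg k[T]}) : k := \sum_(t <- msupp u) u@_t * f t.

Lemma malg_liftEw (d : {fset T}) (u : {malg k[T]}) :
  msupp u `<=` d -> malg_lift u = \sum_(t <- d) u@_t * f t.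
Proof.
move=> le; apply: big_fset_incl => // t _ /mcoeff_outdom ->.
by rewrite mul0r.
Qed.

Fact malg_lift_is_zmod_morphism : zmod_morphism malg_lift.
Proof.
move=> x y; rewrite (malg_liftEw (msuppB_le x y)).
rewrite (malg_liftEw (fsubsetUl (msupp x) (msupp y))).
rewrite (malg_liftEw (fsubsetUr (msupp x) (msupp y))) -sumrB.
by apply/eq_bigr => g _; rewrite mcoeffB mulrBl.
Qed.
HB.instance Definition _ :=
  GRing.isZmodMorphism.Build {malg k[T]} k malg_lift malg_lift_is_zmod_morphism.

Lemma malg_liftU c t : malg_lift << c *g t >> = c * f t.
Proof. by rewrite (malg_liftEw msuppU_le) big_seq_fset1 mcoeffUU. Qed.

End MalgLift.

(** Coefficients in the prime field are multiples of 1, so the basis elements generate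
    additively. *)
Lemma malg_ind p (T : choiceType) (P : {malg 'F_p[T]} -> Prop) :
  P 0 -> (forall u t, P u -> P (u + << t >>)) -> forall u, P u.
Proof.
move=> P0 PD u; rewrite [u]monalgE; elim: (X in \sum_(i <- X) _) => [|t s IHs].
  by rewrite big_nil.
rewrite big_cons addrC.
have -> : << u@_t *g t >> = << t >> *+ u@_t :> {malg 'F_p[T]}.
  by rewrite -{1}[u@_t]natr_Zp -monalgUMn.
by elim: (X in _ *+ X) => [|n IHn]; rewrite ?mulr0n ?addr0 // mulrSr addrA; apply: PD.
Qed.

Section GalgBasis.
Variables (p : nat) (H : groupType).
Local Notation A := (galg 'F_p H).
Local Notation e g := (<< g >> : A).

Lemma galg1 : e 1%g = 1. Proof. by []. Qed.

Lemma galgM g h : e (g * h)%g = e g * e h.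
Proof. by rewrite [RHS]galg_mulUU mulr1. Qed.

Lemma galg_ind_aug (P : A -> Prop) : prime p ->
  P 0 -> (forall a g, P a -> P (a + (e g - 1))) -> forall a, aug a = 0 -> P a.
Proof.
move=> pr_p P0 PD a ea; suff : P (a - 1 *+ aug a) by rewrite ea subr0.
move: a {ea}; apply: malg_ind => [|u g Pu]; first by rewrite raddf0 subr0.
have -> : aug (u + e g : A) = aug u + 1 by rewrite raddfD /= augU.
have -> : (1 : A) *+ (aug u + 1)%R = 1 *+ aug u + 1.
  rewrite mulrn_FpD // -[1 *+ p]/(<< 1%g >> *+ p) -monalgUMn.
  by rewrite pchar_Fp_0 // monalgU0.
by rewrite opprD addrACA; apply: PD.
Qed.
End GalgBasis.

Definition small_pi p (gT : finGroupType) (a : galg 'F_p gT) : small_galg 'F_p gT :=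
  \pi_(ring_quot (TwoSidedIdeal.clone (galg 'F_p gT) (@small_ideal 'F_p gT) _)) a.

Section SmallGalg.
Variables (p : nat) (gT : finGroupType).
Hypothesis pr_p : prime p.
Local Notation A := (galg 'F_p gT).
Local Notation S := (small_galg 'F_p gT).
Local Notation G := [set: gT]%G.
Local Notation e g := (<< g >> : A).
Local Notation pi := (@small_pi p gT).

Definition small_embed (g : gT) : S := pi (e g).

Lemma small_piK (x : S) : pi (repr x) = x.
Proof. exact: reprK. Qed.

Lemma small_piD (a b : A) : pi (a + b) = pi a + pi b.
Proof. exact: pi_ring_quotD. Qed.
Lemma small_pi1 : pi 1 = 1.
Proof. by []. Qed.
Lemma small_piM (a b : A) : pi (a * b) = pi a * pi b.
Proof. by rewrite [RHS]pi_ring_quotM. Qed.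
Lemma small_pi0 : pi 0 = 0.
Proof. by apply: (addrI (pi 0)); rewrite -small_piD !addr0. Qed.
Lemma small_piN (a : A) : pi (- a) = - pi a.
Proof. by apply: (addrI (pi a)); rewrite -small_piD !subrr small_pi0. Qed.
Lemma small_piB (a b : A) : pi (a - b) = pi a - pi b.
Proof. by rewrite small_piD small_piN. Qed.
Lemma small_piMn (a : A) n : pi (a *+ n) = pi a *+ n.
Proof. by elim: n => [|n IHn]; rewrite ?small_pi0 // !mulrS small_piD IHn. Qed.
Lemma small_pi_eq0 (a : A) : (pi a == 0) = (a \in @small_ideal 'F_p gT).
Proof. by rewrite -small_pi0 [LHS]pi_ring_quot_eq subr0. Qed.

Lemma aug_gen g (N : {set gT}) : g \in N -> 1%g \in N -> e g - 1 \in @aug_ideal 'F_p gT N.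
Proof.
move=> Ng N1; apply/aug_idealP; split=> [h Nh|].
  rewrite mcoeffB !mcoeffU.
  have -> : (g == h) = false by apply: contraNF Nh => /eqP<-.
  have -> : (1%g == h) = false by apply: contraNF Nh => /eqP<-.
  by rewrite subrr.
by rewrite raddfB /= augU -galg1 augU subrr.
Qed.

Lemma small_ext (F : {additive A -> 'F_p}) :
  (forall a g, aug a = 0 -> g \in 'L_2(G)%g -> F (a * (e g - 1)) = 0) ->
  exists F' : {additive S -> 'F_p}, forall a, F' (pi a) = F a.
Proof.
move=> F0.
have Fi : {in @small_ideal 'F_p gT, forall a, F a = 0}.
  apply: idealM_ind => [|a b Fa Fb|a b]; first exact: raddf0.
    by rewrite raddfD Fa Fb addr0.
  rewrite aug_idealT => /eqP ea /aug_idealP[bN eb].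
  (* F(a (g - 1)) = 0 gives F(a g) = F(a) on the support of [b], whence F(a b) = F(a) aug(b) = 0. *)
  have Fg g : g \in msupp b -> F (a * << b@_g *g g >>) = F a * b@_g.
    move=> bg; have Lg : g \in 'L_2(G)%g.
      by apply: contraLR bg => /bN; rewrite -mcoeff_eq0 => /eqP.
    have -> : << b@_g *g g >> = e g *+ b@_g :> A.
      by rewrite -{1}[b@_g]natr_Zp -monalgUMn.
    rewrite mulrnAr raddfMn -(subrK 1 (e g)) mulrDr mulr1 raddfD F0 // add0r.
    by rewrite -mulr_natr natr_Zp.
  rewrite [X in a * X]monalgE mulr_sumr raddf_sum big_seq.
  under eq_bigr => g bg do rewrite Fg //.
  by rewrite -big_seq -mulr_sumr -/(aug b) eb mulr0.
pose F' (x : S) := F (repr x).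
have F'E a : F' (pi a) = F a.
  apply/eqP; rewrite -subr_eq0 -raddfB; apply/eqP/Fi.
  by rewrite -small_pi_eq0 small_piB small_piK subrr.
have F'D : zmod_morphism F'.
  by move=> x y; rewrite -[x]small_piK -[y]small_piK -small_piB !F'E raddfB.
pose H := GRing.isZmodMorphism.Build S 'F_p F' F'D.
by exists (HB.pack F' H : {additive S -> 'F_p}).
Qed.

Lemma sg_ind (P : S -> Prop) :
  P 0 -> (forall x g, P x -> P (x + small_embed g)) -> forall x, P x.
Proof.
move=> P0 PD x; rewrite -[x]small_piK; move: (repr x).
apply: malg_ind => [|u g Pu]; first by rewrite small_pi0.
by rewrite small_piD; apply: PD.
Qed.

Lemma small_galg_small_alg : small_alg p small_embed.
Proof.
split=> //.
- by move=> g h; rewrite /small_embed galgM small_piM.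
- exact: sg_ind.
- rewrite -small_pi1 -small_piMn -[1 *+ p]/(<< 1%g >> *+ p) -monalgUMn.
  by rewrite pchar_Fp_0 // monalgU0 small_pi0.
- move=> g n Ln; rewrite /small_embed -small_pi1 -!small_piB -small_piM; apply/eqP.
  rewrite small_pi_eq0; apply: idealM1; apply: aug_gen => //; rewrite ?inE //.
- move=> chi chiP.
  have [F FE] : exists F : {additive A -> 'F_p}, forall h, F (e h) = chi h.
    by exists (malg_lift chi) => h; rewrite /= malg_liftU mul1r.
  have [|F' F'E] := small_ext (F := F); last by exists F' => g; rewrite /small_embed F'E.
  move=> a n ea Ln; move: a ea.
  apply: (galg_ind_aug (P := fun a => F (a * (e n - 1)) = 0) pr_p) => [|a g IH].
    by rewrite mul0r raddf0.
  have -> : (a + (e g - 1)) * (e n - 1) =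
      a * (e n - 1) + (e (g * n)%g - e g - (e n - e 1%g)).
    by rewrite mulrDl; congr (_ + _); rewrite mulrBl mul1r mulrBr mulr1 -galgM.
  rewrite (raddfD F) IH add0r !(raddfB F) !FE.
  by rewrite opprB addrACA chiP // -opprD subrr.
Qed.

End SmallGalg.

(** * The subgroup K_G *)

Section Ext2.
Variables (p : nat) (V : finGroupType).
Local Notation F := {malg 'F_p[(V * V)%type]}.
Local Notation E := (ext2 'F_p V).
Local Notation pi := (\pi_(ext2 'F_p V) : F -> E).

Lemma ext2_pi_eq (u v : F) : (pi u == pi v) = (ext2_nullb (u - v)).
Proof. by rewrite [RHS](@Quotient.idealrBE F (GRing.ZmodClosed.clone F (@ext2_nullb 'F_p V) _)). Qed.

Lemma ext2_piD (u v : F) : pi (u + v) = pi u + pi v.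
Proof. exact: (@Quotient.pi_add F (GRing.ZmodClosed.clone F (@ext2_nullb 'F_p V) _)). Qed.

Lemma ext2_pi0 : pi 0 = 0.
Proof. by apply: (addrI (pi 0)); rewrite -ext2_piD !addr0. Qed.

Lemma ext2_piB (u v : F) : pi (u - v) = pi u - pi v.
Proof. by apply/eqP; rewrite eq_sym subr_eq -ext2_piD subrK. Qed.

Lemma ext2_ind (P : E -> Prop) :
  P 0 -> (forall u x y, P u -> P (u + wedge 'F_p x y)) -> forall u, P u.
Proof.
move=> P0 PD u; rewrite -[u]reprK; move: (repr u).
apply: malg_ind => [|v [x y] Pv]; first by rewrite ext2_pi0.
by rewrite ext2_piD; apply: PD.
Qed.

Lemma ext2_functional (w : V -> V -> 'F_p) :
  (forall x y z, w (x * y)%g z = w x z + w y z) ->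
  (forall x y z, w x (y * z)%g = w x y + w x z) ->
  (forall x, w x x = 0) ->
  exists W : {additive E -> 'F_p}, forall x y, W (wedge 'F_p x y) = w x y.
Proof.
move=> wDl wDr w0.
have [L LE] : exists L : {additive F -> 'F_p}, forall c x y, L << c *g (x, y) >> = c * w x y.
  by exists (malg_lift (fun t : V * V => w t.1 t.2)) => c x y; rewrite /= malg_liftU.
have LZ a u : L (a *: u) = a * L u.
  have -> : a *: u = u *+ a.
    by rewrite -{1}[a]natr_Zp scaler_nat.
  by rewrite raddfMn -mulr_natl natr_Zp.
have Ln u : ext2_null u -> L u = 0.
  elim=> {u} [|u v _ Lu _ Lv|a u _ Lu|x y z|x y z|x].
  - exact: raddf0.
  - by rewrite raddfB Lu Lv subrr.
  - by rewrite LZ Lu mulr0.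
  - by rewrite !(raddfB L) !LE !mul1r wDl addrAC addrK subrr.
  - by rewrite !(raddfB L) !LE !mul1r wDr addrAC addrK subrr.
  by rewrite LE mul1r w0.
pose W (x : E) := L (repr x).
have WE u : W (pi u) = L u.
  apply/eqP; rewrite -subr_eq0 -raddfB; apply/eqP/Ln/asboolP.
  by rewrite -[asbool _]/(ext2_nullb _) -ext2_pi_eq reprK.
have WD : zmod_morphism W.
  by move=> x y; rewrite -[x]reprK -[y]reprK -ext2_piB !WE raddfB.
pose H := GRing.isZmodMorphism.Build E 'F_p W WD.
exists (HB.pack W H : {additive E -> 'F_p}) => x y.
by rewrite [LHS]WE LE mul1r.
Qed.

End Ext2.

Lemma three_generators p (gT : finGroupType) (G : {group gT}) :
  prime p -> p.-group G -> #|G : 'Phi(G)%g| = (p ^ 3)%N ->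
  exists x y z, G \subset <<[set x; y; z]>>%g.
Proof.
move=> pr_p pG oG; have abE := Phi_quotient_abelem pG.
have nP : G \subset 'N('Phi(G)) := gFnorm _ G.
have [B genB cB] := grank_witness (G / 'Phi(G))%G.
rewrite /= grank_abelian ?(abelem_abelian abE) // (rank_abelem abE) in cB.
rewrite card_quotient // oG pfactorK // in cB.
have [a [b [c eB]]] : exists a b c, B = [set a; b; c].
  have : size (enum B) = 3 by rewrite -cardE.
  case e : (enum B) => [|a [|b [|c [|]]]] // _; exists a, b, c.
  by apply/setP=> x; rewrite -mem_enum e !inE orbA.
have BN x : x \in B -> exists2 g, g \in G & x = coset 'Phi(G)%g g.
  move=> Bx; have : x \in (G / 'Phi(G))%g by rewrite -genB mem_gen.
  by case/morphimP=> g _ Gg ->; exists g.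
have [|x Gx ea] := BN a; first by rewrite eB !inE eqxx.
have [|y Gy eb] := BN b; first by rewrite eB !inE eqxx ?orbT.
have [|z Gz ec] := BN c; first by rewrite eB !inE eqxx ?orbT.
exists x, y, z; rewrite -{1}(Phi_nongen (G := G) (X := [set x; y; z])) //.
set X := [set x; y; z]; pose M := ('Phi(G) <*> X)%G.
have sX : X \subset G by rewrite !subUset !sub1set Gx Gy Gz.
have sM : M \subset G by rewrite join_subG Phi_sub sX.
apply/eqP; rewrite eqEsubset sM /=.
have sP : 'Phi(G)%g \subset M by apply: joing_subl.
rewrite -(quotientSGK nP sP) -genB gen_subG eB.
have XM t : t \in X -> coset 'Phi(G)%g t \in (M / 'Phi(G))%g.
  by move=> Xt; apply: mem_quotient; apply: (subsetP (joing_subr _ _)).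
by rewrite !subUset !sub1set ea eb ec !XM // !inE eqxx ?orbT.
Qed.

Section KG.
Variables (p : nat) (gT : finGroupType).
Local Notation G := [set: gT]%G.
Hypotheses (pr_p : prime p) (pG : p.-group G).
Hypotheses (PhiZ2 : 'Phi(G)%g = 'Z_2(G)%g) (oZ2 : #|G : 'Z_2(G)%g| = (p ^ 3)%N).
Variable K : {group gT}.
Hypothesis KG : is_KG p G K.

Let sZK : 'Phi(G)%g \subset K.
Proof. by case: KG => [+ _ _ _]; rewrite PhiZ2. Qed.

Let nGam x : x \in 'N(Gam G)%g.
Proof.
have : Gam G <| G by apply: normalI; [apply: center_normal | apply: lcn_normal].
by move/normal_norm/subsetP; apply; rewrite inE.
Qed.

(** If K = G, all wedges come from K, so every commutator is central and G = Z_2(G). *)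
Lemma KG_neq : K :!=: G.
Proof.
apply/eqP => eK; case: KG => _ _ [i [c [iE [cM cE] _ cK _]]] _.
have comZ x y : [~ x, y]%g \in 'Z(G)%g.
  have Gx t : coset 'Z_2(G)%g t \in (G / 'Z_2(G))%g by rewrite mem_quotient ?inE.
  have Kx t : coset 'Z_2(G)%g t \in (K / 'Z_2(G))%g by rewrite mem_quotient ?eK ?inE.
  have e := cE x y (in_setT _) (in_setT _).
  have e2 := iE (subg _ (coset 'Z_2(G)%g x)) (subg _ (coset 'Z_2(G)%g y)).
  rewrite !subgK // in e2.
  rewrite -e2 in e.
  have e3 : coset (Gam G) [~ x, y]%g = 1%g by rewrite -e; apply/cK; exists (wedge 'F_p (subg (K / 'Z_2(G)) (coset 'Z_2(G) x)) (subg (K / 'Z_2(G)) (coset 'Z_2(G) y)))%g.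
  have : [~ x, y]%g \in Gam G.
    exact: coset_idr (nGam _) e3.
  by case/setIP.
have eZ : 'Z_2(G)%g = G.
  apply/eqP; rewrite eqEsubset subsetT; apply/subsetP=> x _.
  rewrite ucnSnR; apply/setIdP; split; first by rewrite inE.
  rewrite gen_subG; apply/subsetP=> _ /imset2P[_ y /set1P-> _ ->].
  by rewrite /= ucn1.
have : (p ^ 0 < p ^ 3)%N by rewrite ltn_exp2l ?prime_gt1.
by rewrite -oZ2 eZ indexgg.
Qed.

Lemma quo_hom (l : gT -> 'F_p) :
  (forall y z, l (y * z)%g = l y + l z) -> (forall y, y \in 'Phi(G)%g -> l y = 0) ->
  exists l' : coset_of 'Z_2(G)%g -> 'F_p,
    (forall c d, l' (c * d)%g = l' c + l' d) /\ forall x, l' (coset 'Z_2(G)%g x) = l x.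
Proof.
move=> lM l0; have nZ x : x \in 'N('Z_2(G))%g by rewrite (subsetP (ucn_norm _ _)) ?inE.
have lE x y : coset 'Z_2(G)%g x = coset 'Z_2(G)%g y -> l x = l y.
  move=> exy; rewrite -(mulKVg y x) lM [X in _ + X]l0 ?addr0 // PhiZ2.
  apply: coset_idr; first exact: nZ.
  by rewrite morphM ?nZ // morphV ?nZ //= exy mulVg.
exists (fun c => l (fingroup.repr c)); split=> [c d|x]; last first.
  by apply: lE; rewrite coset_reprK.
rewrite -lM; apply: lE.
have E (x : coset_of 'Z_2(G)%g) : coset 'Z_2(G)%g (fingroup.repr x) = x.
  exact: coset_reprK.
by rewrite morphM ?nZ // E /= !E.
Qed.

(** As [v, w] is central, exactness puts the wedge of v and w into the image of the wedge square of
    K. If v were outside K, there would be functionals a vanishing on K and b with a(v) = b(w) = 1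
    and b(v) = 0; the alternating form a(s) b(t) - a(t) b(s) kills that image but is 1 at (v, w). *)
Lemma KG_bad_in v w : bad_pair v w -> v \in K.
Proof.
case/and3P=> Zvw nv nw; apply: contraT => nKv.
have [nKG abK] := Phi_sub_abelem pr_p pG sZK (subsetT K).
have [al [alM alK alv]] := abelem_separate pr_p nKG abK (in_setT v) nKv.
have [be [beM bePhi bev bew]] := Phi_coord pr_p pG nw.
have [||a [aM aE]] := @quo_hom al.
- by move=> y z; apply: alM; rewrite inE.
- by move=> y /(subsetP sZK)/alK.
have [b [bM bE]] := quo_hom beM bePhi.
case: KG => _ _ [i [c [iE [cM cE] _ cK _]]] _.
pose om (s t : [subg G / 'Z_2(G)]%type) :=
  a (sgval s) * b (sgval t) - a (sgval t) * b (sgval s).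
have [|||W WE] := @ext2_functional p _ om.
- by move=> x y z; rewrite /om /= aM bM mulrDl mulrDr opprD addrACA.
- by move=> x y z; rewrite /om /= aM bM mulrDl mulrDr opprD addrACA.
- by move=> x; rewrite /om mulrC subrr.
have Gx t : coset 'Z_2(G)%g t \in (G / 'Z_2(G))%g by rewrite mem_quotient ?inE.
have e := cE v w (in_setT _) (in_setT _).
have Gvw : [~ v, w]%g \in Gam G by apply/setIP; split=> //; apply: comL2.
rewrite (coset_id Gvw) in e.
have [xi exi] := (proj1 (cK _)) e.
have W0 u : W (i u) = 0.
  move: u; apply: ext2_ind => [|u x y Wu]; first by rewrite !raddf0.
  rewrite !raddfD Wu add0r iE WE /om.
  have hK (s : [subg K / 'Z_2(G)]%type) :
     exists2 k, k \in K & sgval (subg (G / 'Z_2(G)) (sgval s)) = coset 'Z_2(G)%g k.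
    have /morphimP[k _ Kk ek] := subgP s.
    by exists k => //; rewrite ek subgK //; apply: Gx.
  have [k Kk ->] := hK x; have [k' Kk' ->] := hK y.
  by rewrite !aE !alK // !mul0r subrr.
have := WE (subg (G / 'Z_2(G)) (coset 'Z_2(G)%g v))%g (subg (G / 'Z_2(G)) (coset 'Z_2(G)%g w))%g.
rewrite exi W0 /om !subgK // !aE !bE alv bew bev mulr0 subr0 mulr1 => /eqP.
by rewrite eq_sym oner_eq0.
Qed.

(** The chain Phi(G) < <w> Phi(G) < <v, w> Phi(G) <= K < G has three strict steps, each of index at
    least p, and total index p^3. *)
Lemma KG_bad v w : bad_pair v w ->
  K :=: ([set v; w] <*> 'Phi(G))%g /\ #|G : K| = p.
Proof.
move=> bvw; have Kv := KG_bad_in bvw.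
have Kw : w \in K.
  apply: (@KG_bad_in w v); case/and3P: bvw => Z nv nw.
  by rewrite /bad_pair nv nw -invg_comm groupV Z.
have /and3P[Z nv nw] := bvw.
pose X := ([set w] <*> 'Phi(G))%G; pose M := ([set v; w] <*> 'Phi(G))%G.
have sPX : 'Phi(G)%g \subset X by apply: joing_subr.
have sXM : X \subset M.
  by rewrite join_subG joing_subr andbT sub1set (subsetP (joing_subl _ _)) // !inE eqxx orbT.
have sMK : M \subset K by rewrite join_subG sZK andbT subUset !sub1set Kv.
have Xw : w \in X by apply: (subsetP (joing_subl _ _)); rewrite inE.
have Mv : v \in M by apply: (subsetP (joing_subl _ _)); rewrite !inE eqxx.
have idx (A B : {group gT}) t : A \subset B -> t \in B -> t \notin A ->
    (p <= #|B : A|)%N.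
  move=> sAB Bt At; have : p.-nat #|B : A|.
    exact: pnat_dvd (dvdn_indexg _ _) (pgroupS (subsetT B) pG).
  case/p_natP=> [[|e] eBA]; last first.
    by rewrite eBA expnS leq_pmulr // expn_gt0 prime_gt0.
  have : B \subset A by rewrite -indexg_eq1 eBA.
  by move/subsetP/(_ t Bt); rewrite (negPf At).
have nwP : w \notin 'Phi(G)%g.
  by apply: contra nw; apply: (subsetP (joing_subr _ _)).
have [g gG gK] : exists2 g, g \in G & g \notin K.
  apply/subsetPn; apply: contra KG_neq => sGK.
  by rewrite eqEsubset subsetT.
have iGK := idx K G g (subsetT K) gG gK.
have iMX := idx X M v sXM Mv nv.
have iXP := idx 'Phi(G)%G X w sPX Xw nwP.
have e : (#|G : K| * (#|K : M| * (#|M : X| * #|X : 'Phi(G)%g|)) = p ^ 3)%N.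
  rewrite !Lagrange_index ?subsetT ?(subset_trans sXM) //.
    by rewrite -oZ2 -PhiZ2.
  exact: subset_trans sPX sXM.
have p_gt0 := prime_gt0 pr_p.
have iKM := indexg_gt0 K M.
split.
  apply/eqP; rewrite eqEsubset sMK andbT -[_ \subset _]/(K \subset M) -indexg_eq1.
  rewrite eqn_leq iKM andbT leqNgt; apply/negP => gt1.
  have : (p ^ 3 < #|G : K| * (#|K : M| * (#|M : X| * #|X : 'Phi(G)%g|)))%N.
    apply: leq_trans (leq_mul iGK (leq_mul gt1 (leq_mul iMX iXP))).
    by rewrite !expnS expn0 muln1 mulnCA ltn_Pmull // !muln_gt0 p_gt0.
  by rewrite e ltnn.
apply/eqP; rewrite eqn_leq iGK andbT leqNgt; apply/negP => gtp.
have : (p ^ 3 < #|G : K| * (#|K : M| * (#|M : X| * #|X : 'Phi(G)%g|)))%N.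
  apply: leq_trans (leq_mul gtp (leq_mul iKM (leq_mul iMX iXP))).
  by rewrite !expnS expn0 muln1 mul1n ltn_pmul2r // !muln_gt0 p_gt0.
by rewrite e ltnn.
Qed.

(** Modulo [K, G] the subgroup K is central with quotient of order p, which makes G / [K, G]
    abelian. *)
Lemma KG_L2 (v w : gT) : bad_pair v w -> ('L_2(G) \subset [~: K, G])%g.
Proof.
case/KG_bad=> _ oGK; have [nKG _] := Phi_sub_abelem pr_p pG sZK (subsetT K).
pose D := [~: K, G]%G.
have nDG : D <| G by rewrite /normal subsetT commg_normr.
have sDK : D \subset K by rewrite commg_subl normal_norm.
apply: der1_min; first exact: normal_norm nDG.
apply: (@cyclic_factor_abelian _ (K / D)%G (G / D)%G).
  by rewrite subsetI quotientS ?subsetT //= quotient_cents2r.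
rewrite (isog_cyclic (third_isog sDK nDG nKG)); apply: prime_cyclic.
by rewrite card_quotient ?normal_norm // oGK.
Qed.

Lemma KG_L3 (v w : gT) : ([~: [~: K, G], G] \subset [~: K, 'L_2(G)])%g ->
  bad_pair v w ->
  K :=: ([set v; w] <*> 'Phi(G))%g /\ 'L_3(G)%g \subset [~: K, 'L_2(G)]%g.
Proof.
move=> sK bvw; split; first by case: (KG_bad bvw).
by apply: subset_trans sK; apply: commSg; apply: KG_L2 bvw.
Qed.
End KG.

(** * The two parts of the theorem *)

(** Serves for a group H that turns out to be finite: the preimages under f list its elements. *)
Lemma finite_group_model (H : groupType) (F : finType) (f : H -> F) : injective f ->
  exists (hT : finGroupType) (th : hT -> H), {morph th : x y / (x * y)%g} /\ bijective th.
Proof.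
move=> fI.
have [s hs] : exists s : seq H, forall h, h \in s.
  exists (pmap (fun y => if pselect (exists h, f h == y) is left e then Some (xchoose e) else None) (enum F)).
  move=> h; rewrite mem_pmap; apply/mapP; exists (f h); first by rewrite mem_enum.
  case: pselect => [e|[]]; last by exists h.
  by congr Some; apply: fI; apply/esym/eqP; apply: (xchooseP e).
pose T : finType := seq_sub s.
pose tr (h : H) : T := SeqSub (hs h).
have trK : cancel tr val by [].
have valK : cancel (val : T -> H) tr by move=> x; apply: val_inj.
pose mul (x y : T) := tr (val x * val y)%g.
pose inv (x : T) := tr (val x)^-1%g.
have mA : associative mul by move=> x y z; apply: val_inj; rewrite /= mulgA.
have m1 : left_id (tr 1%g) mul by move=> x; apply: val_inj; rewrite /= mul1g.
have mV : left_inverse (tr 1%g) inv mul by move=> x; apply: val_inj; rewrite /= mulVg.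
pose G : finGroupType := HB.pack T (Finite_isGroup.Build T mA m1 mV).
exists G, (val : T -> H); split => //.
by exists tr.
Qed.

Lemma group_isomI (G H : groupType) (f : G -> H) :
  {morph f : x y / (x * y)%g} -> bijective f -> group_isom G H.
Proof.
move=> fM fB; pose M := monoid.isMultiplicative.Build G H f fM.
by exists (HB.pack f M : {multiplicative G -> H}).
Qed.

Lemma group_isom_trans (G H K : groupType) : group_isom G H -> group_isom H K -> group_isom G K.
Proof.
move=> [f fB] [g gB]; apply: (@group_isomI _ _ (g \o f)); last exact: bij_comp.
by move=> x y; rewrite /= !gmulfM.
Qed.

Lemma pow_gen_small p (gT : finGroupType) :
  (pow_gen p 'L_2([set: gT]) * 'L_4([set: gT]) = 1)%g ->
  'L_4([set: gT])%g = 1%g /\ forall n, n \in 'L_2([set: gT])%g -> (n ^+ p = 1)%g.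
Proof.
move=> e; split.
  apply/eqP; rewrite eqEsubset sub1G andbT -e.
  by rewrite /pow_gen mulG_subr.
move=> n Ln; apply/set1gP; rewrite -e /pow_gen.
apply: (subsetP (mulG_subl 'L_4([set: gT])%G _)).
by apply: mem_gen; apply/imsetP; exists n.
Qed.

Section Base.
Variables (p : nat) (gT : finGroupType).
Local Notation G := [set: gT]%G.
Hypotheses (p_prime : prime p) (p_odd : odd p) (pG : p.-group G).
Hypothesis G_small : (pow_gen p 'L_2(G) * 'L_4(G) = 1)%g.
Hypothesis G_Phi : #|G : 'Phi(G)%g| = (p ^ 3)%N.
Hypothesis G_Z2 : #|G : 'Z_2(G)%g| = (p ^ 3)%N.
Hypothesis G_class3 : nil_class G = 3%N ->
    exists2 K : {group gT}, is_KG p G K &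
      ([~: [~: K, G], G] \subset [~: K, 'L_2(G)])%g.

Lemma isom_of_small_alg (hT : finGroupType) (S : pzRingType) (j : hT -> S)
    (psi : unit_group S -> unit_group (small_galg 'F_p gT)) :
  p.-group [set: hT] -> 'L_4([set: hT])%g = 1%g ->
  (forall n, n \in 'L_2([set: hT])%g -> (n ^+ p = 1)%g) -> small_alg p j ->
  {morph psi : x y / (x * y)%g} -> bijective psi -> group_isom gT hT.
Proof.
move=> pH L4H expH SA2 psiM [phi psiK phiK].
have [L4G expG] := pow_gen_small G_small.
have SA1 := small_galg_small_alg gT p_prime.
have [eps1 e1] := sa_eps_exists SA1; have [eps2 e2] := sa_eps_exists SA2.
have abG := L2_abelian L4G.
have PhiZ2 : 'Phi(G)%g = 'Z_2(G)%g.
  apply/eqP; rewrite eqEcard; apply/andP; split.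
    rewrite (Phi_joing pG) join_subG; apply/andP; split.
      apply/subsetP=> n Ln; rewrite /= ucnSnR; apply/setIdP; split; first by rewrite inE.
      rewrite gen_subG; apply/subsetP=> _ /imset2P[_ y /set1P-> _ ->].
      by rewrite /= ucn1 (subsetP (sa_L3Z L4G)) ?comL3.
    apply: subset_trans (sa_MhoZ p_odd pG SA1 e1 L4G expG abG) _.
    by rewrite -ucn1 ucn_subS.
  by rewrite -(leq_pmul2r (indexg_gt0 G 'Phi(G))) (Lagrange (Phi_sub G)) G_Phi -G_Z2 Lagrange ?ucn_sub.
have [x [y [z sG]]] := three_generators p_prime pG G_Phi.
have nilG := pgroup_nil pG.
(* Class at most 2 would mean Z_2(G) = G, against |G : Z_2(G)| = p^3. *)
have cl3 : nil_class G = 3%N.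
  apply/eqP; rewrite eqn_leq; apply/andP; split; first exact/(lcn_nil_classP _ nilG).
  rewrite ltnNge; apply/negP => /(ucn_nil_classP _ nilG) eZ.
  have : (p ^ 0 < p ^ 3)%N by rewrite ltn_exp2l ?prime_gt1.
  by rewrite -G_Z2 eZ indexgg.
have [K KG sK] := G_class3 cl3.
have [f fM fB] := small_alg_isom SA1 SA2 p_odd pG pH L4G L4H expG expH PhiZ2 psiK phiK psiM e1 e2 sG
  (fun v w => @KG_L3 p gT p_prime pG PhiZ2 G_Z2 K KG v w sK).
exact: group_isomI fM fB.
Qed.

Lemma isom_of_unit_group (hT : finGroupType) :
  p.-group [set: hT] ->
  (pow_gen p 'L_2([set: hT]) * 'L_4([set: hT]) = 1)%g ->
  group_isom (unit_group (small_galg 'F_p gT)) (unit_group (small_galg 'F_p hT)) ->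
  group_isom gT hT.
Proof.
move=> pH H_small [f [psi fK psiK]]; have [L4H expH] := pow_gen_small H_small.
apply: (isom_of_small_alg (psi := psi) pH L4H expH (small_galg_small_alg hT p_prime)).
  by move=> x y; apply: (can_inj fK); rewrite gmulfM !psiK.
by exists f.
Qed.

End Base.

(* The layers [L_k - 1] do not depend on the group basis of the small algebra. *)
Lemma Jlay_transfer p (gT hT : finGroupType) (S : pzRingType) (i : gT -> S) (j : hT -> S) k n :
  small_alg p i -> small_alg p j -> n \in 'L_k.+2([set: hT])%g -> Jlay i k.+2 (j n - 1).
Proof.
move=> SA1 SA2; have [eps1 e1] := sa_eps_exists SA1; have [eps2 e2] := sa_eps_exists SA2.
elim: k n => [|k IHk] n.
  case/(hom_L2 SA1 (sa1 SA2) (saM SA2)) => m Lm ->; by exists m.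
pose Q := [set n in 'L_2([set: hT])%g | `[< Jlay i k.+3 (j n - 1) >]].
have gQ : group_set Q.
  apply/group_setP; split=> [|a b].
    by apply/setIdP; split; rewrite ?group1 //; apply/asboolP; rewrite (sa1 SA2) subrr; exact: (J0 SA1).
  move=> /setIdP[La /asboolP ha] /setIdP[Lb /asboolP hb].
  apply/setIdP; split; first exact: groupM.
  by apply/asboolP; rewrite (sa_L2M SA2 e2) //; apply: (JD SA1 e1).
have sQ : 'L_k.+3([set: hT])%g \subset Group gQ.
  rewrite gen_subG; apply/subsetP=> _ /imset2P[a b La _ ->].
  apply/setIdP; split; first exact: comL2.
  apply/asboolP; rewrite -(uval_uni SA2) uniR.
  by apply: (unit_commJ SA1 e1); rewrite uval_uni; apply: IHk.
by move/(subsetP sQ)/setIdP=> [_ /asboolP].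
Qed.

(** [l] is known to be injective on its gamma_2 and measures the second layer of S for both other
    groups; injectivity of the map from H is deduced afterwards from this result. *)
Lemma same_index (p : nat) (gT hT : finGroupType) (S : pzRingType) (i : gT -> S) (j : hT -> S)
    (kT : finGroupType) (l : kT -> S) :
  p.-group [set: hT] -> small_alg p i -> small_alg p j -> small_alg p l -> {in 'L_2([set: kT])%g &, injective l} ->
  (#|[set: hT] : 'L_2([set: hT])%g| <= #|[set: gT] : 'L_2([set: gT])%g|)%N.
Proof.
move=> pH SA1 SA2 SA3 lI; have [eps1 e1] := sa_eps_exists SA1; have [eps2 e2] := sa_eps_exists SA2.
pose B := {n : kT | n \in 'L_2([set: kT])%g}.
have b0 : B by exists 1%g; apply: group1.
pose j1 (b : B) : S := l (val b) - 1.
pose j2 (x : S) : B := insubd b0 (odflt 1%g [pick n in 'L_2([set: kT])%g | x == l n - 1]).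
have j2E x : Jlay i 2 x -> x = l (val (j2 x)) - 1.
  case=> m Lm ->; have [n Ln ->] := Jlay_transfer SA3 SA1 Lm.
  rewrite /j2; case: pickP => [n' /andP[Ln' /eqP en']|/(_ n)].
    by rewrite val_insubd Ln'.
  by rewrite Ln eqxx.
(* p-elements have augmentation 1, so the two augmentations of S coincide. *)
have eq_eps x : eps2 x = eps1 x.
  have e1j h : eps1 (j h) = 1.
    have /p_natP[e oH] : p.-nat #|[set: hT]| by [].
    apply: (sa_pelt_eps SA1 e1 (e := e)).
    by rewrite -(sa_X SA2) -oH expg_cardG ?inE // (sa1 SA2).
  move: x; apply: (sa_ind SA2) => [|x h IH]; first by rewrite !raddf0.
  by rewrite !raddfD IH e1j e2.
apply: (@sa_count p gT hT S S i j eps1 eps2 id B b0 j1 j2) => //.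
- by move=> x; rewrite eq_eps.
- by move=> b; apply: (Jlay_transfer SA2 SA3); apply: (valP b).
- by move=> a b /addIr e; apply/val_inj/lI => //; apply: valP.
by move=> x y /j2E ex /j2E ey exy; rewrite ex exy -ey.
Qed.

(** Compares the numbers p^|X| and p^|Y| of coefficient functions. *)
Lemma card_malg_inj p (X Y : finType) (T U : choiceType) (a : X -> T) (b : Y -> U)
    (f : {malg 'F_p[T]} -> {malg 'F_p[U]}) :
  prime p -> injective a -> (forall u, exists y, u = b y) -> injective f -> (#|X| <= #|Y|)%N.
Proof.
move=> pr_p aI bS fI.
pose s (F : {ffun X -> 'F_p}) : {malg 'F_p[T]} := \sum_x << F x *g a x >>.
have sE F x : (s F)@_(a x) = F x.
  rewrite raddf_sum (bigD1 x) //= mcoeffUU big1 ?addr0 // => y nyx.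
  by rewrite mcoeffU (inj_eq aI) (negPf nyx) mulr0n.
pose g (F : {ffun X -> 'F_p}) : {ffun Y -> 'F_p} := [ffun y => (f (s F))@_(b y)].
have gI : injective g.
  move=> F1 F2 /ffunP e; apply/ffunP=> x; rewrite -!sE; congr (_@__); apply: fI.
  by apply/malgP=> u; have [y ->] := bS u; have := e y; rewrite !ffunE.
have := leq_card g gI.
by rewrite !card_ffun card_Fp // leq_exp2l // prime_gt1.
Qed.

(** * From an isomorphism of group algebras to a common small algebra *)

Section GroupAlgebraIsom.
Variables (p : nat) (gT hT : finGroupType) (H : groupType) (th : hT -> H).
Hypotheses (pr_p : prime p) (thM : {morph th : x y / (x * y)%g}) (thB : bijective th).
Variables (f : {rmorphism galg 'F_p gT -> galg 'F_p H}) (g : galg 'F_p H -> galg 'F_p gT).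
Hypotheses (fK : cancel f g) (gK : cancel g f).
Hypotheses (pG : p.-group [set: gT]) (pH : p.-group [set: hT]).
Local Notation G := [set: gT]%G.
Local Notation A := (galg 'F_p gT).
Local Notation B := (galg 'F_p H).
Local Notation e h := (<< h >> : B).

Definition small_image (h : hT) : small_galg 'F_p gT := small_pi (g (e (th h))).

Let gI : injective g := can_inj gK.
Let fI : injective f := can_inj fK.

Lemma inv_isomM (x y : B) : g (x * y) = g x * g y.
Proof. by apply: fI; rewrite rmorphM !gK. Qed.

Lemma inv_isomD (x y : B) : g (x + y) = g x + g y.
Proof. by apply: (fI); rewrite gK (rmorphD f) !gK.
Qed.

Lemma inv_isom1 : g 1 = 1.
Proof. by apply: fI; rewrite rmorph1 gK. Qed.

Lemma inv_isom0 : g 0 = 0.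
Proof. by apply: fI; rewrite rmorph0 gK. Qed.

Lemma small_imageM x y : small_image (x * y)%g = small_image x * small_image y.
Proof. by rewrite /small_image thM galgM inv_isomM small_piM. Qed.

Lemma small_image1 : small_image 1%g = 1.
Proof. by rewrite /small_image (morph_fun1 thM) galg1 inv_isom1 small_pi1. Qed.

Lemma small_image_ind (P : small_galg 'F_p gT -> Prop) :
  P 0 -> (forall x h, P x -> P (x + small_image h)) -> forall x, P x.
Proof.
move=> P0 PD x; rewrite -[x]small_piK -[repr x]fK; move: (f _).
apply: malg_ind => [|u h Pu]; first by rewrite inv_isom0 small_pi0.
case: thB => th' _ th'K; rewrite inv_isomD small_piD -[h]th'K.
exact: PD.
Qed.

Lemma aug_isom a : aug (f a) = aug a.
Proof.
have /p_natP[k oG] : p.-nat #|G| by [].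
have fe x : aug (f (<< x >> : A)) = 1.
  rewrite -(Fp_expX k (aug _) pr_p) -!rmorphXn /=.
  have -> : (<< x >> : A) ^+ (p ^ k) = 1.
    have eX n : (<< x >> : A) ^+ n = << (x ^+ n)%g >>.
      by elim: n => [|n IHn]; rewrite ?expr0 ?expg0 // exprS expgS IHn -galgM.
    by rewrite eX -oG expg_cardG ?inE.
  by rewrite !rmorph1.
move: a; apply: malg_ind => [|u x IH]; first by rewrite !raddf0.
by rewrite !raddfD /= IH fe augU.
Qed.

(* Modulo the ideal generated by the elements h - 1 with h in L_2(H), the group
   algebra of H is commutative, so [f] sends n - 1 into this ideal. *)
Lemma isom_L2_killed (L : {additive B -> 'F_p}) (chi : hT -> 'F_p) x n :
  (forall h, L (e (th h)) = chi h) ->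
  (forall h m, m \in 'L_2([set: hT])%g -> chi (h * m)%g + chi 1%g = chi h + chi m) ->
  aug x = 0 -> n \in 'L_2(G)%g -> L (x * f ((<< n >> : A) - 1)) = 0.
Proof.
move=> LE chiP ax Ln; case: (thB) => th' _ th'K.
have th1 := morph_fun1 thM.
(* [Z] is a left ideal; it will contain m - 1 for m in gamma_2(H) and all additive commutators. *)
pose Z (z : B) := forall y, aug y = 0 -> L (y * z) = 0.
have Z0 : Z 0 by move=> y _; rewrite mulr0 raddf0.
have ZD a b : Z a -> Z b -> Z (a + b).
  by move=> Za Zb y ay; rewrite (mulrDr y) (raddfD L) (Za y ay) (Zb y ay) addr0.
have Zl a b : Z b -> Z (a * b).
  by move=> Zb y ay; rewrite mulrA; apply: Zb; rewrite rmorphM /= ay mul0r.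
have Zm m : m \in 'L_2([set: hT])%g -> Z (e (th m) - 1).
  move=> Lm y; move: y.
  apply: (galg_ind_aug (P := fun y => L (y * (e (th m) - 1)) = 0) pr_p) => [|y h IH].
    by rewrite mul0r raddf0.
  rewrite -[h]th'K.
  have -> : (y + (e (th (th' h)) - 1)) * (e (th m) - 1) = y * (e (th m) - 1) +
      (e (th (th' h * m)%g) - e (th (th' h)) - (e (th m) - e (th 1%g))).
    rewrite mulrDl; congr (_ + _); rewrite thM galgM th1 galg1.
    by rewrite mulrBl mul1r mulrBr mulr1.
  rewrite (raddfD L) IH add0r !(raddfB L) !LE.
  by rewrite opprB addrACA chiP // -opprD subrr.
have Zc u v : Z (u * v - v * u).
  have add a b c : Z (a * c - c * a) -> Z (b * c - c * b) ->
      Z ((a + b) * c - c * (a + b)).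
    by rewrite mulrDl mulrDr opprD addrACA; apply: ZD.
  have sym a b : Z (a * b - b * a) -> Z (b * a - a * b).
    by move=> /(Zl (-1)); rewrite mulN1r opprB.
  have zero a : Z (0 * a - a * 0) by rewrite mul0r mulr0 subrr.
  apply: (malg_ind (P := fun u : B => Z (u * v - v * u))) => [|{}u a IH]; first exact: zero.
  apply: (add u); first exact: IH.
  apply: (malg_ind (P := fun v : B => Z (e a * v - v * e a))) => [|{IH}v b IH].
    exact/(sym 0)/zero.
  apply: (sym (v + e b)); apply: add; apply: (sym); first exact: IH.
  clear IH; rewrite -[a]th'K -[b]th'K; move: (th' a) (th' b) => {}a {}b.
  have -> : e (th a) * e (th b) - e (th b) * e (th a) =
      e (th (b * a)%g) * (e (th [~ a, b]%g) - 1).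
    by rewrite mulrBr mulr1 -!galgM -!thM -commgC.
  by apply/Zl/Zm/comL2.
have gQ : group_set [set n | `[< Z (f ((<< n >> : A) - 1)) >]].
  apply/group_setP; split=> [|a b]; rewrite !inE.
    by apply/asboolP; rewrite galg1 subrr rmorph0.
  move=> /asboolP Za /asboolP Zb; apply/asboolP.
  have -> : (<< (a * b)%g >> : A) - 1 = ((<< a >> : A) - 1) + (<< a >> : A) * ((<< b >> : A) - 1).
    by rewrite mulrBr mulr1 galgM [RHS]addrC [RHS]addrA subrK.
  rewrite (rmorphD f) (rmorphM f); exact: (ZD _ _ Za (Zl _ _ Zb)).
have sQ : 'L_2(G)%g \subset Group gQ.
  rewrite gen_subG; apply/subsetP=> _ /imset2P[a b _ _ ->]; rewrite inE.
  apply/asboolP.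
  have -> : (<< [~ a, b]%g >> : A) - 1 = (<< (a^-1 * b^-1)%g >> : A) *
      ((<< a >> : A) * (<< b >> : A) - (<< b >> : A) * (<< a >> : A)).
    rewrite mulrBr -!galgM.
    have -> : [~ a, b]%g = (a^-1 * b^-1 * (a * b))%g by rewrite commgEl /conjg !mulgA.
    by have -> : (a^-1 * b^-1 * (b * a) = 1)%g by rewrite mulgA mulgKV mulVg.
  rewrite (rmorphM f) (rmorphB f) !(rmorphM f); exact: (Zl _ _ (Zc _ _)).
by have := subsetP sQ n Ln; rewrite inE => /asboolP Zn; apply: Zn.
Qed.

(** The condition [sa_ext] holds because the linear extension of [chi] to the group algebra of H,
    composed with f, kills the small ideal of G. *)
Lemma small_image_small_alg : small_alg p small_image.
Proof.
have SA1 := small_galg_small_alg gT pr_p; have [eps e1] := sa_eps_exists SA1.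
have esh h : eps (small_image h) = 1.
  have /p_natP[k oH] : p.-nat #|[set: hT]| by [].
  apply: (sa_pelt_eps SA1 e1 (e := k)).
  have shX n : small_image (h ^+ n)%g = small_image h ^+ n.
    by elim: n => [|n IHn]; rewrite ?expg0 ?small_image1 // expgS small_imageM IHn exprS.
  by rewrite -shX -oH expg_cardG ?inE // small_image1.
split=> //; [exact: small_image1 | exact: small_imageM | exact: small_image_ind | exact: (sa_p SA1) | | ].
  move=> h n Ln; have [m Lm ->] := hom_L2 SA1 small_image1 small_imageM Ln.
  apply: (IJ0 SA1 e1); last by exists m.
  by rewrite raddfB esh (eps1 SA1 e1) subrr.
move=> chi chiP; case: (thB) => th' thK th'K.
have [L LE] : exists L : {additive B -> 'F_p}, forall h, L (e (th h)) = chi h.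
  by exists (malg_lift (chi \o th')) => h; rewrite /= malg_liftU mul1r /= thK.
have [F FE] : exists F : {additive A -> 'F_p}, forall a, F a = L (f a).
  by exists (L \o f).
have [|F' F'E] := small_ext (F := F).
  move=> a n ea Ln; rewrite FE rmorphM; apply: isom_L2_killed LE chiP _ Ln.
  by rewrite aug_isom.
by exists F' => h; rewrite /small_image F'E FE gK LE.
Qed.

End GroupAlgebraIsom.

Section GroupAlgebraPart.
Variables (p : nat) (gT : finGroupType).
Local Notation G := [set: gT]%G.
Hypotheses (p_prime : prime p) (p_odd : odd p) (pG : p.-group G).
Hypothesis G_small : (pow_gen p 'L_2(G) * 'L_4(G) = 1)%g.
Hypothesis G_Phi : #|G : 'Phi(G)%g| = (p ^ 3)%N.
Hypothesis G_Z2 : #|G : 'Z_2(G)%g| = (p ^ 3)%N.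
Hypothesis G_class3 : nil_class G = 3%N ->
    exists2 K : {group gT}, is_KG p G K &
      ([~: [~: K, G], G] \subset [~: K, 'L_2(G)])%g.

(** The relations gamma_2(H)^p = gamma_4(H) = 1 are not given. Equal orders and equal indices yield
    |gamma_2(H)| = |gamma_2(G)|, so the surjection [m] is injective; then [j] is injective on
    gamma_2(H), and the relations can be read off in S. *)
Lemma isom_of_small_image (H : groupType) (hT : finGroupType) (th : hT -> H)
    (f : {rmorphism galg 'F_p gT -> galg 'F_p H}) (g : galg 'F_p H -> galg 'F_p gT) :
  {morph th : x y / (x * y)%g} -> bijective th -> cancel f g -> cancel g f ->
  p.-group [set: hT] -> #|hT| = #|gT| -> group_isom gT hT.
Proof.
move=> thM thB fK gK pH oH; have [L4G expG] := pow_gen_small G_small.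
have SA1 := small_galg_small_alg gT p_prime; have [eps1 e1] := sa_eps_exists SA1.
have SA2 : small_alg p (small_image th g) by apply: small_image_small_alg fK gK pG pH.
have iI : injective (small_embed p (gT := gT)) := sa_inj SA1 expG (L2_abelian L4G).
have iI2 : {in 'L_2(G)%g &, injective (small_embed p (gT := gT))} by move=> x y _ _; apply: iI.
have oL : #|'L_2([set: hT])%g| = #|'L_2(G)%g|.
  have ix : #|[set: hT] : 'L_2([set: hT])%g| = #|G : 'L_2(G)%g|.
    apply/eqP; rewrite eqn_leq (same_index pH SA1 SA2 SA1 iI2).
    exact: (same_index pG SA2 SA1 SA1 iI2).
  apply/eqP; rewrite -(eqn_pmul2r (indexg_gt0 G 'L_2(G))) Lagrange ?lcn_sub //.
  by rewrite -ix Lagrange ?lcn_sub // !cardsT oH.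
pose j := small_image (p := p) th g.
have [m mL mE] : exists2 m : hT -> gT, {in 'L_2([set: hT])%g, forall n, m n \in 'L_2(G)%g} &
    {in 'L_2([set: hT])%g, forall n, j n = small_embed p (m n)}.
  exists (fun n => odflt 1%g [pick x in 'L_2(G)%g | j n == small_embed p x]) => n Ln;
    case: pickP => [x /andP[Lx /eqP ex] //|];
    have [x Lx ex] := hom_L2 SA1 (small_image1 thM fK gK) (small_imageM thM fK gK) Ln;
    by move/(_ x); rewrite Lx -/j -ex eqxx.
have mS : m @: 'L_2([set: hT])%g = 'L_2(G)%g.
  apply/eqP; rewrite eqEsubset; apply/andP; split.
    by apply/subsetP=> _ /imsetP[n Ln ->]; apply: mL.
  apply/subsetP=> x Lx; have [n Ln en] := hom_L2 SA2 (sa1 SA1) (saM SA1) Lx.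
  by apply/imsetP; exists n => //; apply: iI; rewrite -mE.
have mI : {in 'L_2([set: hT])%g &, injective m} by apply/imset_injP; rewrite mS oL.
have jI n : n \in 'L_2([set: hT])%g -> j n = 1 -> n = 1%g.
  move=> Ln jn; apply: mI; rewrite ?group1 //.
  by apply: iI; rewrite -!mE ?group1 // jn /j (sa1 SA2).
have expH n : n \in 'L_2([set: hT])%g -> (n ^+ p = 1)%g.
  move=> Ln; apply: jI; first exact: groupX.
  by rewrite /j (sa_X SA2) -/(j n) mE // -(sa_X SA1) expG ?mL // (sa1 SA1).
have L4H : 'L_4([set: hT])%g = 1%g.
  apply/trivgP/subsetP=> n Ln; apply/set1gP/jI.
    by apply: subsetP Ln; apply: lcn_sub_leq.
  apply/eqP; rewrite -subr_eq0; apply/eqP.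
  exact: J4_0 SA1 L4G _ (Jlay_transfer SA1 SA2 Ln).
apply: (isom_of_small_alg p_prime p_odd pG G_small G_Phi G_Z2 G_class3 (psi := id) pH L4H expH SA2) => //.
by exists id.
Qed.

Lemma isom_of_group_algebra (H : groupType) :
  ring_isom (galg 'F_p gT) (galg 'F_p H) -> group_isom gT H.
Proof.
case=> f [g fK gK].
have gI : injective g := can_inj gK.
pose F := [the finType of {ffun gT -> 'F_p}].
(* The coefficients of the preimage of h determine h, so H injects into a finite set. *)
have [|hT [th [thM thB]]] := @finite_group_model H F (fun h => [ffun x => (g << h >>)@_x]).
  move=> h1 h2 /ffunP e; have /gI/malgP/(_ h1) : g << h1 >> = g << h2 >>.
    by apply/malgP=> x; have := e x; rewrite !ffunE.
  rewrite !mcoeffU eqxx; case: eqP => // _ /eqP; by rewrite oner_eq0.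
case: (thB) => th' thK th'K.
have oH : #|hT| = #|gT|.
  apply/eqP; rewrite eqn_leq; apply/andP; split.
    apply: (card_malg_inj (a := th) (b := id) p_prime) gI; first exact: can_inj thK.
    by move=> u; exists u.
  apply: (card_malg_inj (a := id) (b := th) p_prime) (can_inj fK) => // u.
  by exists (th' u).
have pH : p.-group [set: hT] by rewrite /pgroup cardsT oH -cardsT.
exact: group_isom_trans (isom_of_small_image thM thB fK gK pH oH) (group_isomI thM thB).
Qed.

End GroupAlgebraPart.

Close Scope ring_scope.
Close Scope quotient_scope.
Close Scope fset_scope.

Theorem theorem3p5 (p : nat) (gT : finGroupType)
  (p_prime : prime p) (p_odd : odd p)
  (pG : p.-group [set: gT])
  (G_small : pow_gen p 'L_2([set: gT]) * 'L_4([set: gT]) = 1)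
  (G_Phi : #|[set: gT] : 'Phi([set: gT])| = (p ^ 3)%N)
  (G_Z2 : #|[set: gT] : 'Z_2([set: gT])| = (p ^ 3)%N)
  (G_class3 : nil_class [set: gT] = 3 ->
    exists2 K : {group gT}, is_KG p [set: gT]%G K &
      [~: [~: K, [set: gT]], [set: gT]] \subset [~: K, 'L_2([set: gT])]) :
  (forall hT : finGroupType,
     p.-group [set: hT] ->
     pow_gen p 'L_2([set: hT]) * 'L_4([set: hT]) = 1 ->
     group_isom (unit_group (small_galg 'F_p gT))
                (unit_group (small_galg 'F_p hT)) ->
     group_isom gT hT)
  /\ (forall H : groupType,
        ring_isom (galg 'F_p gT) (galg 'F_p H) -> group_isom gT H).
Proof.
split; first exact: isom_of_unit_group.
exact: isom_of_group_algebra.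
Qed.
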